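(* There exist universal constants $c, C>0$ such that the following holds for every $\kappa\ge C$ and every $0<\varepsilon\le c$. (i) Let $T\ge 1$ be an integer and consider any (possibly randomized) $T$-query algorithm with access to the oracle $x\mapsto (Ax,A^\top x)$. If for every dimension $n$, every $b\in\mathbb{R}^n$ and every nonsingular $A\in\mathbb{R}^{n\times n}$ with condition number at most $\kappa$ the algorithm satisfies $$\mathbb{P}_{\mathrm{Alg}}\left(\|Ax_T-b\|\le \varepsilon\|b\|\right)\ge \tfrac23,$$ then $$T\ \ge\ c\,\kappa\log(1/\varepsilon).$$ (ii) The same conclusion $T\ge c\,\kappa\log(1/\varepsilon)$ already holds if the success guarantee is only required for every $b$ and every symmetric matrix $A=UDU^\top$, with $U$ orthogonal and $D$ diagonal with all diagonal entries in $[-\kappa,-1]\cup[1,\kappa]$, even if $D$ is revealed to the algorithm in advance and even if the algorithm uses the more powerful oracle $x\mapsto (Ax,U^\top x)$. (iii) The lower bound (in both forms) holds already in dimension $n=\Omega(T^2)$: for any fixed dimension $n\ge C T^2$, it suffices that the success guarantee is required only for matrices of size $n\times n$ and $b\in\mathbb{R}^n$.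
   Context: $\|\cdot\|$ is the Euclidean norm. The condition number of a nonsingular matrix is the ratio of its largest to its smallest singular value. Oracle model: a $T$-query algorithm knows the dimension $n$ and observes $b\in\mathbb{R}^n$ (and, where stated, the diagonal matrix $D$), and accesses the unknown matrix only through an oracle. At each iteration $t=1,\ldots,T$ it chooses a query vector $x_t\in\mathbb{R}^n$ as an arbitrary (measurable) function of the information obtained so far (that is, of $b$, of $D$ if revealed, of the previous queries and oracle responses) and, if randomized, of its internal randomness, which is independent of the input; it then receives the oracle's response at $x_t$. There is no restriction on computation. The output of the algorithm is its last query $x_T$. $\mathbb{P}_{\mathrm{Alg}}$ denotes probability over the algorithm's internal randomness, for a fixed input. In the oracle $x\mapsto(Ax,U^\top x)$, the input consists of $b$ together with a pair $(U,D)$, where $A=UDU^\top$, and the guarantee is required for every such $(U,D)$. *)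

(* Defs.v *)
From HB Require Import structures.
From mathcomp Require Import all_boot all_order all_algebra.
From mathcomp Require Import all_classical all_reals all_analysis.

Set Implicit Arguments.
Unset Strict Implicit.
Unset Printing Implicit Defensive.

Import Order.TTheory GRing.Theory Num.Theory.

Local Open Scope classical_set_scope.
Local Open Scope ring_scope.

Definition measure_matrix_display : measure_display -> measure_display.
Proof. exact. Qed.

(* 'M[T]_(m, n) carries the product sigma-algebra, i.e. the one generated by the
   m * n entry maps; for T := R this is the Borel sigma-algebra of R^(m * n). *)
Section measurable_matrix.
Context {d : measure_display} {T : measurableType d} {m n : nat}.

Definition entry_cylinders : set_system 'M[T]_(m, n) :=
  [set X | exists ij : 'I_m * 'I_n,
     preimage_set_system setT (fun M : 'M[T]_(m, n) => M ij.1 ij.2)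
       measurable X].

Let measurable_matrix0 : <<s entry_cylinders >> set0.
Proof. exact: sigma_algebra0. Qed.

Let measurable_matrixC X :
  <<s entry_cylinders >> X -> <<s entry_cylinders >> (~` X).
Proof. by move=> mX; rewrite -setTD; exact: sigma_algebraCD. Qed.

Let measurable_matrix_bigcup (F : (set 'M[T]_(m, n))^nat) :
  (forall i, <<s entry_cylinders >> (F i)) ->
  <<s entry_cylinders >> (\bigcup_i F i).
Proof. exact: sigma_algebra_bigcup. Qed.

HB.instance Definition _ := @isMeasurable.Build (measure_matrix_display d)
  'M[T]_(m, n) <<s entry_cylinders >>
  measurable_matrix0 measurable_matrixC measurable_matrix_bigcup.

End measurable_matrix.

Section linear_algebra.
Context {R : realType} {n : nat}.

(* The library norm on matrices is the sup norm. *)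
Definition euclidean_norm (v : 'cV[R]_n) : R :=
  Num.sqrt (\sum_(i < n) v i ord0 ^+ 2).

Definition singular_values (A : 'M[R]_n) : set R :=
  [set s | 0 <= s /\ eigenvalue (A^T *m A) (s ^+ 2)].

(* The set of singular values is finite, so sup and inf are max and min. *)
Definition condition_number (A : 'M[R]_n) : R :=
  sup (singular_values A) / inf (singular_values A).

Definition orthogonal_mx (U : 'M[R]_n) : Prop := U^T *m U = 1%:M.

End linear_algebra.

(* An algorithm in dimension n for oracles 'cV_n -> 'cV_n * 'cV_n. I is the type
   of the data revealed before the first query. The randomness is drawn once, as
   a point of [coins]. [query t] produces the query that follows t oracle calls,
   from the coins, the revealed data and the t (query, response) pairs obtained
   so far; measurability is joint in all of these. The number of queries actually
   made is a parameter of [output], not of the algorithm. *)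
Record algorithm (R : realType) (n : nat) (d : measure_display)
    (I : measurableType d) := Algorithm {
  coins_display : measure_display;
  coins : measurableType coins_display;
  coins_prob : probability coins R;
  query : forall t : nat,
    coins * I * t.-tuple ('cV[R]_n * ('cV[R]_n * 'cV[R]_n)) -> 'cV[R]_n;
  measurable_query : forall t : nat, measurable_fun setT (@query t) }.

Arguments query {R n d I} _ t _.

Section execution.
Context {R : realType} {n : nat} {d : measure_display} {I : measurableType d}.
Variables (alg : algorithm R n I) (oracle : 'cV[R]_n -> 'cV[R]_n * 'cV[R]_n).
Variables (info : I) (w : coins alg).

(* Most recent (query, response) pair first. *)
Fixpoint transcript (t : nat) : t.-tuple ('cV[R]_n * ('cV[R]_n * 'cV[R]_n)) :=
  match t with
  | 0 => [tuple]
  | t'.+1 =>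
      let h := transcript t' in
      let x := query alg t' (w, info, h) in
      [tuple of (x, oracle x) :: h]
  end.

(* The T-th of T queries, for 0 < T; it is preceded by T.-1 oracle calls. *)
Definition output (T : nat) : 'cV[R]_n := query alg T.-1 (w, info, transcript T.-1).

End execution.

Arguments output {R n d I} alg oracle info w T.

Section guarantees.
Context {R : realType} {n : nat}.

Definition succeeds {d : measure_display} {I : measurableType d}
    (alg : algorithm R n I) (T : nat)
    (oracle : 'cV[R]_n -> 'cV[R]_n * 'cV[R]_n) (info : I)
    (A : 'M[R]_n) (b : 'cV[R]_n) (eps : R) : Prop :=
  ((2 / 3 : R)%:E <= coins_prob alg
     [set w | (euclidean_norm (A *m output alg oracle info w T - b)
               <= eps * euclidean_norm b)%R])%E.

Definition solves_well_conditioned (T : nat) (kappa eps : R)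
    (alg : algorithm R n 'cV[R]_n) : Prop :=
  forall (b : 'cV[R]_n) (A : 'M[R]_n),
    A \in unitmx -> condition_number A <= kappa ->
    succeeds alg T (fun x => (A *m x, A^T *m x)) b A b eps.

(* The data revealed in advance are b and D. *)
Definition solves_symmetric (T : nat) (kappa eps : R)
    (alg : algorithm R n ('cV[R]_n * 'M[R]_n)%type) : Prop :=
  forall (b : 'cV[R]_n) (U D : 'M[R]_n),
    orthogonal_mx U -> is_diag_mx D ->
    (forall i, (- kappa <= D i i <= -1) \/ (1 <= D i i <= kappa)) ->
    let A := U *m D *m U^T in
    succeeds alg T (fun x => (A *m x, U^T *m x)) (b, D) A b eps.

End guarantees.

(* Main.v *)
(* The hard instance is [A = U D U^T], where [U] follows the Haar measure of the
   orthogonal matrices with [U beta = b] and [D] has about [T] distinct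
   eigenvalues, the square roots of both signs of the Chebyshev nodes of
   [1, kappa^2], each with multiplicity of order [T]. A query [x] and the two
   halves of its answer reveal one new Gaussian direction [U^T x] of the
   eigenvector coordinates at a time; what has been seen besides these random
   directions lies in the Krylov space of [beta] under [D]. Since the random
   directions are few compared to the multiplicities, each eigenspace keeps a
   part, of which the projection of [beta] loses only a bounded proportion, on
   which the output [x_T] coincides with [p(D) beta] for a polynomial [p] of
   degree less than [T]. Testing the residual [D p(D) beta - beta] against the
   Lagrange weights of the nodes at the origin, whose total mass is at most
   [((kappa + 1) / (kappa - 1)) ^ (T / 2)], bounds its norm from below by the
   inverse of this mass, up to a constant factor. *)

From HB Require Import structures.
From mathcomp Require Import all_boot all_order all_algebra.
From mathcomp Require Import all_classical all_reals all_analysis.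
From mathcomp Require Import measurable_realfun.
From mathcomp Require Import perm.
From mathcomp Require Import zify ring lra.
Require Import Defs.

Set Implicit Arguments.
Unset Strict Implicit.
Unset Printing Implicit Defensive.

Import Order.TTheory GRing.Theory Num.Theory.
Import numFieldNormedType.Exports.
Local Open Scope classical_set_scope.
Local Open Scope ring_scope.

(** * Measurability of matrix operations *)

(** The difficulty is adaptivity: each query depends on all earlier answers. Instead of
    conditioning, [game_bound] keeps the unknown matrix in the form [P *m M *m Q^T], with [P] and
    [Q] known and [M] Haar distributed on the stabilizer of the first basis vectors. Left invariance
    turns the next query, then right invariance turns the vector [D y] whose image is [A x], to the
    first basis vector not yet fixed, and splitting off a reflection leaves a smaller stabilizer.
    Only the direction revealed by [U^T x] disturbs the eigenvector coordinates: the one revealed by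
    [A x] falls on the side of [P], while the side of [Q] receives [D y], which raises the degree by
    one.

    A random direction takes from each of about [T] eigenspaces a proportion of mean at most the
    inverse of the dimension left there, at least [delta]. The chance that some eigenspace loses
    more than half is bounded by second moments, of order [T / delta ^ 2], and over [T] directions
    this stays small as soon as [delta] is a large multiple of [T]; hence the dimension of order
    [T ^ 2]. *)

Section measurable_matrices.
Context {d d' : measure_display} {Z : measurableType d} {T : measurableType d'}.

Lemma measurable_entry m n (i : 'I_m) (j : 'I_n) :
  measurable_fun setT (fun M : 'M[T]_(m, n) => M i j).
Proof.
move=> _ Y mY; apply: sub_sigma_algebra.
by exists (i, j), Y.
Qed.

Lemma measurable_mxP m n (f : Z -> 'M[T]_(m, n)) :
  (forall i j, measurable_fun setT (fun z => f z i j)) -> measurable_fun setT f.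
Proof.
move=> mf; apply: (measurability entry_cylinders) => //.
move=> _ [_ [ij [Y mY <-]] <-].
by have := mf ij.1 ij.2 measurableT _ mY; rewrite !setTI.
Qed.
End measurable_matrices.

Section measurable_algebra.
Context {R : realType} {d : measure_display} {Z : measurableType d}.

Lemma measurable_mx_entry m n (f : Z -> 'M[R]_(m, n)) i j :
  measurable_fun setT f -> measurable_fun setT (fun z => f z i j).
Proof. move=> mf; exact: (measurableT_comp (measurable_entry i j) mf). Qed.

Lemma measurable_mulmx m n p (f : Z -> 'M[R]_(m, n)) (g : Z -> 'M[R]_(n, p)) :
  measurable_fun setT f -> measurable_fun setT g ->
  measurable_fun setT (fun z => f z *m g z).
Proof.
move=> mf mg; apply: measurable_mxP => i j.
under eq_fun do rewrite mxE.
apply: measurable_sum => k.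
by apply: measurable_funM; exact: measurable_mx_entry.
Qed.

Lemma measurable_trmx m n (f : Z -> 'M[R]_(m, n)) :
  measurable_fun setT f -> measurable_fun setT (fun z => (f z)^T).
Proof.
move=> mf; apply: measurable_mxP => i j; under eq_fun do rewrite mxE.
exact: measurable_mx_entry.
Qed.

Lemma measurable_submx m n (f g : Z -> 'M[R]_(m, n)) :
  measurable_fun setT f -> measurable_fun setT g ->
  measurable_fun setT (fun z => f z - g z).
Proof.
move=> mf mg; apply: measurable_mxP => i j; under eq_fun do rewrite !mxE.
by apply: measurable_funB; exact: measurable_mx_entry.
Qed.

Lemma measurable_euclidean_norm n (f : Z -> 'cV[R]_n) :
  measurable_fun setT f -> measurable_fun setT (fun z => euclidean_norm (f z)).
Proof.
move=> mf.
have msqrt : measurable_fun setT (@Num.sqrt R).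
  by apply: continuous_measurable_fun; exact: sqrt_continuous.
apply: (measurableT_comp msqrt).
by apply: measurable_sum => k; apply: measurable_funX; exact: measurable_mx_entry.
Qed.

Lemma measurable_inv (f : Z -> R) :
  measurable_fun setT f -> measurable_fun setT (fun z => (f z)^-1).
Proof.
move=> mf.
(* The power of exponent [-1] is the inverse on nonnegative arguments, hence the square; the factor
   [f z] restores the sign, and at [0] both sides vanish. *)
have -> : (fun z => (f z)^-1) = (fun z => f z * (f z ^+ 2) `^ (-1)).
  apply/funext => z; rewrite powR_inv1 ?sqr_ge0//.
  have [->|z0] := eqVneq (f z) 0; first by rewrite invr0 mul0r.
  by rewrite expr2 invfM mulrA divff// mul1r.
apply: measurable_funM => //.
apply: (measurableT_comp (measurable_powR (-1))).
exact: measurable_funX.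
Qed.
End measurable_algebra.

(** * Integration against the Gaussian measure of the line *)

Section gaussian1d.
Import HBNNSimple.
Context {R : realType}.
Local Open Scope ereal_scope.
Local Notation leb := (@lebesgue_measure R).

Lemma lebesgue_translation (a : R) (A : set R) : measurable A ->
  pushforward leb ((fun x => x + a)%R : measurableTypeR R -> measurableTypeR R) A
  = leb A.
Proof.
move=> mA; apply/esym/lebesgue_measure_unique => //=.
  exact: measurable_funD.
move=> _ _ [[b c] _ <-].
rewrite /pushforward/=.
have -> : ((fun x => x + a)%R @^-1` [set x | (b < x <= c)%R]) =
          `](b - a)%R, (c - a)%R]%classic.
  by apply/seteqP; split => x /=; rewrite in_itv/= ltrBlDr lerBrDr.
have -> : [set x | (b < x <= c)%R] = `]b, c]%classic.
  by apply/seteqP; split => x /=; rewrite in_itv/=.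
rewrite !lebesgue_measure_itv/= !lte_fin ltrD2r.
by case: ifP => // _; congr EFin; ring.
Qed.

Lemma ge0_integral_translation (a : R) (f : R -> \bar R) :
  measurable_fun setT f -> (forall x, 0 <= f x) ->
  \int[leb]_x f (x + a)%R = \int[leb]_x f x.
Proof.
move=> mf f0.
pose h : measurableTypeR R -> measurableTypeR R := (fun x => x + a)%R.
have mh : measurable_fun setT h by exact: measurable_funD.
transitivity (\int[pushforward leb h]_x f x); last first.
  by apply: eq_measure_integral => // A mA _; exact: lebesgue_translation.
by rewrite ge0_integral_pushforward.
Qed.

Lemma ge0_integral_opp (f : R -> \bar R) :
  measurable_fun setT f -> (forall x, 0 <= f x) ->
  \int[leb]_x f (- x)%R = \int[leb]_x f x.
Proof.
move=> mf f0.
pose h : measurableTypeR R -> measurableTypeR R := -%R.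
have mh : measurable_fun setT h by exact: measurable_funN.
transitivity (\int[pushforward leb h]_x f x); last first.
  by apply: eq_measure_integral => // A mA _; exact: lebesgue_measureN.
by rewrite ge0_integral_pushforward.
Qed.

Definition gauss1 (A : set R) : \bar R := normal_prob 0%R 1%R A.
Let gauss1_0 : gauss1 set0 = 0.
Proof. exact: measure0. Qed.
Let gauss1_ge0 A : 0 <= gauss1 A.
Proof. exact: measure_ge0. Qed.
Let gauss1_sigma_additive : semi_sigma_additive gauss1.
Proof. exact: (@measure_semi_sigma_additive _ _ _ (normal_prob (0 : R)%R 1%R)). Qed.
HB.instance Definition _ := isMeasure.Build _ _ _ gauss1
  gauss1_0 gauss1_ge0 gauss1_sigma_additive.
Let gauss1_setT : gauss1 setT = 1.
Proof. exact: (@probability_setT _ _ _ (normal_prob (0 : R)%R 1%R)). Qed.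
HB.instance Definition _ := Measure_isProbability.Build _ _ _ gauss1 gauss1_setT.
Local Notation phi := (normal_pdf (0 : R) 1).

(** Both sides pass to the limit along an increasing sequence of simple functions, and for an
    indicator the equality is the definition of [normal_prob] as the integral of its density. *)
Lemma ge0_integral_gauss1 (f : R -> \bar R) :
  measurable_fun setT f -> (forall x, 0 <= f x) ->
  \int[gauss1]_x f x = \int[leb]_x (f x * (phi x)%:E).
Proof.
move=> mf f0.
have mphi : measurable_fun setT (EFin \o phi).
  by apply/measurable_EFinP; exact: measurable_normal_pdf.
have phi0 x : 0 <= (phi x)%:E by rewrite lee_fin normal_pdf_ge0.
pose f_ := nnsfun_approx measurableT mf.
have nd x : {homo (fun n => (f_ n x)%:E) : a b / (a <= b)%N >-> a <= b}.
  by move=> a b ab; rewrite lee_fin; exact/lefP/nd_nnsfun_approx.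
have cvgf x : (f_ n x)%:E @[n --> \oo] --> f x.
  by apply: cvg_nnsfun_approx => //.
have mfn n : measurable_fun setT (f_ n) by exact: measurable_funPT.
transitivity (limn (fun n => \int[gauss1]_x (f_ n x)%:E)).
  rewrite -monotone_convergence//=.
  - by apply: eq_integral => x _; apply/esym/cvg_lim.
  - by move=> n; exact/measurable_EFinP/measurable_funTS.
  by move=> n x _; rewrite lee_fin.
transitivity (limn (fun n => \int[leb]_x ((f_ n x)%:E * (phi x)%:E))); last first.
  rewrite -monotone_convergence//=.
  - apply: eq_integral => x _; apply/cvg_lim => //.
    by apply: cvgeZr => //; exact: cvgf.
  - by move=> n; apply: emeasurable_funM; [apply/measurable_EFinP; exact: (mfn n)|exact: mphi].
  - by move=> n x _; rewrite mule_ge0// lee_fin.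
  - by move=> x _ a b ab; apply: lee_wpmul2r => //; exact: nd.
congr (limn _); apply/funext => n.
have fE x : (f_ n x)%:E = \sum_(k \in range (f_ n)) (k * \1_(f_ n @^-1` [set k]) x)%:E.
  by rewrite fsumEFin// -fimfunE.
have mi r : measurable_fun setT (fun x : R => (r * \1_(f_ n @^-1` [set r]) x)%:E).
  apply/measurable_EFinP; apply: measurable_funM; first exact: measurable_cst.
  by apply: measurable_indic.
under eq_integral do rewrite fE.
rewrite ge0_integral_fsum//; last by move=> r x _; rewrite nnfun_muleindic_ge0.
under [RHS]eq_integral => x _.
  rewrite fE ge0_mule_fsuml; last by move=> r; rewrite nnfun_muleindic_ge0.
  over.
rewrite ge0_integral_fsum//; last 2 first.
  - by move=> r; apply: emeasurable_funM; [exact: mi|exact: mphi].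
  - by move=> r x _; rewrite mule_ge0// nnfun_muleindic_ge0.
apply: eq_fsbigr => r /[!inE] -[y _ ry].
have r0 : (0 <= r)%R by rewrite -ry.
under eq_integral do rewrite EFinM.
under [RHS]eq_integral do rewrite EFinM -muleA.
have mi1 : measurable_fun setT (fun x : R => (\1_(f_ n @^-1` [set r]) x : R)%:E).
  by apply/measurable_EFinP; apply: measurable_indic.
have i0 x : 0 <= (\1_(f_ n @^-1` [set r]) x : R)%:E by rewrite lee_fin.
rewrite ge0_integralZl//.
rewrite (@ge0_integralZl _ _ _ leb _ measurableT _ _ r%:E)//; last first.
  by move=> *; rewrite mule_ge0.
  by apply: emeasurable_funM; [exact: mi1|exact: mphi].
congr (_ * _); rewrite integral_indic// setIT.
transitivity (\int[leb]_(x in f_ n @^-1` [set r]) (phi x)%:E); first by [].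
rewrite [LHS]integral_mkcond.
apply: eq_integral => x _.
by rewrite patchE indicE; case: ifPn => _; rewrite ?mul1e ?mul0e.
Qed.
End gaussian1d.

(** * Orthogonal matrices fixing the first coordinates *)

Section orthogonal_matrices.
Context {R : realType}.

Definition dot n (v w : 'cV[R]_n) : R := \sum_(i < n) v i ord0 * w i ord0.

Lemma dotE n (v w : 'cV[R]_n) : v^T *m w = (dot v w)%:M.
Proof.
apply/matrixP => i j; rewrite !ord1 !mxE eqxx mulr1n.
by apply: eq_bigr => k _; rewrite mxE.
Qed.

Lemma dotC n (v w : 'cV[R]_n) : dot v w = dot w v.
Proof. by apply: eq_bigr => i _; rewrite mulrC. Qed.

Lemma dotDl n (u v w : 'cV[R]_n) : dot (u + v) w = dot u w + dot v w.
Proof. by rewrite -big_split; apply: eq_bigr => i _; rewrite mxE mulrDl. Qed.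

Lemma dotZl n a (v w : 'cV[R]_n) : dot (a *: v) w = a * dot v w.
Proof. by rewrite mulr_sumr; apply: eq_bigr => i _; rewrite mxE mulrA. Qed.

Lemma dotNl n (v w : 'cV[R]_n) : dot (- v) w = - dot v w.
Proof. by rewrite -scaleN1r dotZl mulN1r. Qed.

Lemma dotDr n (u v w : 'cV[R]_n) : dot w (u + v) = dot w u + dot w v.
Proof. by rewrite !(dotC w) dotDl. Qed.

Lemma dotZr n a (v w : 'cV[R]_n) : dot w (a *: v) = a * dot w v.
Proof. by rewrite !(dotC w) dotZl. Qed.

Lemma dotNr n (v w : 'cV[R]_n) : dot w (- v) = - dot w v.
Proof. by rewrite !(dotC w) dotNl. Qed.

Lemma dot_mull n m (A : 'M[R]_(n, m)) v w : dot (A *m v) w = dot v (A^T *m w).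
Proof.
have : (A *m v)^T *m w = v^T *m (A^T *m w) by rewrite trmx_mul mulmxA.
by rewrite !dotE => /matrixP/(_ ord0 ord0); rewrite !mxE eqxx !mulr1n.
Qed.

Lemma dot_sqE n (v : 'cV[R]_n) : dot v v = \sum_(i < n) v i ord0 ^+ 2.
Proof. by apply: eq_bigr => i _; rewrite expr2. Qed.

Lemma dot_ge0 n (v : 'cV[R]_n) : 0 <= dot v v.
Proof. by rewrite dot_sqE; apply: sumr_ge0 => i _; rewrite sqr_ge0. Qed.

Lemma dot_eq0 n (v : 'cV[R]_n) : (dot v v == 0) = (v == 0).
Proof.
apply/eqP/eqP => [|->]; last by apply: big1 => i _; rewrite mxE mul0r.
rewrite dot_sqE => /eqP; rewrite psumr_eq0 => [/allP v0|i _]; last exact: sqr_ge0.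
apply/colP => i; rewrite mxE; have := v0 i; rewrite mem_index_enum => /(_ isT).
by rewrite sqrf_eq0 => /eqP.
Qed.

Lemma euclidean_normE n (v : 'cV[R]_n) : euclidean_norm v = Num.sqrt (dot v v).
Proof. by rewrite dot_sqE. Qed.

Lemma orthogonal_mxr n (Q : 'M[R]_n) : orthogonal_mx Q -> Q *m Q^T = 1%:M.
Proof. exact: mulmx1C. Qed.

Lemma orthogonal_tr n (Q : 'M[R]_n) : orthogonal_mx Q -> orthogonal_mx Q^T.
Proof. by move=> oQ; rewrite /orthogonal_mx trmxK orthogonal_mxr. Qed.

Lemma orthogonal1 n : orthogonal_mx (1%:M : 'M[R]_n).
Proof. by rewrite /orthogonal_mx trmx1 mulmx1. Qed.

Lemma orthogonalM n (Q P : 'M[R]_n) :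
  orthogonal_mx Q -> orthogonal_mx P -> orthogonal_mx (Q *m P).
Proof.
rewrite /orthogonal_mx => oQ oP.
by rewrite trmx_mul mulmxA -(mulmxA P^T) oQ mulmx1.
Qed.

Lemma orthogonal_trK n m (Q : 'M[R]_n) (v : 'M[R]_(n, m)) :
  orthogonal_mx Q -> Q^T *m (Q *m v) = v.
Proof. by move=> oQ; rewrite mulmxA oQ mul1mx. Qed.

Lemma orthogonal_Ktr n m (Q : 'M[R]_n) (v : 'M[R]_(n, m)) :
  orthogonal_mx Q -> Q *m (Q^T *m v) = v.
Proof. by move=> oQ; rewrite mulmxA orthogonal_mxr// mul1mx. Qed.

Lemma dot_orthogonal n (Q : 'M[R]_n) v w :
  orthogonal_mx Q -> dot (Q *m v) (Q *m w) = dot v w.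
Proof. by move=> oQ; rewrite dot_mull orthogonal_trK. Qed.

(** The index is a natural number so that it can be computed, as in [n - d]; out of range the vector
    is zero. *)
Definition basis n (k : nat) : 'cV[R]_n := \col_i (i == k :> nat)%:R.

Definition headed n (k : nat) (v : 'cV[R]_n) :=
  forall i : 'I_n, (k <= i)%N -> v i ord0 = 0.

Definition tail n (k : nat) (v : 'cV[R]_n) : 'cV[R]_n :=
  \col_i (if (k <= i)%N then v i ord0 else 0).

Lemma tailP n k (v : 'cV[R]_n) (i : 'I_n) :
  tail k v i ord0 = if (k <= i)%N then v i ord0 else 0.
Proof. by rewrite mxE. Qed.

Lemma headed_subr_tail n k (v : 'cV[R]_n) : headed k (v - tail k v).
Proof. by move=> i ki; rewrite !mxE ki subrr. Qed.

Lemma dot_headed_tail n k (v w : 'cV[R]_n) : headed k v -> dot v (tail k w) = 0.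
Proof.
move=> hv; apply: big1 => i _; rewrite tailP.
by case: ifPn => [/hv ->|]; rewrite ?mul0r ?mulr0.
Qed.

Lemma tail_tail n k (v : 'cV[R]_n) : tail k (tail k v) = tail k v.
Proof. by apply/colP => i; rewrite !mxE; case: (leqP k i). Qed.

Lemma headed_le n k l (v : 'cV[R]_n) : (k <= l)%N -> headed k v -> headed l v.
Proof. by move=> kl hv i li; apply: hv; exact: leq_trans li. Qed.

Lemma headed_basis n k l : (k < l)%N -> headed l (basis n k).
Proof.
by move=> kl i li; rewrite mxE gtn_eqF// (leq_trans kl li).
Qed.

Lemma dot_basis n k (kn : (k < n)%N) (v : 'cV[R]_n) :
  dot (basis n k) v = v (Ordinal kn) ord0.
Proof.
rewrite /dot (bigD1 (Ordinal kn))//= big1 ?addr0 ?mxE/= ?eqxx ?mul1r// => i ik.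
rewrite mxE (_ : (_ == _) = false) ?mul0r//.
by apply/negbTE; apply: contra ik => /eqP ik; apply/eqP/val_inj.
Qed.

Lemma tail_sum n k (kn : (k < n)%N) (v : 'cV[R]_n) :
  tail k v = v (Ordinal kn) ord0 *: basis n k + tail k.+1 v.
Proof.
apply/colP => i; rewrite !mxE.
have [ik|ki|ki] := ltngtP k i; rewrite ?mulr0 ?add0r ?addr0//.
by rewrite mulr1; congr (v _ _); apply/val_inj; rewrite /= ki.
Qed.

Lemma orthogonal_entries n (M : 'M[R]_n) i (v : 'cV[R]_n) :
  (M *m v) i ord0 = dot (M^T *m basis n i) v.
Proof.
rewrite dot_mull trmxK dot_basis.
by congr (_ _ _); apply/val_inj.
Qed.

Definition stab n (k : nat) (M : 'M[R]_n) : Prop :=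
  orthogonal_mx M /\ (forall v, headed k v -> M *m v = v).

Lemma stab1 n k : stab k (1%:M : 'M[R]_n).
Proof. by split; [exact: orthogonal1|move=> v _; rewrite mul1mx]. Qed.

Lemma stabM n k (M N : 'M[R]_n) : stab k M -> stab k N -> stab k (M *m N).
Proof.
move=> [oM M1] [oN N1]; split; first exact: orthogonalM.
by move=> v hv; rewrite -mulmxA N1// M1.
Qed.

Lemma stab_tr n k (M : 'M[R]_n) : stab k M -> stab k M^T.
Proof.
move=> [oM M1]; split; first exact: orthogonal_tr.
by move=> v hv; rewrite -{1}(M1 v hv) orthogonal_trK.
Qed.

Lemma stab_le n k l (M : 'M[R]_n) : (k <= l)%N -> stab l M -> stab k M.
Proof. by move=> kl [oM M1]; split => // v hv; apply: M1; exact: headed_le hv. Qed.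

Lemma stab_full n (M : 'M[R]_n) : stab n M -> M = 1%:M.
Proof.
move=> [_ M1]; apply/matrixP => i j.
have /colP/(_ i) : M *m basis n j = basis n j.
  by apply: M1 => l; rewrite leqNgt ltn_ord.
have bE : basis n j = delta_mx j ord0.
  by apply/colP => l; rewrite !mxE eqxx andbT.
by rewrite {1}bE -colE !mxE.
Qed.

Lemma stab_entry n k (M : 'M[R]_n) (v : 'cV[R]_n) (i : 'I_n) :
  stab k M -> (i < k)%N -> (M *m v) i ord0 = v i ord0.
Proof.
move=> sM ik; rewrite orthogonal_entries (proj2 (stab_tr sM)); last exact: headed_basis.
by rewrite dot_basis; congr (v _ _); apply/val_inj.
Qed.

(** An orthogonal matrix that fixes the first [k] basis vectors preserves the orthogonal complement
    of their span. *)
Lemma stab_tail n k (M : 'M[R]_n) (v : 'cV[R]_n) :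
  stab k M -> M *m tail k v = tail k (M *m v).
Proof.
move=> sM; apply/colP => i; rewrite [in RHS]mxE.
case: ifPn => [ki|]; last first.
  by rewrite -ltnNge => ik; rewrite (stab_entry _ sM)// tailP leqNgt ik.
have -> : M *m v = (v - tail k v) + M *m tail k v.
  rewrite -{1}(subrK (tail k v) v) mulmxDr (proj2 sM)//.
  exact: headed_subr_tail.
by rewrite [in RHS]mxE (headed_subr_tail v ki) add0r.
Qed.

Lemma stabS n k (M : 'M[R]_n) :
  stab k M -> M *m basis n k = basis n k -> stab k.+1 M.
Proof.
move=> [oM M1] Mk; split => // v hv.
have [kn|nk] := ltnP k n; last by apply: M1 => i /(leq_trans nk); rewrite leqNgt ltn_ord.
rewrite -(subrK (v (Ordinal kn) ord0 *: basis n k) v) mulmxDr -scalemxAr Mk; congr (_ + _).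
apply: M1 => i; rewrite leq_eqVlt => /orP[/eqP ki|/hv vi].
  rewrite !mxE -ki eqxx mulr1.
  by apply/eqP; rewrite subr_eq0; apply/eqP; congr (v _ _); apply/val_inj.
rewrite !mxE vi; have := hv i; case: eqP => [ik|]; last by rewrite mulr0 subr0.
rewrite mulr1 sub0r => _; apply/eqP; rewrite oppr_eq0 -vi; apply/eqP.
by congr (v _ _); apply/val_inj.
Qed.
(* The junk value [0^-1 = 0] makes this the identity when the reflection
   vector vanishes, in particular when the tail of [g] is zero. *)
Definition householder n (k : nat) (g : 'cV[R]_n) : 'M[R]_n :=
  let u := tail k g - Num.sqrt (dot (tail k g) (tail k g)) *: basis n k in
  1%:M - (2 / dot u u) *: (u *m u^T).

Lemma householder_mul n k (g v : 'cV[R]_n) :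
  let u := tail k g - Num.sqrt (dot (tail k g) (tail k g)) *: basis n k in
  householder k g *m v = v - (2 * dot u v / dot u u) *: u.
Proof.
move=> u; rewrite /householder -/u mulmxBl mul1mx -scalemxAl -mulmxA dotE.
by rewrite mul_mx_scalar scalerA; congr (_ - _ *: _); rewrite mulrAC.
Qed.

Lemma householder_tr n k (g : 'cV[R]_n) : (householder k g)^T = householder k g.
Proof. by rewrite /householder linearB/= linearZ/= trmx_mul trmxK trmx1. Qed.

Lemma householderK n k (g : 'cV[R]_n) : householder k g *m householder k g = 1%:M.
Proof.
rewrite /householder; set u := tail k g - _.
rewrite mulmxBl mul1mx mulmxBr mulmx1 -scalemxAl -scalemxAr scalerA.
rewrite -mulmxA (mulmxA u^T) dotE mul_scalar_mx -scalemxAr scalerA.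
have [u0|u0] := eqVneq (dot u u) 0.
  by rewrite u0 invr0 mulr0 !mul0r !scale0r !subr0.
rewrite (_ : 2 / dot u u * (2 / dot u u) * dot u u = 2 / dot u u + 2 / dot u u).
  by rewrite scalerDl opprB addrK subrK.
by field.
Qed.

Lemma householder_stab n k (g : 'cV[R]_n) : (k < n)%N -> stab k (householder k g).
Proof.
move=> kn; split; first by rewrite /orthogonal_mx householder_tr householderK.
move=> v hv; rewrite householder_mul.
rewrite dotDl dotNl dotZl dotC dot_headed_tail// dot_basis hv// mulr0 subr0.
by rewrite mulr0 mul0r scale0r subr0.
Qed.

(** The tail and its target have the same norm, so [2 * dot u t] equals [dot u u] and the reflection
    subtracts exactly [u] from [t]; when [u] is zero the two vectors already coincide. *)
Lemma householder_tail n k (g : 'cV[R]_n) : (k < n)%N ->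
  householder k g *m tail k g = Num.sqrt (dot (tail k g) (tail k g)) *: basis n k.
Proof.
move=> kn; rewrite householder_mul; set t := tail k g; set r := Num.sqrt _.
set u := t - r *: basis n k.
have rr : r ^+ 2 = dot t t by rewrite sqr_sqrtr// dot_ge0.
have uu : 2 * dot u t = dot u u.
  rewrite /u !(dotDl, dotDr, dotNl, dotNr, dotZl, dotZr) -rr.
  rewrite (dotC t (basis n k)) (dot_basis kn (basis n k)) mxE eqxx/=; ring.
rewrite uu; have [u0|u0] := eqVneq (dot u u) 0.
  rewrite u0 mul0r scale0r subr0; move/eqP: u0; rewrite dot_eq0 subr_eq0.
  by move=> /eqP.
by rewrite divff// scale1r opprB addrC subrK.
Qed.

Lemma householder_basis n k (g : 'cV[R]_n) : (k < n)%N -> tail k g != 0 ->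
  householder k g *m basis n k = (Num.sqrt (dot (tail k g) (tail k g)))^-1 *: tail k g.
Proof.
move=> kn g0; have := householder_tail g kn; set r := Num.sqrt _ => h.
have r0 : r != 0.
  by rewrite gt_eqF// sqrtr_gt0 lt_neqAle dot_ge0 eq_sym dot_eq0 g0.
by apply: (scalerI r0); rewrite scalerA divff// scale1r scalemxAr -h mulmxA householderK mul1mx.
Qed.

(** Both [Q *m householder k g] and [householder k (Q *m g)] send [basis n k] to the normalized tail
    of [Q *m g], hence they differ by a matrix that fixes one more basis vector. The left invariance
    of [haar] rests on this. *)
Lemma householder_conj n k (Q : 'M[R]_n) g : (k < n)%N -> stab k Q ->
  tail k g != 0 ->
  stab k.+1 (householder k (Q *m g) *m Q *m householder k g).
Proof.
move=> kn sQ g0; apply: stabS.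
  by apply: stabM; [apply: stabM => //|]; exact: householder_stab.
rewrite -mulmxA householder_basis// -scalemxAr -!mulmxA (stab_tail _ sQ).
rewrite householder_tail// -(stab_tail _ sQ) (dot_orthogonal _ _ (proj1 sQ)).
rewrite scalerA mulVf ?scale1r// gt_eqF// sqrtr_gt0.
by rewrite lt_neqAle dot_ge0 eq_sym dot_eq0 g0.
Qed.

Lemma householder_headed n k (x : 'cV[R]_n) : (k < n)%N ->
  headed k.+1 (householder k x *m x).
Proof.
move=> kn; rewrite -{2}(subrK (tail k x) x) mulmxDr householder_tail//.
rewrite (proj2 (householder_stab x kn)); last exact: headed_subr_tail.
move=> i ki; rewrite !mxE (ltnW ki) subrr add0r gtn_eqF// mulr0 //.
Qed.
End orthogonal_matrices.

(** * Gaussian vectors *)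

Section gaussian2d.
Context {R : realType}.
Local Open Scope ereal_scope.
Local Notation leb := (@lebesgue_measure R).
Local Notation phi := (normal_pdf (0 : R) 1).
Local Notation mR := (measurableTypeR R).
Implicit Types f : R * R -> \bar R.

Lemma lebesgue_tonelli f : measurable_fun setT f -> (forall z, 0 <= f z) ->
  \int[leb]_x \int[leb]_y f (x, y) = \int[leb]_y \int[leb]_x f (x, y).
Proof. by move=> mf f0; exact: (@fubini_tonelli _ _ mR mR _ leb leb f). Qed.

Lemma measurable_section1 f y : measurable_fun setT f ->
  measurable_fun setT (fun x => f (x, y)).
Proof.
move=> mf; apply: (measurableT_comp mf).
by apply: measurable_fun_pair => //; exact: measurable_cst.
Qed.

Lemma measurable_section2 f x : measurable_fun setT f ->
  measurable_fun setT (fun y => f (x, y)).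
Proof.
move=> mf; apply: (measurableT_comp mf).
by apply: measurable_fun_pair => //; exact: measurable_cst.
Qed.

Lemma measurable_affine2 (a b c d : R) :
  measurable_fun setT (fun z : R * R => (a * z.1 + b * z.2, c * z.1 + d * z.2)%R).
Proof.
by apply: measurable_fun_pair; apply: measurable_funD;
  apply: measurable_funM; try exact: measurable_cst;
  try exact: measurable_fst; exact: measurable_snd.
Qed.

Definition linear2 (a b c d : R) (z : R * R) : R * R :=
  (a * z.1 + b * z.2, c * z.1 + d * z.2)%R.

Lemma measurable_comp_linear2 f a b c d : measurable_fun setT f ->
  measurable_fun setT (fun z => f (linear2 a b c d z)).
Proof. by move=> mf; exact: (measurableT_comp mf (measurable_affine2 a b c d)). Qed.

Lemma integral_shear1 f a : measurable_fun setT f -> (forall z, 0 <= f z) ->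
  \int[leb]_x \int[leb]_y f (linear2 1 a 0 1 (x, y)) =
  \int[leb]_x \int[leb]_y f (x, y).
Proof.
move=> mf f0.
have E1 := lebesgue_tonelli (measurable_comp_linear2 1 a 0 1 mf) (fun=> f0 _).
apply: (etrans E1); apply: etrans (esym (lebesgue_tonelli mf f0)).
apply: eq_integral => y _.
rewrite -[RHS](@ge0_integral_translation _ (a * y) (fun x => f (x, y)))//; last exact: measurable_section1.
by apply: eq_integral => x _; rewrite /linear2/= mul0r add0r !mul1r.
Qed.

Lemma integral_shear2 f a : measurable_fun setT f -> (forall z, 0 <= f z) ->
  \int[leb]_x \int[leb]_y f (linear2 1 0 a 1 (x, y)) =
  \int[leb]_x \int[leb]_y f (x, y).
Proof.
move=> mf f0; apply: eq_integral => x _.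
rewrite -[RHS](@ge0_integral_translation _ (a * x) (fun y => f (x, y)))//; last exact: measurable_section2.
by apply: eq_integral => y _; rewrite /linear2/= mul0r addr0 !mul1r addrC.
Qed.
(* A rotation by an angle not in [pi Z] is a product of three shears. *)
Lemma integral_rotation f c s : (c ^+ 2 + s ^+ 2 = 1)%R -> s != 0%R ->
  measurable_fun setT f -> (forall z, 0 <= f z) ->
  \int[leb]_x \int[leb]_y f (linear2 c (- s) s c (x, y)) =
  \int[leb]_x \int[leb]_y f (x, y).
Proof.
move=> cs s0 mf f0; pose a := ((c - 1) / s)%R.
have m1 := measurable_comp_linear2 1 a 0 1 mf.
have m2 := measurable_comp_linear2 1 0 s 1 m1.
have E3 := integral_shear1 a m2 (fun=> f0 _).
have E2 := integral_shear2 s m1 (fun=> f0 _).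
apply: etrans (etrans E3 (etrans E2 (integral_shear1 a mf f0))).
apply: eq_integral => x _; apply: eq_integral => y _; congr f.
rewrite /linear2/= /a; congr pair; last by field.
have -> : (c * x + - s * y = c * x + (c ^+ 2 - 1) / s * y)%R.
  by rewrite -cs; field.
by field.
Qed.

Lemma gauss1_tonelli f : measurable_fun setT f -> (forall z, 0 <= f z) ->
  \int[gauss1]_x \int[gauss1]_y f (x, y) =
  \int[leb]_x \int[leb]_y (f (x, y) * (phi x * phi y)%:E).
Proof.
move=> mf f0.
have phi0 x : 0 <= (phi x)%:E by rewrite lee_fin normal_pdf_ge0.
have mphi : measurable_fun setT (fun x => (phi x)%:E).
  by apply/measurable_EFinP; exact: measurable_normal_pdf.
rewrite ge0_integral_gauss1; last 2 first.
- exact: (@measurable_fun_fubini_tonelli_F _ _ _ _ _ _ _ mf f0).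
- by move=> x; apply: integral_ge0.
apply: eq_integral => x _; rewrite ge0_integral_gauss1//; last exact: measurable_section2.
rewrite -ge0_integralZr//; last 2 first.
- apply: emeasurable_funM => //; exact: measurable_section2.
- by move=> y _; exact: mule_ge0.
by apply: eq_integral => y _; rewrite -muleA -EFinM mulrC.
Qed.

(** The product density depends only on [x ^ 2 + y ^ 2], so the invariance of the plane Lebesgue
    integral carries over. *)
Lemma gauss1_rotation f c s : (c ^+ 2 + s ^+ 2 = 1)%R ->
  measurable_fun setT f -> (forall z, 0 <= f z) ->
  \int[gauss1]_x \int[gauss1]_y f (linear2 c (- s) s c (x, y)) =
  \int[gauss1]_x \int[gauss1]_y f (x, y).
Proof.
have main c' s' g : (c' ^+ 2 + s' ^+ 2 = 1)%R -> s' != 0%R ->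
    measurable_fun setT g -> (forall z, 0 <= g z) ->
    \int[gauss1]_x \int[gauss1]_y g (linear2 c' (- s') s' c' (x, y)) =
    \int[gauss1]_x \int[gauss1]_y g (x, y).
  move=> cs s0 mg g0.
  apply: (etrans (gauss1_tonelli (measurable_comp_linear2 c' (- s') s' c' mg) (fun=> g0 _))).
  apply: (etrans _ (esym (gauss1_tonelli mg g0))).
  apply: (etrans _ (@integral_rotation (fun z => g z * (phi z.1 * phi z.2)%:E) _ _ cs s0 _ _)); last 2 first.
  - apply: emeasurable_funM => //; apply/measurable_EFinP; apply: measurable_funM.
      exact: (measurableT_comp (measurable_normal_pdf _ _) measurable_fst).
    exact: (measurableT_comp (measurable_normal_pdf _ _) measurable_snd).
  - by move=> z; apply: mule_ge0 => //; rewrite lee_fin mulr_ge0// normal_pdf_ge0.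
  apply: eq_integral => x _; apply: eq_integral => y _; congr (_ * _%:E).
  rewrite !normal_pdfE ?oner_eq0// mulrACA [RHS]mulrACA; congr (_ * _)%R.
  rewrite /normal_fun -!expRD; congr expR.
  rewrite /linear2/= !subr0.
  have -> : ((c' * x + - s' * y) ^+ 2 = (c' ^+ 2 + s' ^+ 2) * (x ^+ 2 + y ^+ 2) - (s' * x + c' * y) ^+ 2)%R by ring.
  by rewrite cs mul1r; ring.
move=> cs mf f0; have [s0|s0] := eqVneq s 0%R; last exact: main.
(* rotations by [0] and [pi] are squares of rotations by [pi] and [pi / 2] *)
have c1 : (c ^+ 2 = 1)%R by rewrite -cs s0 expr0n addr0.
have m1 := main 0%R 1%R f; rewrite expr0n expr1n add0r in m1.
have m2 := main 0%R 1%R (fun z => f (linear2 0 (- 1) 1 0 z)).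
rewrite expr0n expr1n add0r in m2.
move/eqP: c1; rewrite sqrf_eq1 => /orP[|] /eqP ->; rewrite s0.
  by apply: eq_integral => x _; apply: eq_integral => y _; congr f; rewrite /linear2/=; congr pair; ring.
have o0 := oner_neq0 R; have mg := measurable_comp_linear2 0 (- 1) 1 0 mf.
apply: (etrans _ (m1 erefl o0 mf f0)).
apply: (etrans _ (m2 erefl o0 mg (fun=> f0 _))).
by apply: eq_integral => x _; apply: eq_integral => y _; congr f; rewrite /linear2/=; congr pair; ring.
Qed.
End gaussian2d.

Section gaussian_vector.
Context {R : realType}.
Local Open Scope ereal_scope.

Definition consv n (z : R * 'cV[R]_n) : 'cV[R]_n.+1 := col_mx z.1%:M z.2.

Lemma consv0 n z : @consv n z ord0 ord0 = z.1.
Proof.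
rewrite /consv; have -> : (ord0 : 'I_n.+1) = @lshift 1 n ord0 by exact/val_inj.
by rewrite (@col_mxEu _ 1 n) mxE eqxx mulr1n.
Qed.

Lemma consvS n z i : @consv n z (lift ord0 i) ord0 = z.2 i ord0.
Proof.
have -> : lift ord0 i = @rshift 1 n i by exact/val_inj.
by rewrite /consv (@col_mxEd _ 1 n).
Qed.

Lemma measurable_consv n : measurable_fun setT (@consv n).
Proof.
apply: measurable_mxP => i j; rewrite ord1.
have [k ->|->] := unliftP ord0 i.
  under eq_fun do rewrite consvS.
  exact: (measurable_mx_entry k ord0 measurable_snd).
under eq_fun do rewrite consv0.
exact: measurable_fst.
Qed.
HB.instance Definition _ n :=
  isMeasurableFun.Build _ _ _ _ (@consv n) (@measurable_consv n).

(** Adding one coordinate at a time makes an integral in dimension [n.+1] an iterated one, which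
    suits induction on the dimension. *)
Fixpoint gauss n : probability 'cV[R]_n R :=
  match n return probability 'cV[R]_n R with
  | 0%N => dirac (0%R : 'cV[R]_0)
  | k.+1 => distribution (gauss1 \x gauss k) (@consv k : {mfun _ >-> _})
  end.
Implicit Types n : nat.

Lemma measurable_comp_consv n (f : 'cV[R]_n.+1 -> \bar R) x : measurable_fun setT f ->
  measurable_fun setT (fun v => f (consv (x, v))).
Proof.
move=> mf; apply: (measurableT_comp mf); apply: (measurableT_comp (@measurable_consv n)).
by apply: measurable_fun_pair => //; exact: measurable_cst.
Qed.

Lemma ge0_integral_gaussS n (f : 'cV[R]_n.+1 -> \bar R) :
  measurable_fun setT f -> (forall v, 0 <= f v) ->
  \int[gauss n.+1]_v f v = \int[gauss1]_x \int[gauss n]_v f (consv (x, v)).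
Proof.
move=> mf f0; rewrite ge0_integral_distribution//.
have mc : measurable_fun setT (f \o @consv n).
  exact: (measurableT_comp mf (@measurable_consv n)).
rewrite [LHS]fubini_tonelli1//.
by move=> z; exact: f0.
Qed.

Lemma measurable_integral_gauss n (f : 'cV[R]_n.+1 -> \bar R) :
  measurable_fun setT f -> (forall v, 0 <= f v) ->
  measurable_fun setT (fun x => \int[gauss n]_v f (consv (x, v))).
Proof.
move=> mf f0; apply: (@measurable_fun_fubini_tonelli_F _ _ _ _ _ (gauss n) (fun z => f (consv z))) => //.
exact: (measurableT_comp mf (@measurable_consv n)).
Qed.
#[local] Opaque gauss.

Definition gauss_invariant n (Q : 'M[R]_n) :=
  forall f : 'cV[R]_n -> \bar R, measurable_fun setT f -> (forall v, 0 <= f v) ->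
  \int[gauss n]_v f (Q *m v) = \int[gauss n]_v f v.

Lemma measurable_mulmxl n p (Q : 'M[R]_(p, n)) :
  measurable_fun setT (fun v : 'cV[R]_n => Q *m v).
Proof. by apply: measurable_mulmx => //; exact: measurable_cst. Qed.

Lemma gauss_invariantM n (P Q : 'M[R]_n) :
  gauss_invariant P -> gauss_invariant Q -> gauss_invariant (P *m Q).
Proof.
move=> iP iQ f mf f0; rewrite -(iP f)// -(iQ (fun v => f (P *m v)))//.
  by under eq_integral do rewrite -mulmxA.
exact: (measurableT_comp mf (measurable_mulmxl P)).
Qed.

Lemma stab1_consv n (M : 'M[R]_n.+1) : stab 1 M ->
  exists2 V : 'M[R]_n, orthogonal_mx V &
    forall x v, M *m consv (x, v) = consv (x, V *m v).
Proof.
move=> sM.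
have b0 : basis n.+1 0 = delta_mx ord0 ord0 :> 'cV[R]_n.+1.
  by apply/colP => l; rewrite !mxE eqxx andbT.
have c0 (N : 'M[R]_n.+1) i : stab 1 N -> N i ord0 = (i == ord0)%:R.
  move=> [_ N1]; have /colP/(_ i) : N *m basis n.+1 0 = basis n.+1 0.
    by apply: N1; exact: headed_basis.
  by rewrite {1}b0 -colE !mxE.
have r0 j : M ord0 j = (j == ord0)%:R by rewrite -(c0 M^T) ?mxE//; exact: stab_tr.
pose N : 'M[R]_(1 + n) := M.
have MB : N = block_mx 1%:M 0%R 0%R (drsubmx N).
  rewrite -[LHS]submxK; congr block_mx; apply/matrixP => i j; rewrite !mxE.
  - by rewrite !ord1 lshift0 c0// eqxx.
  - by rewrite ord1 lshift0 r0.
  - by rewrite ord1 lshift0 c0.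
exists (drsubmx N).
  have : N^T *m N = 1%:M by exact: (proj1 sM).
  rewrite MB tr_block_mx mulmx_block trmx0 !mulmx0 !mul0mx !add0r.
  by rewrite (@scalar_mx_block _ 1 n) block_mxKdr => /eq_block_mx[_ _ _].
move=> x v; rewrite -[M]/N MB /consv/= block_mxKdr.
by rewrite (@mul_block_col _ 1 n 1 n) !mul0mx mul1mx addr0 add0r.
Qed.

Definition block1 n (V : 'M[R]_n) : 'M[R]_n.+1 := block_mx (1%:M : 'M[R]_1) 0%R 0%R V.

Lemma block1_consv n (V : 'M[R]_n) x v : block1 V *m consv (x, v) = consv (x, V *m v).
Proof. by rewrite (@mul_block_col _ 1 n 1 n)/= !mul0mx mul1mx addr0 add0r. Qed.

Lemma block1_orthogonal n (V : 'M[R]_n) : orthogonal_mx V -> orthogonal_mx (block1 V).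
Proof.
move=> oV; rewrite /orthogonal_mx /block1 (@tr_block_mx _ 1 n 1 n).
rewrite (@mulmx_block _ 1 n 1 n 1 n) !trmx0 !mulmx0 !mul0mx trmx1 mulmx1 oV !addr0 add0r.
by rewrite -(@scalar_mx_block _ 1 n).
Qed.

Lemma gauss_invariant_consv n (M : 'M[R]_n.+1) (V : 'M[R]_n) :
  gauss_invariant V -> (forall x v, M *m consv (x, v) = consv (x, V *m v)) ->
  gauss_invariant M.
Proof.
move=> iV MV f mf f0.
have mM : measurable_fun setT (fun v : 'cV[R]_n.+1 => f (M *m v)).
  exact: (measurableT_comp mf (measurable_mulmxl M)).
rewrite [LHS](ge0_integral_gaussS mM (fun=> f0 _)) [RHS](ge0_integral_gaussS mf f0).
apply: eq_integral => x _.
under eq_integral do rewrite MV.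
rewrite (iV (fun v => f (consv (x, v))))//.
exact: measurable_comp_consv.
Qed.

Definition rot2 n (c s : R) : 'M[R]_n.+2 :=
  \matrix_(i, j) (if (i < 2)%N && (j < 2)%N then
     (if i == j then c else if i == ord0 then - s else s)
   else (i == j)%:R)%R.

Lemma rot2_consv n c s x y v :
  rot2 n c s *m consv (x, consv (y, v)) =
  consv ((c * x - s * y)%R, consv ((s * x + c * y)%R, v)).
Proof.
have E i j : rot2 n c s i j = (if (i < 2)%N && (j < 2)%N then
     (if i == j then c else if i == ord0 then - s else s) else (i == j)%:R)%R.
  by rewrite mxE.
apply/colP => i; rewrite mxE big_ord_recl big_ord_recl consv0 consvS consv0 !E/=.
have [k ->|->] := unliftP ord0 i; last first.
  by rewrite consv0/= big1 ?addr0 ?mulNr// => j _; rewrite !E mul0r.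
have [l ->|->] := unliftP ord0 k; last first.
  by rewrite !consvS consv0/= big1 ?addr0// => j _; rewrite !E mul0r.
rewrite !consvS /= !mul0r !add0r (bigD1 l)//= big1 ?addr0.
  by rewrite !consvS/= E/= eqxx mul1r.
move=> j jl; rewrite E/= (_ : (_ == _) = false) ?mul0r//.
by rewrite !(inj_eq lift_inj) eq_sym (negbTE jl).
Qed.

Lemma rot2_tr n c s : (rot2 n c s)^T = rot2 n c (- s).
Proof.
apply/matrixP => i j; rewrite !mxE [in LHS]andbC opprK (eq_sym j).
case: ifPn => // /andP[i2 j2]; case: ifPn => // ij.
by case: i i2 ij => -[|[|i]] hi // _; case: j j2 => -[|[|j]] hj.
Qed.

Lemma rot2_orthogonal n c s : (c ^+ 2 + s ^+ 2 = 1)%R -> orthogonal_mx (rot2 n c s).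
Proof.
move=> cs; rewrite /orthogonal_mx rot2_tr; apply/matrixP => i j.
suff h v : rot2 n c (- s) *m (rot2 n c s *m v) = v :> 'cV[R]_n.+2.
  have /colP/(_ i) := h (delta_mx j ord0).
  by rewrite mulmxA -colE !mxE eqxx andbT.
have -> : v = consv (v ord0 ord0, consv (v (lift ord0 ord0) ord0,
    \col_i v (lift ord0 (lift ord0 i)) ord0)).
  apply/colP => k; have [l ->|->] := unliftP ord0 k; last by rewrite consv0.
  rewrite consvS/=; have [p ->|->] := unliftP ord0 l; last by rewrite consv0.
  by rewrite consvS mxE.
rewrite !rot2_consv; congr consv; congr pair; last congr consv; last congr pair.
- by rewrite -[RHS]mul1r -cs; ring.
- by rewrite -[RHS]mul1r -cs; ring.
Qed.

Lemma rot2_invariant n c s : (c ^+ 2 + s ^+ 2 = 1)%R -> gauss_invariant (rot2 n c s).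
Proof.
move=> cs f mf f0.
have mh : measurable_fun setT (fun w : (R * R) * 'cV[R]_n => consv (w.1.1, consv (w.1.2, w.2))).
  apply: (measurableT_comp (@measurable_consv n.+1)); apply: measurable_fun_pair.
    exact: (measurableT_comp measurable_fst measurable_fst).
  apply: (measurableT_comp (@measurable_consv n)); apply: measurable_fun_pair.
    exact: (measurableT_comp measurable_snd measurable_fst).
  exact: measurable_snd.
pose F (z : R * R) := \int[gauss n]_v f (consv (z.1, consv (z.2, v))).
have mF : measurable_fun setT F.
  apply: (@measurable_fun_fubini_tonelli_F _ _ _ _ _ (gauss n)
    (fun w => f (consv (w.1.1, consv (w.1.2, w.2))))) => //.
  exact: (measurableT_comp mf mh).
have F0 z : 0 <= F z by apply: integral_ge0.
have E g : measurable_fun setT g -> (forall v, 0 <= g v) ->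
    \int[gauss n.+2]_v g v =
    \int[gauss1]_x \int[gauss1]_y \int[gauss n]_v g (consv (x, consv (y, v))).
  move=> mg g0; rewrite [LHS](ge0_integral_gaussS mg g0); apply: eq_integral => x _.
  exact: (ge0_integral_gaussS (measurable_comp_consv x mg) (fun=> g0 _)).
have mr : measurable_fun setT (fun v : 'cV[R]_n.+2 => f (rot2 n c s *m v)).
  exact: (measurableT_comp mf (measurable_mulmxl _)).
rewrite [RHS](E f mf f0) [LHS](E _ mr (fun v => f0 _)).
rewrite -[RHS]/(\int[gauss1]_x \int[gauss1]_y F (x, y)).
rewrite -[RHS](gauss1_rotation cs mF F0).
apply: eq_integral => x _; apply: eq_integral => y _; apply: eq_integral => v _.
by rewrite rot2_consv /linear2/= mulNr.
Qed.

(** In dimension 1 there is no plane to rotate: the matrix is a sign, and the density is even. *)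
Lemma gauss_invariant1 (Q : 'M[R]_1) : orthogonal_mx Q -> gauss_invariant Q.
Proof.
move=> oQ f mf f0.
have : (Q ord0 ord0 ^+ 2 = 1)%R.
  have /matrixP/(_ ord0 ord0) := oQ.
  by rewrite !mxE big_ord_recl big_ord0 mxE addr0 eqxx expr2.
have QE (v : 'cV[R]_1) : Q *m v = Q ord0 ord0 *: v.
  by apply/colP => i; rewrite !mxE big_ord_recl big_ord0 addr0 !ord1.
under eq_integral do rewrite QE.
move/eqP; rewrite sqrf_eq1 => /orP[|] /eqP ->.
  by under eq_integral do rewrite scale1r.
under eq_integral do rewrite scaleN1r.
have mN : measurable_fun setT (fun v : 'cV[R]_1 => f (- v)%R).
  apply: (measurableT_comp mf); apply: measurable_mxP => i j.
  under eq_fun do rewrite mxE.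
  by apply: measurable_funN; exact: measurable_entry.
rewrite [LHS](ge0_integral_gaussS mN (fun=> f0 _)) [RHS](ge0_integral_gaussS mf f0).
have E x : \int[gauss 0]_v f (- consv (x, v))%R = \int[gauss 0]_v f (consv ((- x)%R, v)).
  apply: eq_integral => v _; congr f; apply/colP => i; rewrite !ord1 mxE.
  by rewrite !consv0.
under eq_integral do rewrite E.
pose F x := \int[gauss 0]_v f (consv (x, v)).
have mF : measurable_fun setT F by exact: measurable_integral_gauss.
have F0 x : 0 <= F x by exact: integral_ge0.
have mNR : measurable_fun [set: R] (fun x : R => F (- x)%R).
  by apply: (measurableT_comp mF); exact: measurable_funN.
rewrite -[RHS]/(\int[gauss1]_x F x) -[LHS]/(\int[gauss1]_x F (- x)%R).
rewrite [LHS](ge0_integral_gauss1 mNR (fun=> F0 _)) [RHS](ge0_integral_gauss1 mF F0).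
rewrite -[RHS](@ge0_integral_opp _ (fun x => F x * (normal_pdf 0 1 x)%:E)); last 2 first.
- apply: emeasurable_funM => //.
  by apply/measurable_EFinP; exact: measurable_normal_pdf.
- by move=> x; rewrite mule_ge0// lee_fin normal_pdf_ge0.
apply: eq_integral => x _; congr (_ * _%:E).
by rewrite !normal_pdfE ?oner_eq0// /normal_fun !subr0 sqrrN.
Qed.

(** In dimension at least 2, [block1 V] moves the first column of [Q] into the plane of the first
    two coordinates and a plane rotation brings it back to the first basis vector. With [P] the
    product of the two, [P *m Q] fixes that vector, so [P *m Q] and [block1 V] are both covered by
    the induction hypothesis, and the rotation by the planar case. *)
Theorem gauss_orthogonal n (Q : 'M[R]_n) : orthogonal_mx Q -> gauss_invariant Q.
Proof.
elim: n Q => [|[|n] IH] Q oQ.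
- by move=> f mf f0; apply: eq_integral => v _; rewrite (flatmx0 v) mulmx0.
- exact: gauss_invariant1.
have stab_inv (M : 'M[R]_n.+2) : stab 1 M -> gauss_invariant M.
  by move=> sM; have [V oV MV] := stab1_consv sM; exact: (gauss_invariant_consv (IH V oV) MV).
have block_inv (V : 'M[R]_n.+1) : orthogonal_mx V -> gauss_invariant (block1 V).
  by move=> oV; exact: (gauss_invariant_consv (IH V oV) (block1_consv V)).
pose w := Q *m basis _ 0.
pose w' : 'cV[R]_n.+1 := \col_i w (lift ord0 i) ord0.
pose V := householder 0 w'; pose c := w ord0 ord0; pose s := Num.sqrt (dot w' w').
have oV : orthogonal_mx V by exact: (proj1 (householder_stab _ _)).
have w'E i : w' i ord0 = w (lift ord0 i) ord0 by rewrite [LHS]mxE.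
have wE : w = consv (c, w').
  apply/colP => k; have [l ->|->] := unliftP ord0 k; last by rewrite consv0.
  by rewrite consvS w'E.
have tw : tail 0 w' = w' by apply/colP => i; rewrite tailP.
have Vw : V *m w' = consv (s, 0%R).
  rewrite -[X in V *m X]tw (householder_tail w' (ltn0Sn n)) tw -/s; apply/colP => i.
  rewrite [LHS]mxE [X in (_ * X)%R]mxE.
  have [l ->|->] := unliftP ord0 i; first by rewrite consvS mulr0 mxE.
  by rewrite consv0 mulr1.
have cs : (c ^+ 2 + s ^+ 2 = 1)%R.
  rewrite sqr_sqrtr ?dot_ge0//.
  have : dot w w = 1%R by rewrite dot_orthogonal// dot_basis mxE.
  rewrite dot_sqE big_ord_recl => <-; congr +%R.
  by rewrite dot_sqE; apply: eq_bigr => i _; rewrite w'E.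
have cs' : (c ^+ 2 + (- s) ^+ 2 = 1)%R by rewrite sqrrN.
pose P := rot2 n c (- s) *m block1 V.
have oP : orthogonal_mx P.
  by apply: orthogonalM; [exact: rot2_orthogonal|exact: block1_orthogonal].
have sPQ : stab 1 (P *m Q).
  apply: stabS; first split; first exact: orthogonalM.
    move=> v hv; suff -> : v = 0%R by rewrite mulmx0.
    by apply/colP => i; rewrite hv// mxE.
  rewrite -mulmxA -/w wE /P -mulmxA block1_consv Vw rot2_consv.
  apply/colP => k; rewrite [RHS]mxE.
  have [l ->|->] := unliftP ord0 k; last by rewrite consv0/= -cs; ring.
  rewrite consvS/=; have [p ->|->] := unliftP ord0 l; last by rewrite consv0/=; ring.
  by rewrite consvS mxE.
have -> : Q = P^T *m (P *m Q) by rewrite mulmxA oP mul1mx.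
apply: gauss_invariantM; last exact: stab_inv.
rewrite trmx_mul; apply: gauss_invariantM; last by rewrite rot2_tr opprK; exact: rot2_invariant.
have -> : (block1 V)^T = block1 V^T.
  by rewrite /block1 (@tr_block_mx _ 1 n.+1 1 n.+1) !trmx0 trmx1.
by apply: block_inv; exact: orthogonal_tr.
Qed.
End gaussian_vector.

(** * Haar integration *)

Section gauss_null.
Context {R : realType}.
Local Open Scope ereal_scope.

Lemma measurable_coord0 n (i : 'I_n) :
  measurable [set v : 'cV[R]_n | v i ord0 = 0%R].
Proof.
rewrite -[X in measurable X]setTI.
exact: (measurable_entry i ord0 measurableT (measurable_set1 0%R)).
Qed.

Lemma gauss_coord0 n (i : 'I_n) :
  gauss n [set v : 'cV[R]_n | v i ord0 = 0%R] = 0.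
Proof.
elim: n i => [[]//|n IH] i; rewrite /= /distribution /pushforward.
have [k ->|->] := unliftP ord0 i.
  have -> : @consv R n @^-1` [set v : 'cV[R]_n.+1 | v (lift ord0 k) ord0 = 0%R] =
      setT `*` [set v : 'cV[R]_n | v k ord0 = 0%R].
    by apply/seteqP; split => -[x v] /=; rewrite consvS/=; [split|case].
  rewrite product_measure1E//; last exact: measurable_coord0.
  by rewrite [X in _ * X]IH mule0.
have -> : @consv R n @^-1` [set v : 'cV[R]_n.+1 | v ord0 ord0 = 0%R] =
    [set 0%R] `*` setT.
  by apply/seteqP; split => -[x v] /=; rewrite consv0/=; [split|case].
rewrite product_measure1E//.
by rewrite [X in X * _](_ : _ = 0) ?mul0e//; exact: integral_set1.
Qed.

Lemma gauss_ae_tail n k (kn : (k < n)%N) :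
  {ae gauss n, forall g : 'cV[R]_n, tail k g != 0%R}.
Proof.
exists [set v : 'cV[R]_n | v (Ordinal kn) ord0 = 0%R]; split.
- exact: measurable_coord0.
- exact: gauss_coord0.
- move=> v /= /negP; rewrite negbK => /eqP tv.
  have := congr1 (fun w : 'cV[R]_n => w (Ordinal kn) ord0) tv.
  by rewrite /= tailP mxE/= ifT.
Qed.
End gauss_null.
#[local] Opaque gauss.

Section haar.
Context {R : realType} {n : nat}.
Local Open Scope ereal_scope.

Lemma measurable_householder k :
  measurable_fun setT (fun g : 'cV[R]_n => householder k g).
Proof.
have mt : measurable_fun setT (fun g : 'cV[R]_n => tail k g).
  apply: measurable_mxP => i j; under eq_fun do rewrite mxE.
  by case: (leqP k i) => _; [exact: measurable_entry|exact: measurable_cst].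
have mdot (f : 'cV[R]_n -> 'cV[R]_n) : measurable_fun setT f ->
    measurable_fun setT (fun g => dot (f g) (f g)).
  move=> mf; apply: measurable_sum => i.
  by apply: measurable_funM; exact: measurable_mx_entry.
pose u (g : 'cV[R]_n) := (tail k g - Num.sqrt (dot (tail k g) (tail k g)) *: basis n k)%R.
have mu : measurable_fun setT u.
  apply: measurable_submx => //; apply: measurable_mxP => i j.
  under eq_fun do rewrite mxE.
  apply: measurable_funM; last exact: measurable_cst.
  have msqrt : measurable_fun setT (@Num.sqrt R).
    by apply: continuous_measurable_fun; exact: sqrt_continuous.
  by apply: (measurableT_comp msqrt); exact: mdot.
apply: measurable_submx; first exact: measurable_cst.
apply: measurable_mxP => i j; under eq_fun do rewrite mxE.
apply: measurable_funM.
  apply: measurable_funM; first exact: measurable_cst.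
  by apply: measurable_inv; exact: mdot.
apply: measurable_mx_entry; apply: measurable_mulmx => //.
exact: measurable_trmx.
Qed.
(* Integration against the Haar measure of the group of orthogonal matrices
   fixing the first [n - d] basis vectors. *)
Fixpoint haar (d : nat) (f : 'M[R]_n -> \bar R) : \bar R :=
  if d is d'.+1 then
    \int[gauss n]_g haar d' (fun M => f (householder (n - d) g *m M))
  else f 1%:M.

Lemma haar_ge0 d f : (forall M, 0 <= f M) -> 0 <= haar d f.
Proof.
elim: d f => [|d IH] f f0 /=; first exact: f0.
by apply: integral_ge0 => g _; apply: IH.
Qed.

Lemma subnSS_lt d : (d < n)%N -> (n - d.+1 < n)%N.
Proof. by move=> dn; rewrite subnS prednK ?leq_subr// subn_gt0. Qed.

Lemma haar_eq d f f' : (d <= n)%N -> (forall M, stab (n - d) M -> f M = f' M) ->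
  haar d f = haar d f'.
Proof.
elim: d f f' => [|d IH] f f' dn ff' /=; first by apply: ff'; exact: stab1.
apply: eq_integral => g _; apply: IH; first exact: ltnW.
move=> M sM; apply: ff'; apply: stabM.
  by apply: householder_stab; exact: subnSS_lt.
by apply: stab_le sM; exact: leq_sub2l.
Qed.

Lemma measurable_mulH d (Z : measurableType d) k (F : Z * 'M[R]_n -> \bar R) :
  measurable_fun setT F ->
  measurable_fun setT (fun w : (Z * 'cV[R]_n) * 'M[R]_n =>
    F (w.1.1, householder k w.1.2 *m w.2)).
Proof.
move=> mF; apply: (measurableT_comp mF); apply: measurable_fun_pair.
  exact: (measurableT_comp measurable_fst measurable_fst).
apply: measurable_mulmx; last exact: measurable_snd.
apply: (measurableT_comp (measurable_householder k)).
exact: (measurableT_comp measurable_snd measurable_fst).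
Qed.

Lemma measurable_haar e d (Z : measurableType e) (F : Z * 'M[R]_n -> \bar R) :
  measurable_fun setT F -> (forall z, 0 <= F z) ->
  measurable_fun setT (fun z => haar d (fun M => F (z, M))).
Proof.
elim: d e Z F => [|d IH] e Z F mF F0 /=.
  apply: (measurableT_comp mF); apply: measurable_fun_pair => //; exact: measurable_cst.
apply: (@measurable_fun_fubini_tonelli_F _ _ _ _ _ (gauss n)
  (fun w : Z * 'cV[R]_n =>
    haar d (fun M => F (w.1, householder (n - d.+1) w.2 *m M)))).
  apply: (IH _ _ (fun w : (Z * 'cV[R]_n) * 'M[R]_n =>
    F (w.1.1, householder (n - d.+1) w.1.2 *m w.2))) => //.
  exact: measurable_mulH.
by move=> w; apply: haar_ge0.
Qed.

Lemma measurable_mulHM k (f : 'M[R]_n -> \bar R) : measurable_fun setT f ->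
  measurable_fun setT (fun w : 'cV[R]_n * 'M[R]_n => f (householder k w.1 *m w.2)).
Proof.
move=> mf; apply: (measurableT_comp mf); apply: measurable_mulmx; last exact: measurable_snd.
exact: (measurableT_comp (measurable_householder k) measurable_fst).
Qed.

Lemma haar_le d f f' : (d <= n)%N ->
  measurable_fun setT f -> measurable_fun setT f' ->
  (forall M, 0 <= f M) -> (forall M, 0 <= f' M) ->
  (forall M, stab (n - d) M -> f M <= f' M) -> haar d f <= haar d f'.
Proof.
elim: d f f' => [|d IH] f f' dn mf mf' f0 f'0 ff' /=; first by apply: ff'; exact: stab1.
have mH h k g : measurable_fun setT h ->
    measurable_fun setT (fun M : 'M[R]_n => h (householder k g *m M) : \bar R).
  move=> mh; apply: (measurableT_comp mh).
  by apply: measurable_mulmx; [exact: measurable_cst|exact: measurable_id].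
apply: ge0_le_integral => //.
- by move=> g _; exact: haar_ge0.
- exact: (measurable_haar d (measurable_mulHM (n - d.+1) mf)).
- exact: (measurable_haar d (measurable_mulHM (n - d.+1) mf')).
move=> g _; apply: IH => //; [exact: ltnW|exact: mH|exact: mH|].
move=> M sM; apply: ff'; apply: stabM.
  by apply: householder_stab; exact: subnSS_lt.
by apply: stab_le sM; exact: leq_sub2l.
Qed.

Lemma haar_cst d c : haar d (fun=> c) = c.
Proof.
elim: d => //= d ->; rewrite (integral_cst (gauss n) measurableT).
by rewrite [X in _ * X](_ : _ = 1) ?mule1//; exact: (@probability_setT _ _ _ (gauss n)).
Qed.

Lemma integral_haar e (Z : measurableType e) (mu : {sigma_finite_measure set Z -> \bar R})
    d (F : Z * 'M[R]_n -> \bar R) :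
  measurable_fun setT F -> (forall z, 0 <= F z) ->
  \int[mu]_z haar d (fun M => F (z, M)) = haar d (fun M => \int[mu]_z F (z, M)).
Proof.
elim: d F => //= d IH F mF F0.
rewrite (@fubini_tonelli _ _ _ _ _ mu (gauss n)
  (fun w : Z * 'cV[R]_n =>
    haar d (fun M => F (w.1, householder (n - d.+1) w.2 *m M))))/=; last 2 first.
- apply: (measurable_haar d (F := (fun w : (Z * 'cV[R]_n) * 'M[R]_n =>
    F (w.1.1, householder (n - d.+1) w.1.2 *m w.2)))) => //.
  exact: measurable_mulH.
- by move=> w; apply: haar_ge0.
apply: eq_integral => g _.
apply: (IH (fun w => F (w.1, householder (n - d.+1) g *m w.2))) => //.
apply: (measurableT_comp mF); apply: measurable_fun_pair => //.
by apply: measurable_mulmx; [exact: measurable_cst|exact: measurable_snd].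
Qed.

Lemma haar_swap d e (F : 'M[R]_n * 'M[R]_n -> \bar R) :
  measurable_fun setT F -> (forall z, 0 <= F z) ->
  haar d (fun M => haar e (fun N => F (M, N))) =
  haar e (fun N => haar d (fun M => F (M, N))).
Proof.
elim: d F => //= d IH F mF F0.
under eq_integral => g _.
  rewrite (IH (fun w => F (householder (n - d.+1) g *m w.1, w.2)))//; last first.
    apply: (measurableT_comp mF); apply: measurable_fun_pair => //.
    apply: measurable_mulmx; [exact: measurable_cst|exact: measurable_fst].
  over.
rewrite (integral_haar (gauss n) e (F := fun w : 'cV[R]_n * 'M[R]_n =>
  haar d (fun M => F (householder (n - d.+1) w.1 *m M, w.2))))//; last first.
  by move=> w; apply: haar_ge0.
apply: (measurable_haar d (F := fun w : ('cV[R]_n * 'M[R]_n) * 'M[R]_n =>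
  F (householder (n - d.+1) w.1.1 *m w.2, w.1.2))) => //.
apply: (measurableT_comp mF); apply: measurable_fun_pair; last first.
  exact: (measurableT_comp measurable_snd measurable_fst).
apply: measurable_mulmx; last exact: measurable_snd.
apply: (measurableT_comp (measurable_householder _)).
exact: (measurableT_comp measurable_fst measurable_fst).
Qed.

Lemma measurable_mull (Q : 'M[R]_n) (f : 'M[R]_n -> \bar R) :
  measurable_fun setT f -> measurable_fun setT (fun M : 'M[R]_n => f (Q *m M)).
Proof.
move=> mf; apply: (measurableT_comp mf).
by apply: measurable_mulmx; do ?[exact: measurable_cst|exact: measurable_id].
Qed.

Lemma measurable_mulr (Q : 'M[R]_n) (f : 'M[R]_n -> \bar R) :
  measurable_fun setT f -> measurable_fun setT (fun M : 'M[R]_n => f (M *m Q)).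
Proof.
move=> mf; apply: (measurableT_comp mf).
by apply: measurable_mulmx; do ?[exact: measurable_cst|exact: measurable_id].
Qed.

Lemma measurable_comp_tr (f : 'M[R]_n -> \bar R) :
  measurable_fun setT f -> measurable_fun setT (fun M : 'M[R]_n => f M^T).
Proof. by move=> mf; apply: (measurableT_comp mf); exact: measurable_trmx. Qed.

(** The substitution of [Q *m g] for [g] preserves the Gaussian measure, and [Q] times the
    reflection of [g] is the reflection of [Q *m g] times a matrix of the next stabilizer, absorbed
    by induction. This fails only where the tail of [g] vanishes, a null set. *)
Lemma haar_mull d (Q : 'M[R]_n) f : (d <= n)%N -> stab (n - d) Q ->
  measurable_fun setT f -> (forall M, 0 <= f M) ->
  haar d (fun M => f (Q *m M)) = haar d f.
Proof.
elim: d Q f => [|d IH] Q f dn sQ mf f0 /=.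
  by rewrite subn0 in sQ; rewrite (stab_full sQ) mul1mx.
have kn := subnSS_lt dn; set k := (n - d.+1)%N in sQ kn *.
pose phi g := haar d (fun M => f (householder k g *m M)).
have mphi : measurable_fun setT phi.
  exact: (measurable_haar d (measurable_mulHM k mf)).
have phi0 g : 0 <= phi g by apply: haar_ge0.
have mpsi : measurable_fun setT
    (fun g => haar d (fun M => f (Q *m (householder k g *m M)))).
  exact: (measurable_haar d (measurable_mulHM k (measurable_mull Q mf))).
rewrite -[RHS](gauss_orthogonal (proj1 sQ) mphi phi0).
have mphiQ : measurable_fun setT (fun g : 'cV[R]_n => phi (Q *m g)).
  exact: (measurableT_comp mphi (measurable_mulmxl Q)).
apply: (ge0_ae_eq_integral measurableT mpsi mphiQ).
- by move=> g _; exact: haar_ge0.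
- by move=> g _; exact: phi0.
apply: filterS (gauss_ae_tail kn) => g tg _.
have sS := householder_conj kn sQ tg.
rewrite (_ : k.+1 = (n - d)%N) in sS; last by rewrite /k -subSn// subSS.
rewrite /phi -(IH _ (fun M => f (householder k (Q *m g) *m M)) (ltnW dn) sS)//; last first.
  exact: measurable_mull.
apply: haar_eq; first exact: ltnW.
by move=> M _; congr f; rewrite !mulmxA householderK mul1mx.
Qed.
(* A left-invariant and a right-invariant probability coincide. *)
Lemma haar_tr d f : (d <= n)%N -> measurable_fun setT f -> (forall M, 0 <= f M) ->
  haar d (fun M => f M^T) = haar d f.
Proof.
move=> dn mf f0.
have mF : measurable_fun setT (fun w : 'M[R]_n * 'M[R]_n => f (w.1^T *m w.2)).
  apply: (measurableT_comp mf); apply: measurable_mulmx; last exact: measurable_snd.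
  by apply: measurable_trmx; exact: measurable_fst.
have := haar_swap d d mF (fun w => f0 _) => /= E.
transitivity (haar d (fun N : 'M[R]_n => haar d (fun M : 'M[R]_n => f (M^T *m N)))).
  rewrite -[LHS](haar_cst d); apply: haar_eq => // N sN.
  rewrite -(haar_mull dn (stab_tr sN) (f := fun M => f M^T))//; last exact: measurable_comp_tr.
  by apply: haar_eq => // M _; rewrite trmx_mul trmxK.
rewrite -E -[RHS](haar_cst d); apply: haar_eq => // M sM.
by rewrite (haar_mull dn (stab_tr sM)).
Qed.

Lemma haar_mulr d (Q : 'M[R]_n) f : (d <= n)%N -> stab (n - d) Q ->
  measurable_fun setT f -> (forall M, 0 <= f M) ->
  haar d (fun M => f (M *m Q)) = haar d f.
Proof.
move=> dn sQ mf f0.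
rewrite -(haar_tr dn (f := fun M => f (M *m Q)))//; last exact: measurable_mulr.
rewrite -[RHS](haar_tr dn)// -(haar_mull dn (stab_tr sQ) (f := fun M => f M^T))//; last first.
  exact: measurable_comp_tr.
by apply: haar_eq => // M _; rewrite trmx_mul trmxK.
Qed.

(** The random reflection is wanted on the right, next to [Q^T]: it is there that it produces the
    random direction contained in [U^T x]. *)
Lemma haarS_mulr d f : (d < n)%N -> measurable_fun setT f -> (forall M, 0 <= f M) ->
  haar d.+1 f =
  \int[gauss n]_g haar d (fun M => f (M *m householder (n - d.+1) g)).
Proof.
move=> dn mf f0; rewrite -haar_tr//=; apply: eq_integral => g _.
rewrite -[RHS](haar_tr (ltnW dn) (measurable_mulr (householder (n - d.+1) g) mf) (fun=> f0 _)).
by apply: haar_eq; [exact: ltnW|move=> M _; rewrite trmx_mul householder_tr].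
Qed.
End haar.

(** * Moments of a random direction *)

Lemma integral_gauss_cst {R : realType} n (c : \bar R) :
  (\int[@gauss R n]_g c = c)%E.
Proof.
rewrite (integral_cst (gauss n) measurableT).
rewrite [X in (_ * X)%E](_ : _ = 1%E) ?mule1//.
exact: (@probability_setT _ _ _ (gauss n)).
Qed.

Section squared_cosine.
Context {R : realType} {n : nat}.

(** Squared cosine of the angle between the tails of [a] and [g]: in the numerator the head of [g]
    is orthogonal to [tail k a]. *)
Definition sqcos (k : nat) (a g : 'cV[R]_n) : R :=
  dot (tail k a) g ^+ 2 / (dot (tail k a) (tail k a) * dot (tail k g) (tail k g)).

Lemma measurable_sqcos k a : measurable_fun setT (sqcos k a).
Proof.
have mt : measurable_fun setT (fun g : 'cV[R]_n => tail k g).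
  apply: measurable_mxP => i j; under eq_fun do rewrite mxE.
  by case: (leqP k i) => _; [exact: measurable_entry|exact: measurable_cst].
apply: measurable_funM.
  apply: measurable_funX; apply: measurable_sum => i.
  by apply: measurable_funM; [exact: measurable_cst|exact: measurable_entry].
apply: measurable_inv; apply: measurable_funM; first exact: measurable_cst.
by apply: measurable_sum => i; apply: measurable_funM; exact: measurable_mx_entry.
Qed.

Lemma sqcos_ge0 k a g : 0 <= sqcos k a g.
Proof. by rewrite divr_ge0 ?sqr_ge0// mulr_ge0// dot_ge0. Qed.

Lemma sqcos_householder k a g : (k < n)%N -> tail k a != 0 ->
  sqcos k a (householder k a *m g) = sqcos k (basis n k) g.
Proof.
move=> kn a0; have sH := householder_stab a kn.
rewrite /sqcos -(stab_tail _ sH) (dot_orthogonal _ _ (proj1 sH)).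
have tb : tail k (basis n k) = basis n k :> 'cV[R]_n.
  by apply/colP => i; rewrite !mxE; case: leqP => // ik; rewrite ltn_eqF.
rewrite -{1}(householder_tr k a) -dot_mull householder_tail// tb dotZl.
rewrite (dot_basis kn (basis n k)) mxE eqxx mul1r exprMn sqr_sqrtr ?dot_ge0//.
by rewrite invfM mulrACA divff ?mul1r// dot_eq0.
Qed.
Local Open Scope ereal_scope.

(** The reflection of [a] moves its tail to the direction of [basis n k] without changing the law of
    [g], so the law of the cosine does not depend on [a]. *)
Lemma integral_sqcos k a (phi : R -> R) : (k < n)%N -> tail k a != 0%R ->
  measurable_fun setT phi -> (forall x, (0 <= x)%R -> (0 <= phi x)%R) ->
  \int[gauss n]_g (phi (sqcos k a g))%:E =
  \int[gauss n]_g (phi (sqcos k (basis n k) g))%:E.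
Proof.
move=> kn a0 mphi phi0.
have mf : measurable_fun setT (fun g : 'cV[R]_n => (phi (sqcos k a g))%:E).
  by apply/measurable_EFinP; exact: (measurableT_comp mphi (measurable_sqcos k a)).
have f0 g : 0 <= (phi (sqcos k a g))%:E by rewrite lee_fin phi0// sqcos_ge0.
have oH := proj1 (householder_stab a kn).
rewrite -[LHS](gauss_orthogonal oH mf f0).
by apply: eq_integral => g _; rewrite sqcos_householder.
Qed.

Lemma tail_basis k (i : 'I_n) : (k <= i)%N -> tail k (basis n i) = basis n i :> 'cV[R]_n.
Proof.
move=> ki; apply/colP => j; rewrite !mxE; case: leqP => // jk.
by rewrite ltn_eqF// (leq_trans jk ki).
Qed.

Lemma dot_basisE (i : 'I_n) (v : 'cV[R]_n) : dot (basis n i) v = v i ord0.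
Proof. by rewrite (dot_basis (ltn_ord i)); congr (v _ _); apply/val_inj. Qed.

Lemma basis_neq0 (i : 'I_n) : basis n i != 0%R :> 'cV[R]_n.
Proof.
apply/eqP => /(congr1 (dot (basis n i))); rewrite !dot_basisE !mxE eqxx => /eqP.
by rewrite oner_eq0.
Qed.

Definition share k (i : 'I_n) (g : 'cV[R]_n) : R :=
  (g i ord0 ^+ 2 / dot (tail k g) (tail k g))%R.

Lemma sqcos_basis k (i : 'I_n) g : (k <= i)%N -> sqcos k (basis n i) g = share k i g.
Proof.
by move=> ki; rewrite /sqcos tail_basis// !dot_basisE mxE eqxx mul1r.
Qed.

Lemma sqcos_diag k (i j : 'I_n) b g : (k <= i)%N -> (k <= j)%N -> i != j ->
  (b ^+ 2 = 1)%R ->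
  sqcos k (basis n i + b *: basis n j) g =
  ((g i ord0 + b * g j ord0) ^+ 2 / (2 * dot (tail k g) (tail k g)))%R.
Proof.
move=> ki kj ij b2; rewrite /sqcos.
have -> : tail k (basis n i + b *: basis n j) = (basis n i + b *: basis n j)%R.
  apply/colP => l; rewrite [LHS]mxE.
  have := congr1 (fun v : 'cV[R]_n => v l ord0) (tail_basis ki).
  have := congr1 (fun v : 'cV[R]_n => v l ord0) (tail_basis kj).
  rewrite /= !tailP; case: leqP => // _ h1 h2.
  by rewrite mxE -h2 [X in (_ + X)%R]mxE -h1 mulr0 addr0.
rewrite !(dotDl, dotDr, dotZl, dotZr) !dot_basisE !mxE !eqxx.
rewrite (negbTE (_ : val i != val j))// (eq_sym (val j)) (negbTE (_ : val i != val j))//.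
rewrite (_ : 2 = 1 + b ^+ 2)%R; last by rewrite b2.
by congr (_ / (_ * _))%R; rewrite /=; ring.
Qed.

Lemma tail_diag_neq0 k (i j : 'I_n) (b : R) : (k <= i)%N -> i != j ->
  tail k (basis n i + b *: basis n j) != 0%R.
Proof.
move=> ki ij; apply/eqP => /colP/(_ i); rewrite tailP ki !mxE eqxx.
by rewrite (negbTE (_ : val i != val j))// mulr0 addr0 => /eqP; rewrite oner_eq0.
Qed.

Lemma share_ge0 k (i : 'I_n) g : (0 <= share k i g)%R.
Proof. by rewrite divr_ge0 ?sqr_ge0// dot_ge0. Qed.

Lemma measurable_share k (i : 'I_n) : measurable_fun setT (fun g => (share k i g)).
Proof.
have mt : measurable_fun setT (fun g : 'cV[R]_n => tail k g).
  apply: measurable_mxP => l j; under eq_fun do rewrite mxE.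
  by case: (leqP k l) => _; [exact: measurable_entry|exact: measurable_cst].
apply: measurable_funM; first by apply: measurable_funX; exact: measurable_entry.
apply: measurable_inv; apply: measurable_sum => j.
by apply: measurable_funM; exact: measurable_mx_entry.
Qed.

Lemma sum_share k g : (\sum_(i < n | (k <= i)%N) share k i g <= 1)%R.
Proof.
rewrite -mulr_suml.
have -> : (\sum_(i < n | (k <= i)%N) g i ord0 ^+ 2 = dot (tail k g) (tail k g))%R.
  rewrite dot_sqE big_mkcond; apply: eq_bigr => i _; rewrite tailP.
  by case: leqP => // _; rewrite expr0n.
have [->|d0] := eqVneq (dot (tail k g) (tail k g)) 0%R; first by rewrite mul0r.
by rewrite divff.
Qed.

Lemma share_le1 k (i : 'I_n) g : (k <= i)%N -> (share k i g <= 1)%R.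
Proof.
move=> ki; apply: le_trans (sum_share k g); rewrite (bigD1 i)//= lerDl.
by apply: sumr_ge0 => j _; exact: share_ge0.
Qed.

Lemma sumr_const_ge k (c : R) :
  (\sum_(i < n | (k <= i)%N) c = (n - k)%:R * c)%R.
Proof. by rewrite -(big_geq_mkord _ _ xpredT (fun=> c)) sumr_const_nat mulr_natl. Qed.

Definition gmean (f : 'cV[R]_n -> R) : R := fine (\int[gauss n]_g (f g)%:E).

(** Values in the unit interval make the integral finite, so that [fine] in [gmean] loses
    nothing. *)
Definition unit_fun (f : 'cV[R]_n -> R) :=
  measurable_fun setT f /\ forall g, (0 <= f g <= 1)%R.

Lemma integral_unit_le1 f : unit_fun f -> \int[gauss n]_g (f g)%:E <= 1.
Proof.
move=> [mf f01]; rewrite -[leRHS](@integral_gauss_cst _ n).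
apply: ge0_le_integral.
- exact: measurableT.
- by move=> g _; rewrite lee_fin; case/andP: (f01 g).
- exact/measurable_EFinP.
- exact: measurable_cst.
- by move=> g _; rewrite lee_fin; case/andP: (f01 g).
Qed.

Lemma gmeanE f : unit_fun f -> \int[gauss n]_g (f g)%:E = (gmean f)%:E.
Proof.
move=> uf; have [mf f01] := uf; rewrite fineK// ge0_fin_numE.
  exact: le_lt_trans (integral_unit_le1 uf) (ltry _).
by apply: integral_ge0 => g _; rewrite lee_fin; case/andP: (f01 g).
Qed.

Lemma gmean_le1 f : unit_fun f -> (gmean f <= 1)%R.
Proof. by move=> uf; rewrite -lee_fin -gmeanE//; exact: integral_unit_le1. Qed.

Lemma gmean_ge0 f : (forall g, (0 <= f g)%R) -> (0 <= gmean f)%R.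
Proof. by move=> f0; apply: fine_ge0; apply: integral_ge0 => g _; rewrite lee_fin. Qed.

Lemma integral_sum (I : finType) (P : pred I) (c : I -> R) (F : I -> 'cV[R]_n -> R) :
  (forall i, (0 <= c i)%R) -> (forall i, P i -> unit_fun (F i)) ->
  \int[gauss n]_g (\sum_(i | P i) c i * F i g)%R%:E =
  (\sum_(i | P i) c i * gmean (F i))%R%:E.
Proof.
move=> c0 uF; under eq_integral do rewrite -sumEFin big_mkcond.
rewrite -sumEFin big_mkcond ge0_integral_sum.
- apply: eq_bigr => i _; case: ifPn => Pi; last by rewrite integral0.
  under eq_integral do rewrite EFinM.
  have [mF F01] := uF i Pi.
  rewrite EFinM -gmeanE; last by split.
  rewrite ge0_integralZl_EFin//.
  - by move=> g _; rewrite lee_fin; case/andP: (F01 g).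
  - exact/measurable_EFinP.
- exact: measurableT.
- move=> i; have [Pi|Pi] := boolP (P i); last exact: measurable_cst.
  apply/measurable_EFinP; apply: measurable_funM; first exact: measurable_cst.
  by case: (uF i Pi).
- move=> i g _; case: ifPn => // Pi; rewrite lee_fin mulr_ge0//.
  by case: (uF i Pi) => _ /(_ g)/andP[].
Qed.

Lemma gmean_lin2 a b f h : (0 <= a)%R -> (0 <= b)%R -> unit_fun f -> unit_fun h ->
  gmean (fun g => a * f g + b * h g)%R = (a * gmean f + b * gmean h)%R.
Proof.
move=> a0 b0 uf uh.
have := @integral_sum bool xpredT (fun x => if x then a else b) (fun x => if x then f else h).
rewrite big_bool/= => E; apply: EFin_inj; rewrite -E//; last 2 first.
- by case.
- by case.
rewrite /gmean fineK//; last first.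
  by under eq_integral => g _ do rewrite -(big_bool _ (fun x => (if x then a else b) * (if x then f else h) g)%R)/=; rewrite E//; case.
by apply: eq_integral => g _; rewrite big_bool.
Qed.

Lemma gmean_sum_le (I : finType) (P : pred I) (c : I -> R) (F : I -> 'cV[R]_n -> R) h :
  (forall i, (0 <= c i)%R) ->
  (forall i, P i -> unit_fun (F i)) -> unit_fun h ->
  (forall g, (\sum_(i | P i) c i * F i g <= h g)%R) ->
  (\sum_(i | P i) c i * gmean (F i) <= gmean h)%R.
Proof.
move=> c0 uF uh Fh; rewrite -lee_fin -gmeanE//.
rewrite -integral_sum//.
apply: ge0_le_integral.
- exact: measurableT.
- move=> g _; rewrite lee_fin; apply: sumr_ge0 => i Pi; rewrite mulr_ge0//.
  by case: (uF i Pi) => _ /(_ g)/andP[].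
- apply/measurable_EFinP; under eq_fun do rewrite big_mkcond.
  apply: measurable_sum => i; have [Pi|Pi] := boolP (P i); last exact: measurable_cst.
  apply: measurable_funM; first exact: measurable_cst.
  by case: (uF i Pi).
- by apply/measurable_EFinP; case: uh.
- by move=> g _; rewrite lee_fin.
Qed.

Lemma unit_share k (i : 'I_n) : (k <= i)%N -> unit_fun (share k i).
Proof.
move=> ki; split; first exact: measurable_share.
by move=> g; rewrite share_ge0 share_le1.
Qed.

Lemma unit_funM f h : unit_fun f -> unit_fun h -> unit_fun (fun g => f g * h g)%R.
Proof.
move=> [mf f01] [mh h01]; split; first exact: measurable_funM.
by move=> g; have /andP[? ?] := f01 g; have /andP[? ?] := h01 g; rewrite mulr_ge0// mulr_ile1.
Qed.

Lemma sqcos_le1 k a g : (sqcos k a g <= 1)%R.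
Proof.
have [a0|a0] := eqVneq (tail k a) 0%R.
  by rewrite /sqcos a0 (_ : dot 0 g = 0%R) ?expr0n ?mul0r// -(scale0r g) dotZl mul0r.
have [nk|kn] := leqP n k.
  case/eqP: a0; apply/colP => i; rewrite !mxE leqNgt (leq_trans (ltn_ord i) nk)//.
rewrite -[g](orthogonal_Ktr _ (proj1 (householder_stab a kn))) sqcos_householder//.
by rewrite (sqcos_basis (i := Ordinal kn))// share_le1.
Qed.

Lemma unit_sqcos k a : unit_fun (sqcos k a).
Proof.
split; first exact: measurable_sqcos.
by move=> g; rewrite sqcos_ge0 sqcos_le1.
Qed.

Lemma gmean_sqcos k a p : (k < n)%N -> tail k a != 0%R ->
  gmean (fun g => sqcos k a g ^+ p)%R = gmean (fun g => sqcos k (basis n k) g ^+ p)%R.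
Proof.
move=> kn a0; congr fine; apply: (integral_sqcos (phi := fun x => x ^+ p)%R kn a0).
  exact: exprn_measurable.
by move=> x x0; rewrite exprn_ge0.
Qed.

Lemma gmean_share k (i : 'I_n) p : (k < n)%N -> (k <= i)%N ->
  gmean (fun g => share k i g ^+ p)%R = gmean (fun g => sqcos k (basis n k) g ^+ p)%R.
Proof.
move=> kn ki; rewrite -(gmean_sqcos p kn (a := basis n i)) ?tail_basis ?basis_neq0//.
by congr gmean; apply/funext => g; rewrite sqcos_basis.
Qed.

Lemma unit_cst1 : unit_fun (fun=> 1%R).
Proof. by split; [exact: measurable_cst|move=> g; rewrite ler01 lexx]. Qed.

(** The [n - k] shares of the coordinates have equal means and sum to at most 1. *)
Lemma gmean_sqcos1 k a : (k < n)%N -> tail k a != 0%R ->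
  (gmean (sqcos k a) <= (n - k)%:R^-1)%R.
Proof.
move=> kn a0.
have -> : gmean (sqcos k a) = gmean (fun g => sqcos k a g ^+ 1)%R by [].
rewrite gmean_sqcos//; set m := gmean _.
have : (\sum_(i < n | (k <= i)%N) 1 * gmean (share k i) <= 1)%R.
  apply: le_trans (gmean_le1 unit_cst1).
  apply: gmean_sum_le => //; first by move=> i ki; exact: unit_share.
  - exact: unit_cst1.
  - by move=> g; under eq_bigr do rewrite mul1r; exact: sum_share.
have -> : (\sum_(i < n | (k <= i)%N) 1 * gmean (share k i) = (n - k)%:R * m)%R.
  rewrite -sumr_const_ge; apply: eq_bigr => i ki; rewrite mul1r.
  by rewrite /m -(gmean_share 1 kn ki).
by rewrite -ler_pdivlMl ?mulr1 ?ltr0n ?subn_gt0.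
Qed.
(* Rotating the plane of two coordinates by 45 degrees compares their fourth
   moment with their mixed second moment. *)
Lemma gmean_shareM k (i j : 'I_n) : (k < n)%N -> (k <= i)%N -> (k <= j)%N -> i != j ->
  (gmean (fun g => sqcos k (basis n k) g ^+ 2) =
   3 * gmean (fun g => share k i g * share k j g))%R.
Proof.
move=> kn ki kj ij; set m := gmean _; set c := gmean _.
have uX2 f : unit_fun f -> unit_fun (fun g => f g ^+ 2)%R.
  by move=> uf; have := unit_funM uf uf; under eq_fun do rewrite -expr2.
have h0 : (0 <= 2^-1 :> R)%R by rewrite invr_ge0.
pose f1 g := (2^-1 * share k i g ^+ 2 + 2^-1 * share k j g ^+ 2)%R.
have us (l : 'I_n) : (k <= l)%N -> unit_fun (fun g => share k l g ^+ 2)%R.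
  by move=> kl; apply: uX2; exact: unit_share.
have uf1 : unit_fun f1.
  have [m1 b1] := us i ki; have [m2 b2] := us j kj; split.
    by apply: measurable_funD; apply: measurable_funM => //; exact: measurable_cst.
  by move=> g; have := b1 g; have := b2 g; rewrite /f1; lra.
have E1 : gmean f1 = m.
  rewrite gmean_lin2//; [|exact: us|exact: us].
  by rewrite !gmean_share// -/m; lra.
have ucos b : unit_fun (fun g => sqcos k (basis n i + b *: basis n j) g ^+ 2)%R.
  by apply: uX2; exact: unit_sqcos.
(* Adding both signs cancels the odd terms: [(x + y) ^ 4 + (x - y) ^ 4 = 2 x ^ 4 + 12 x ^ 2 y ^ 2 +
   2 y ^ 4], and each of the two diagonal directions has second moment [m]. *)
have : gmean (fun g => 2^-1 * sqcos k (basis n i + 1 *: basis n j) g ^+ 2 +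
    2^-1 * sqcos k (basis n i + (- 1) *: basis n j) g ^+ 2)%R = m.
  rewrite gmean_lin2// !gmean_sqcos ?tail_diag_neq0// -/m; lra.
have -> : (fun g => 2^-1 * sqcos k (basis n i + 1 *: basis n j) g ^+ 2 +
    2^-1 * sqcos k (basis n i + (- 1) *: basis n j) g ^+ 2)%R =
    (fun g => 2^-1 * f1 g + 3 / 2 * (share k i g * share k j g))%R.
  apply/funext => g; rewrite !sqcos_diag ?expr1n ?sqrrN ?expr1n// /f1 /share.
  have [->|d0] := eqVneq (dot (tail k g) (tail k g)) 0%R.
    by rewrite mulr0 invr0; ring.
  by field.
rewrite gmean_lin2//; [|by apply: unit_funM; exact: unit_share].
by rewrite E1 -/c; lra.
Qed.

(** Multiply the sum of the shares by the share of one coordinate [i0] and integrate. Each of the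
    [n - k] products has mean at least [m / 3], with equality off the diagonal, while the total is
    at most the mean of one share, [(n - k)^-1]. *)
Lemma gmean_sqcos2 k a : (k < n)%N -> tail k a != 0%R ->
  (gmean (fun g => sqcos k a g ^+ 2) <= 3 * (n - k)%:R^-1 ^+ 2)%R.
Proof.
move=> kn a0; rewrite gmean_sqcos//; set m := gmean _.
pose i0 := Ordinal kn; have ki0 : (k <= i0)%N by [].
set N : R := (n - k)%:R; have N0 : (0 < N)%R by rewrite ltr0n subn_gt0.
have m0 : (0 <= m)%R by apply: gmean_ge0 => g; rewrite exprn_ge0// sqcos_ge0.
have ush (i : 'I_n) : (k <= i)%N -> unit_fun (fun g => share k i g * share k i0 g)%R.
  by move=> ki; apply: unit_funM; exact: unit_share.
have : (\sum_(i < n | (k <= i)%N) 1 * gmean (fun g => share k i g * share k i0 g)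
    <= gmean (share k i0))%R.
  apply: gmean_sum_le => //; first exact: unit_share.
  move=> g; under eq_bigr do rewrite mul1r.
  by rewrite -mulr_suml -[leRHS]mul1r ler_wpM2r ?share_ge0 ?sum_share.
have -> : gmean (share k i0) = gmean (sqcos k (basis n i0)).
  by congr gmean; apply/funext => g; rewrite sqcos_basis.
have := gmean_sqcos1 kn (a := basis n i0); rewrite tail_basis// => /(_ (basis_neq0 i0)).
move=> h1 /le_trans/(_ h1); rewrite -/N.
have lb : (\sum_(i < n | (k <= i)%N) m / 3 <=
    \sum_(i < n | (k <= i)%N) 1 * gmean (fun g => share k i g * share k i0 g))%R.
  apply: ler_sum => i ki; rewrite mul1r; have [->|ii0] := eqVneq i i0.
    have -> : gmean (fun g => share k i0 g * share k i0 g)%R = m.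
      by rewrite /m -(gmean_share 2 kn ki0); under [in RHS]eq_fun do rewrite expr2.
    by rewrite ler_pdivrMr// ler_peMr// ler1n.
  by rewrite /m (gmean_shareM kn ki ki0 ii0) mulrC mulKf.
move/(le_trans lb); rewrite sumr_const_ge -/N.
rewrite -(ler_pM2l N0) divff ?gt_eqF// => h2.
rewrite exprVn -ler_pdivrMr ?invr_gt0 ?exprn_gt0// invrK expr2.
by move: h2; set N2 := (N * (N * _))%R => h2; rewrite (_ : m * _ = 3 * N2)%R; [lra|rewrite /N2; field].
Qed.
End squared_cosine.

(** * Chebyshev quadrature *)

Section lagrange.
Context {R : realType}.

(** Value at the origin of the Lagrange basis polynomial of the node [s i]. *)
Definition lagrange0 d (s : 'I_d.+1 -> R) (i : 'I_d.+1) : R :=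
  \prod_(l < d.+1 | l != i) (s l / (s l - s i)).

Lemma lagrange0_sum d (s : 'I_d.+1 -> R) (q : {poly R}) : injective s ->
  (size q <= d.+1)%N -> \sum_i lagrange0 s i * q.[s i] = q.[0].
Proof.
move=> s_inj sq.
pose L i : {poly R} := \prod_(l < d.+1 | l != i) ((s i - s l)^-1 *: ('X - (s l)%:P)).
pose p := q - \sum_i q.[s i] *: L i.
have LE i x : (L i).[x] = \prod_(l < d.+1 | l != i) ((s i - s l)^-1 * (x - s l)).
  by rewrite horner_prod; apply: eq_bigr => l _; rewrite hornerE !hornerE.
have Lii i : (L i).[s i] = 1.
  rewrite LE; apply: big1 => l li; rewrite mulVf// subr_eq0.
  by apply: contra li => /eqP/s_inj ->.
have Lij i j : i != j -> (L i).[s j] = 0.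
  by move=> ij; rewrite LE (bigD1 j) 1?eq_sym//= subrr mulr0 mul0r.
have sL i : (size (L i) <= d.+1)%N.
  apply: leq_trans (size_poly_prod_leq _ _) _.
  have -> : #|(fun l => l != i)| = d.
    by have := cardC (pred1 i); rewrite card1 card_ord add1n => -[].
  apply: (@leq_trans ((\sum_(l < d.+1 | l != i) 2).+1 - d)%N).
    apply: leq_sub2r; rewrite ltnS; apply: leq_sum => l _.
    by apply: leq_trans (size_scale_leq _ _) _; rewrite size_XsubC.
  rewrite sum_nat_const.
  have -> : #|(fun l => l != i)| = d.
    by have := cardC (pred1 i); rewrite card1 card_ord add1n => -[].
  by rewrite muln2 -addnn -addSn addnK.
have p0 : p = 0.
  apply: (@roots_geq_poly_eq0 _ p [seq s i | i <- enum 'I_d.+1]).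
  - apply/allP => _ /mapP[j _ ->]; rewrite /root /p hornerD hornerN horner_sum.
    rewrite (bigD1 j)//= hornerZ Lii mulr1 big1 ?addr0 ?subrr// => i ij.
    by rewrite hornerZ Lij// mulr0.
  - by rewrite map_inj_uniq// enum_uniq.
  - rewrite size_map size_enum_ord; apply: leq_trans (size_polyD _ _) _.
    rewrite geq_max sq size_polyN; apply: leq_trans (size_sum _ _ _) _.
    by apply/bigmax_leqP => i _; apply: leq_trans (size_scale_leq _ _) _.
have /eqP := p0; rewrite subr_eq0 => /eqP {2}->.
rewrite horner_sum; apply: eq_bigr => i _; rewrite hornerZ mulrC LE; congr (_ * _).
apply: eq_bigr => l li; by rewrite sub0r -[s i - s l](opprB (s l)) invrN mulrNN mulrC.
Qed.

(** The nodes are positive and decreasing, so a factor is negative exactly when [i < l]; there are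
    [d - i] such factors, and [d - i] has the parity of [d + i]. *)
Lemma lagrange0_sign d (s : 'I_d.+1 -> R) (i : 'I_d.+1) :
  (forall i, 0 < s i) -> (forall i j : 'I_d.+1, (i < j)%N -> s j < s i) ->
  `|lagrange0 s i| = (-1) ^+ d * ((-1) ^+ i * lagrange0 s i).
Proof.
move=> s0 sd.
have -> : (-1) ^+ d * ((-1) ^+ i * lagrange0 s i) =
    \prod_(l < d.+1 | l != i) ((if (l < i)%N then 1 else -1) * (s l / (s l - s i))).
  rewrite big_split/= mulrA; congr (_ * _).
  have : \prod_(l < d.+1) (if (l < i)%N then 1 else -1 : R) = (-1) ^+ (d.+1 - i).
    rewrite -(big_mkord xpredT (fun l => if (l < i)%N then 1 else -1 : R)).
    rewrite (big_cat_nat (n := i))//=; last exact: ltnW.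
    rewrite big_nat big1 ?mul1r; last by move=> l /andP[_ ->].
    rewrite big_nat (eq_bigr (fun=> -1)) -?big_nat ?prodr_const_nat//.
    by move=> l /andP[il _]; rewrite ltnNge il.
  rewrite (bigD1 i)//= ltnn subSn; last by rewrite -ltnS.
  rewrite exprS => /mulrI -> //; last by rewrite unitrN1.
  rewrite -exprD -signr_odd -[RHS]signr_odd; congr (_ ^+ nat_of_bool _).
  by rewrite oddD oddB// -ltnS.
rewrite normr_prod; apply: eq_bigr => l li.
have [ltli|] := ltnP l i.
  by rewrite mul1r ger0_norm// divr_ge0// ltW// subr_gt0 sd.
rewrite leq_eqVlt => /orP[/eqP/val_inj il|ltil]; first by rewrite il eqxx in li.
rewrite mulN1r ler0_norm//; apply: mulr_ge0_le0; first exact: ltW.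
by rewrite invr_le0 subr_le0 ltW// sd.
Qed.

Lemma lagrange0_neq0 d (s : 'I_d.+1 -> R) i :
  (forall i, 0 < s i) -> injective s -> lagrange0 s i != 0.
Proof.
move=> s0 s_inj; apply/prodf_neq0 => l li; apply: mulf_neq0; first by rewrite gt_eqF.
rewrite invr_eq0 subr_eq0.
by apply: contra li => /eqP/s_inj ->.
Qed.

(** Two consecutive polynomials are computed together to make the two-term recurrence structural. *)
Fixpoint chebyshev2 n : {poly R} * {poly R} :=
  if n is n'.+1 then
    let: (p, q) := chebyshev2 n' in (q, 2 *: ('X * q) - p)
  else (1, 'X).

Definition chebyshev n : {poly R} := (chebyshev2 n).1.

Lemma chebyshevSS n : chebyshev n.+2 = 2 *: ('X * chebyshev n.+1) - chebyshev n.
Proof. by rewrite /chebyshev/=; case: (chebyshev2 n). Qed.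

Lemma chebyshev_rec (P : nat -> {poly R} -> Prop) :
  P 0%N 1 -> P 1%N 'X ->
  (forall n p q, P n p -> P n.+1 q -> P n.+2 (2 *: ('X * q) - p)) ->
  forall n, P n (chebyshev n).
Proof.
move=> P0 P1 PS n; suff : P n (chebyshev n) /\ P n.+1 (chebyshev n.+1) by case.
elim: n => [|n [IH1 IH2]]; first by split.
by split => //; rewrite chebyshevSS; exact: PS.
Qed.

Lemma size_chebyshev n : (size (chebyshev n) <= n.+1)%N.
Proof.
apply: (chebyshev_rec (P := fun n p => size p <= n.+1)%N) => {n}.
- by rewrite size_poly1.
- by rewrite size_polyX.
- move=> n p q sp sq; apply: leq_trans (size_polyD _ _) _.
  rewrite geq_max size_polyN (leq_trans sp) ?andbT; last by rewrite !ltnS ltnW.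
  apply: leq_trans (size_scale_leq _ _) _; have [->|q0] := eqVneq q 0.
    by rewrite mulr0 size_poly0.
  by rewrite mulrC size_mulX// ltnS.
Qed.

Lemma chebyshev_cos n (x : R) : (chebyshev n).[cos x] = cos (n%:R * x).
Proof.
apply: (chebyshev_rec (P := fun n p => p.[cos x] = cos (n%:R * x))) => {n}.
- by rewrite hornerE mul0r cos0.
- by rewrite hornerE mul1r.
- move=> n p q sp sq; rewrite !(hornerD, hornerN, hornerZ, hornerM, hornerX, hornerC) sp sq.
  have -> : n.+2%:R * x = n.+1%:R * x + x by rewrite -natr1; ring.
  have -> : n%:R * x = n.+1%:R * x - x by rewrite -natr1; ring.
  by rewrite cosB cosD; ring.
Qed.

Lemma chebyshev_joukowski n (z : R) : z != 0 ->
  (chebyshev n).[(z + z^-1) / 2] = (z ^+ n + z ^- n) / 2.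
Proof.
move=> z0; apply: (chebyshev_rec (P := fun n p =>
  p.[(z + z^-1) / 2] = (z ^+ n + z ^- n) / 2)) => {n}.
- by rewrite hornerE expr0 invr1; field.
- by rewrite hornerE expr1.
- move=> n p q sp sq; rewrite !(hornerD, hornerN, hornerZ, hornerM, hornerX, hornerC) sp sq !exprS; field.
  by rewrite z0 expf_neq0.
Qed.

Definition cheb_angle d (i : 'I_d.+1) : R := i%:R * (pi / d%:R).
(* The images of the extremal points of the Chebyshev polynomial of degree [d]
   under the affine map from [-1, 1] onto [1, k^2]. *)
Definition cheb_node (k : R) d (i : 'I_d.+1) : R :=
  ((k ^+ 2 + 1) + (k ^+ 2 - 1) * cos (cheb_angle i)) / 2.

Lemma cheb_angle_itv d (i : 'I_d.+1) : 0 <= cheb_angle i <= pi.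
Proof.
rewrite /cheb_angle.
have p0 : 0 <= (pi : R) by exact: pi_ge0.
rewrite mulr_ge0 ?divr_ge0//=; case: d i => [|d] i.
  by rewrite invr0 !mulr0.
rewrite mulrCA ler_piMr// ler_pdivrMr// mul1r ler_nat -ltnS//.
Qed.

Lemma cheb_node_itv k d (i : 'I_d.+1) : 1 <= k -> 1 <= cheb_node k i <= k ^+ 2.
Proof.
move=> k1; have := cos_geN1 (cheb_angle i).
have := cos_le1 (cheb_angle i); rewrite /cheb_node.
have : 0 <= k ^+ 2 - 1 by nra.
move: (cos _) (k ^+ 2) => c b b0 c1 c2.
have : 0 <= (b - 1) * (1 - c) by apply: mulr_ge0; lra.
have : 0 <= (b - 1) * (1 + c) by apply: mulr_ge0; lra.
by move=> h1 h2; apply/andP; split; lra.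
Qed.

Lemma cheb_node_lt k d (i j : 'I_d.+1) : 1 < k -> (i < j)%N ->
  cheb_node k j < cheb_node k i.
Proof.
move=> k1 ij; rewrite /cheb_node ltr_pM2r ?invr_gt0// ltrD2l ltr_pM2l; last by nra.
rewrite ltr_cos ?in_itv/= ?cheb_angle_itv// ltr_pM2r ?ltr_nat//.
by rewrite divr_gt0 ?pi_gt0// ltr0n; case: d i j ij => // i j; rewrite !ord1.
Qed.

Lemma cheb_node_inj k d : 1 < k -> injective (@cheb_node k d).
Proof.
move=> k1 i j ij; apply/val_inj/eqP.
by case: (ltngtP (val i) (val j)) => // /(cheb_node_lt k1); rewrite ij ltxx.
Qed.

(** At the nodes the transported Chebyshev polynomial [q] takes the values [1] and [-1] in
    alternation, as do the signs of the weights. The sum of their absolute values is therefore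
    [q.[0]] up to sign, an explicit value outside the interval of oscillation. *)
Lemma sum_lagrange0_cheb k d : 1 < k ->
  \sum_(i < d.+1) `|lagrange0 (@cheb_node k d) i| <= ((k + 1) / (k - 1)) ^+ d.
Proof.
move=> k1; have k2 : 0 < k ^+ 2 - 1 by nra.
(* Chosen so that [(z + z^-1) / 2] is the image [- (k ^ 2 + 1) / (k ^ 2 - 1)] of the origin under
   the affine map [a]. *)
pose z : R := - ((k + 1) / (k - 1)).
have z0 : z != 0 by rewrite oppr_eq0 mulf_neq0 ?invr_eq0//; lra.
pose a : {poly R} := (k ^+ 2 - 1)^-1 *: (2 *: 'X - (k ^+ 2 + 1)%:P).
pose q := chebyshev d \Po a.
have sa : (size a <= 2)%N.
  apply: leq_trans (size_scale_leq _ _) _; apply: leq_trans (size_polyD _ _) _.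
  rewrite geq_max size_polyN (leq_trans (size_scale_leq _ _)) ?size_polyX//=.
  by rewrite (leq_trans (size_polyC_leq1 _)).
have sq : (size q <= d.+1)%N.
  apply: leq_trans (size_comp_poly_leq _ _) _; rewrite ltnS.
  have := size_chebyshev d; case: (size (chebyshev d)) => [|n]; rewrite ?mul0n//.
  rewrite ltnS => nd; apply: (@leq_trans (n * 1)); last by rewrite muln1.
  by rewrite leq_mul2l; case: (size a) sa => [|[|[|]]]; rewrite ?orbT.
have qs (i : 'I_d.+1) : q.[cheb_node k i] = (-1) ^+ i.
  have aE : a.[cheb_node k i] = cos (cheb_angle i).
    rewrite /a !(hornerD, hornerN, hornerZ, hornerM, hornerX, hornerC) /cheb_node.
    by field; rewrite gt_eqF.
  rewrite horner_comp aE.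
  rewrite chebyshev_cos /cheb_angle; have [d0|d0] := posnP d.
    have i0 : nat_of_ord i = 0%N by apply/eqP; rewrite -leqn0 (leq_trans (leq_ord i))// d0.
    by rewrite i0 d0 mul0r cos0.
  rewrite mulrCA (_ : d%:R * (pi / d%:R) = pi); last first.
    by field; rewrite pnatr_eq0 -lt0n.
  elim: (nat_of_ord i) => [|n IH]; first by rewrite mul0r cos0.
  by rewrite -natr1 mulrDl mul1r cosDpi IH exprS mulN1r.
have q0 : q.[0] = (z ^+ d + z ^- d) / 2.
  rewrite horner_comp !(hornerD, hornerN, hornerZ, hornerM, hornerX, hornerC) -chebyshev_joukowski//; congr (_.[_]).
  have km : k - 1 != 0 by rewrite gt_eqF// subr_gt0.
  have kp : k + 1 != 0 by rewrite gt_eqF//; lra.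
  have k2' : k ^+ 2 - 1 != 0 by rewrite gt_eqF.
  by rewrite /z; field; rewrite ?km ?kp ?k2'.
have -> : \sum_(i < d.+1) `|lagrange0 (@cheb_node k d) i| = (-1) ^+ d * q.[0].
  rewrite -(lagrange0_sum (@cheb_node_inj k d k1) sq) mulr_sumr.
  apply: eq_bigr => i _; rewrite qs lagrange0_sign; first by rewrite [_ ^+ i * _]mulrC.
    by move=> j; have /andP[] := cheb_node_itv j (ltW k1); move=> h _; exact: lt_le_trans h.
  by move=> j l; exact: cheb_node_lt.
apply: le_trans (ler_norm _) _; rewrite normrM normrX normrN1 expr1n mul1r q0.
rewrite normrM [X in _ * X]ger0_norm ?invr_ge0// ler_pdivrMr//.
apply: le_trans (ler_normD _ _) _; rewrite normfV normrX normrN.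
have w1 : 1 <= (k + 1) / (k - 1) by rewrite ler_pdivlMr; lra.
rewrite ger0_norm; last by lra.
set w := (_ / _) in w1 *; have wd : 1 <= w ^+ d by rewrite exprn_ege1.
have : (w ^+ d)^-1 <= 1 by rewrite invf_le1//; lra.
by lra.
Qed.
(* Lagrange interpolation at the origin for the nodes [+- sqrt s], where [s] runs
   over the Chebyshev nodes of [1, k^2]; the total mass of the weights is then,
   up to sign, the value at the origin of a Chebyshev polynomial. *)
Lemma quadrature k d : 1 < k ->
  exists lam nu : 'I_d.+1 * bool -> R,
  [/\ injective lam,
      forall j, (- k <= lam j <= -1) \/ (1 <= lam j <= k),
      forall j, nu j != 0,
      forall q : {poly R}, (size q <= 2 * d.+1)%N -> \sum_j nu j * q.[lam j] = q.[0] &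
      \sum_j `|nu j| <= ((k + 1) / (k - 1)) ^+ d].
Proof.
move=> k1; pose s := @cheb_node k d.
have s1 i : 1 <= s i <= k ^+ 2 by apply: cheb_node_itv; exact: ltW.
have s0 i : 0 < s i by have /andP[h _] := s1 i; exact: lt_le_trans h.
have sinj := @cheb_node_inj k d k1.
pose r i := Num.sqrt (s i).
have r2 i : r i ^+ 2 = s i by rewrite sqr_sqrtr// ltW.
have r1 i : 1 <= r i <= k.
  have := s1 i; rewrite -r2; have : 0 <= r i by exact: sqrtr_ge0.
  by move=> ri /andP[h1 h2]; apply/andP; split; nra.
pose lam (j : 'I_d.+1 * bool) := if j.2 then - r j.1 else r j.1.
pose nu (j : 'I_d.+1 * bool) := lagrange0 s j.1 / 2.
have sumE (F : 'I_d.+1 * bool -> R) : \sum_j F j = \sum_i (F (i, true) + F (i, false)).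
  rewrite (eq_bigr (fun j => F (j.1, j.2))); last by case.
  rewrite -(pair_bigA _ (fun i b => F (i, b)))/=.
  by apply: eq_bigr => i _; rewrite big_bool.
exists lam, nu; split.
- move=> [i b] [j c]; rewrite /lam/= => E.
  have ij : i = j.
    apply: sinj; rewrite -[LHS]r2 -[RHS]r2; move/(congr1 (fun x => x ^+ 2)): E.
    by case: b c => -[]; rewrite /= ?sqrrN.
  rewrite ij in E *; congr pair; have := r1 j; move: E.
  by case: b c => -[] //; lra.
- move=> [i b]; rewrite /lam/=; have := r1 i; case: b; first by left; lra.
  by right.
- move=> [i b]; rewrite /nu/= mulf_neq0 ?invr_eq0//.
  by apply: lagrange0_neq0.
(* Opposite nodes carry the same weight, so the odd part of [q] cancels; its even part is a
   polynomial in the square, of half the size, interpolated at the [s i]. *)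
- move=> q sq; rewrite sumE.
  have sE : (size (even_poly q) <= d.+1)%N.
    apply: leq_trans (size_even_poly _) _.
    by rewrite leq_uphalf_double -mul2n.
  have -> : q.[0] = (even_poly q).[0].
    by rewrite -{1}(poly_even_odd q) !(hornerD, hornerM, hornerX, hornerXn, horner_comp) !mulr0 addr0.
  rewrite -(lagrange0_sum sinj sE); apply: eq_bigr => i _.
  have h x : q.[x] = (even_poly q).[x ^+ 2] + (odd_poly q).[x ^+ 2] * x.
    by rewrite -{1}(poly_even_odd q) !hornerE !horner_comp !(hornerD, hornerN, hornerZ, hornerM, hornerX, hornerC).
  by rewrite /nu /lam/= !h sqrrN r2; field.
- rewrite (sumE (fun j => `|nu j|)); apply: le_trans (sum_lagrange0_cheb d k1).
  apply: ler_sum => i _; rewrite /nu/= normrM [X in _ * X]ger0_norm ?invr_ge0//.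
  by rewrite -/s; lra.
Qed.
End lagrange.

(** * The unexplored part of the eigenspaces *)

Lemma dot_suml (R : realType) n (I : finType) (v : I -> 'cV[R]_n) (w : 'cV[R]_n) :
  dot (\sum_i v i) w = \sum_i dot (v i) w.
Proof.
rewrite /dot exchange_big/=; apply: eq_bigr => l _.
by rewrite summxE mulr_suml.
Qed.

Lemma dot_cauchy (R : realType) n (v w : 'cV[R]_n) :
  dot v w ^+ 2 <= dot v v * dot w w.
Proof.
have := dot_ge0 (dot w w *: v - dot v w *: w).
rewrite !(dotDl, dotDr, dotNl, dotNr, dotZl, dotZr) (dotC w v).
have := dot_ge0 w; rewrite le_eqVlt => /orP[|w0].
  rewrite eq_sym => /eqP w0 _; move/eqP: (w0); rewrite dot_eq0 => /eqP ->.
  by rewrite dotC -(scale0r v) dotZl !mul0r expr0n dotZl mul0r mulr0.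
move=> h; rewrite -subr_ge0 -(pmulr_rge0 _ w0); apply: le_trans h _.
by rewrite le_eqVlt; apply/orP; left; apply/eqP; ring.
Qed.

Lemma tailZ (R : realType) n k (a : R) (v : 'cV[R]_n) : tail k (a *: v) = a *: tail k v.
Proof. by apply/colP => i; rewrite !mxE; case: leqP => // _; rewrite mulr0. Qed.

Lemma tailD (R : realType) n k (v w : 'cV[R]_n) : tail k (v + w) = tail k v + tail k w.
Proof. by apply/colP => i; rewrite !mxE; case: leqP => // _; rewrite addr0. Qed.

Lemma tail_tailS (R : realType) n k (v : 'cV[R]_n) : tail k.+1 (tail k v) = tail k.+1 v.
Proof. by apply/colP => i; rewrite !mxE; case: leqP => // /ltnW ->. Qed.

Lemma tailK_tailS (R : realType) n k (v : 'cV[R]_n) : tail k (tail k.+1 v) = tail k.+1 v.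
Proof.
apply/colP => i; rewrite !mxE; case: (leqP k.+1 i) => [/ltnW ->//|_].
by case: leqP.
Qed.

Lemma tail_headed (R : realType) n k (v : 'cV[R]_n) : headed k v -> tail k v = 0.
Proof. by move=> hv; apply/colP => i; rewrite !mxE; case: leqP => // /hv. Qed.

Lemma headed_tail0 (R : realType) n k (v : 'cV[R]_n) : tail k v = 0 -> headed k v.
Proof. by move=> tv i ki; have /colP/(_ i) := tv; rewrite !mxE ki. Qed.

Lemma tail_orthogonal (R : realType) n k (v w : 'cV[R]_n) :
  dot (tail k v) w = dot (tail k v) (tail k w).
Proof.
apply: eq_bigr => i _; rewrite !mxE; case: leqP => //; by rewrite !mul0r.
Qed.

Section frames.
Context {R : realType} {n : nat} {J : finType}.
Variables (D : 'M[R]_n) (lam : J -> R) (e : J -> 'cV[R]_n) (nu : J -> R).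
Hypothesis D_sym : D^T = D.
Hypothesis lam_inj : injective lam.
Hypothesis nu_neq0 : forall j, nu j != 0.
Let mass : R := \sum_j `|nu j|.
Let wt j : R := `|nu j| / mass.
Let sw j : R := Num.sqrt (wt j).

(** The weights [wt] are those of sum 1 that minimise [\sum_j nu j ^+ 2 / wt j], the squared norm of
    the test vector of [residual_bound] when every [tau] is 1; the minimum is [mass ^+ 2]. *)
Definition beta : 'cV[R]_n := \sum_j sw j *: e j.
(* [F j] is an orthogonal frame whose vectors of index at least [K] lie in the
   eigenspace of [lam j]; they span the subspace orthogonal to what the
   algorithm has seen of that eigenspace. *)
Definition frame (K : nat) (F : J -> 'M[R]_n) := forall j,
  [/\ orthogonal_mx (F j),
      forall v, D *m (F j *m tail K v) = lam j *: (F j *m tail K v) &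
      tail K ((F j)^T *m beta) = sw j *: tail K ((F j)^T *m e j)].
(* Up to explored directions, [y] is [p(D) beta] for a polynomial [p] of degree
   less than [s]. *)
Definition good (F : J -> 'M[R]_n) (K s : nat) (y : 'cV[R]_n) :=
  exists2 p : {poly R}, (size p <= s)%N &
  forall j, tail K ((F j)^T *m y) = (sw j * p.[lam j]) *: tail K ((F j)^T *m e j).

Lemma goodD F K s y z : good F K s y -> good F K s z -> good F K s (y + z).
Proof.
move=> [p sp py] [q sq qz]; exists (p + q).
  by apply: leq_trans (size_polyD _ _) _; rewrite geq_max sp.
by move=> j; rewrite mulmxDr tailD py qz hornerD mulrDr scalerDl.
Qed.

Lemma goodZ F K s a y : good F K s y -> good F K s (a *: y).
Proof.
move=> [p sp py]; exists (a *: p); first exact: leq_trans (size_scale_leq _ _) sp.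
by move=> j; rewrite -scalemxAr tailZ py hornerZ scalerA mulrCA.
Qed.

Lemma goodB F K s y z : good F K s y -> good F K s z -> good F K s (y - z).
Proof. by move=> gy gz; rewrite -scaleN1r; apply: goodD => //; exact: goodZ. Qed.

Lemma good_le F K s s' y : (s <= s')%N -> good F K s y -> good F K s' y.
Proof. by move=> ss [p sp py]; exists p => //; exact: leq_trans ss. Qed.

Lemma good_beta F K : frame K F -> good F K 1 beta.
Proof.
move=> fF; exists 1; first by rewrite size_poly1.
by move=> j; have [_ _ ->] := fF j; rewrite hornerE mulr1.
Qed.

(** As [D] is symmetric, it commutes with the projection onto a space of eigenvectors. *)
Lemma frame_eigen F K j y : frame K F ->
  tail K ((F j)^T *m (D *m y)) = lam j *: tail K ((F j)^T *m y).
Proof.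
move=> fF; have [oF DF _] := fF j; apply/colP => i; rewrite [RHS]mxE !tailP.
case: leqP => [Ki|]; last by rewrite mulr0.
have tb : tail K (basis n i) = basis n i :> 'cV[R]_n.
  by apply/colP => l; rewrite !mxE; case: leqP => // lK; rewrite ltn_eqF// (leq_trans lK).
rewrite !orthogonal_entries trmxK -(dotC (D *m y)) dot_mull D_sym -tb DF tb.
by rewrite dotZr dotC.
Qed.

Lemma good_mulD F K s y : frame K F -> good F K s y -> good F K s.+1 (D *m y).
Proof.
move=> fF [p sp py]; exists ('X * p).
  have [->|p0] := eqVneq p 0; first by rewrite mulr0 size_poly0.
  by rewrite mulrC size_mulX.
move=> j; rewrite frame_eigen// py scalerA hornerM hornerX; congr (_ *: _); ring.
Qed.

(** The reflection gathers the unexplored part of [G] in the frame vector of index [K], which is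
    discarded when [K] becomes [K.+1]. Each frame loses one vector, so a single index [K] serves all
    eigenspaces. *)
Definition update (K : nat) (F : J -> 'M[R]_n) (G : 'cV[R]_n) (j : J) : 'M[R]_n :=
  F j *m householder K ((F j)^T *m G).

Lemma update_tail K F G j y : (K < n)%N ->
  tail K.+1 ((update K F G j)^T *m y) =
  tail K.+1 (householder K ((F j)^T *m G) *m tail K ((F j)^T *m y)).
Proof.
move=> Kn; rewrite trmx_mul householder_tr -mulmxA.
by rewrite (stab_tail _ (householder_stab _ Kn)) tail_tailS.
Qed.

Lemma frame_update K F G : (K < n)%N -> frame K F -> frame K.+1 (update K F G).
Proof.
move=> Kn fF j; have [oF DF bF] := fF j.
have sH := householder_stab ((F j)^T *m G) Kn; split.
- by apply: orthogonalM => //; exact: (proj1 sH).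
- by move=> v; rewrite /update -!mulmxA -tailK_tailS (stab_tail _ sH) DF.
- by rewrite !update_tail// bF -scalemxAr tailZ.
Qed.

Lemma good_update K F G s y : (K < n)%N -> good F K s y -> good (update K F G) K.+1 s y.
Proof.
move=> Kn [p sp py]; exists p => // j.
by rewrite !update_tail// py -scalemxAr tailZ.
Qed.

(** After the update [G] has no unexplored component left, so the zero polynomial represents it. *)
Lemma good_update_new K F G s : (K < n)%N -> good (update K F G) K.+1 s G.
Proof.
move=> Kn; exists 0; first by rewrite size_poly0.
move=> j; rewrite horner0 mulr0 scale0r trmx_mul householder_tr -mulmxA.
by apply: tail_headed; exact: householder_headed.
Qed.

Definition tau (F : J -> 'M[R]_n) (K : nat) (j : J) : R :=
  dot (tail K ((F j)^T *m e j)) (tail K ((F j)^T *m e j)).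

(** Up to the factor [mass ^+ 2], the squared norm of the test vector of [residual_bound]; it grows
    as the projections of the [e j] shrink. *)
Definition potential (F : J -> 'M[R]_n) (K : nat) : R := \sum_j wt j / tau F K j.

(** By Pythagoras: dropping the coordinate [K] after the reflection removes from the tail of [e j]
    its component along the tail of [G], and the bracket is one minus the squared cosine. *)
Lemma tau_update K F G j : (K < n)%N -> tail K ((F j)^T *m G) != 0 ->
  tau F K j != 0 ->
  tau (update K F G) K.+1 j = tau F K j *
    (1 - dot (tail K ((F j)^T *m e j)) ((F j)^T *m G) ^+ 2 /
      (tau F K j * dot (tail K ((F j)^T *m G)) (tail K ((F j)^T *m G)))).
Proof.
move=> Kn; rewrite /tau update_tail//.
set a := _ *m e j; set g := _ *m G; move=> g0 a0.
set H := householder K g; have sH : stab K H := householder_stab g Kn.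
have E : dot (H *m tail K a) (H *m tail K a) = dot (tail K a) (tail K a).
  exact: (dot_orthogonal _ _ (proj1 sH)).
have : H *m tail K a = (dot (basis n K) (H *m tail K a)) *: basis n K +
    tail K.+1 (H *m tail K a).
  by rewrite -{1}(tail_tail K a) (stab_tail _ sH) (tail_sum Kn) dot_basis.
set c := dot (basis n K) _; set t := tail K.+1 _ => HE.
have bt : dot (basis n K) t = 0 by apply: dot_headed_tail; exact: headed_basis.
have : dot (tail K a) (tail K a) = c ^+ 2 + dot t t.
  rewrite -E {1 2}HE !(dotDl, dotDr, dotZl, dotZr) (dotC t) bt (dot_basis Kn (basis n K)).
  by rewrite mxE eqxx/=; ring.
have cE : c = (Num.sqrt (dot (tail K g) (tail K g)))^-1 * dot (tail K a) g.
  rewrite /c dotC dot_mull householder_tr householder_basis// dotZr.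
  by rewrite (tail_orthogonal K a g).
have gg : 0 < dot (tail K g) (tail K g) by rewrite lt_neqAle dot_ge0 eq_sym dot_eq0 g0.
have c2 : c ^+ 2 = dot (tail K a) g ^+ 2 / dot (tail K g) (tail K g).
  by rewrite cE exprMn exprVn sqr_sqrtr ?ltW// mulrC.
rewrite c2; move: (dot t t) (dot (tail K a) g) a0 gg.
move: (dot (tail K a) (tail K a)) (dot (tail K g) (tail K g)) => x y z u x0 y0 xE.
have y0' : y != 0 by rewrite gt_eqF.
have -> : z = x - u ^+ 2 / y by rewrite xE; ring.
by field; rewrite ?x0 ?y0'.
Qed.
Hypothesis quadr : forall q : {poly R}, (size q <= #|J|)%N ->
  \sum_j nu j * q.[lam j] = q.[0].

Lemma frame_orthogonal F K i j v w : frame K F -> i != j ->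
  dot (F i *m tail K v) (F j *m tail K w) = 0.
Proof.
move=> fF ij; have [_ Di _] := fF i; have [_ Dj _] := fF j.
have : dot (D *m (F i *m tail K v)) (F j *m tail K w) =
       dot (F i *m tail K v) (D *m (F j *m tail K w)) by rewrite dot_mull D_sym.
rewrite Di Dj dotZl dotZr => /eqP; rewrite -subr_eq0 -mulrBl mulf_eq0.
by rewrite subr_eq0 (inj_eq lam_inj) (negbTE ij) => /eqP.
Qed.

Lemma wt_gt0 j : 0 < wt j.
Proof.
have h : 0 < `|nu j| by rewrite normr_gt0.
rewrite divr_gt0//; apply: (lt_le_trans h); rewrite /mass (bigD1 j)//= lerDl.
by apply: sumr_ge0.
Qed.
(* The vector of the quadrature weights, projected on the unexplored parts of
   the eigenspaces, is orthogonal to [D *m y] and has inner product 1 with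
   [beta]. *)
Lemma residual_bound F K s y : frame K F -> (forall j, 0 < tau F K j) ->
  (s < #|J|)%N -> good F K s y ->
  1 <= mass ^+ 2 * potential F K * dot (D *m y - beta) (D *m y - beta).
Proof.
move=> fF tau0 sJ [p sp py].
pose a j := tail K ((F j)^T *m e j).
pose v := \sum_j (nu j / (sw j * tau F K j)) *: (F j *m a j).
have sw0 j : sw j != 0 by rewrite gt_eqF// sqrtr_gt0 wt_gt0.
have tn j : tau F K j != 0 by rewrite gt_eqF.
(* On the unexplored part of index [j], the residual is [sw j * q.[lam j]] times the projection of
   [e j]; the size of [q] is at most [s.+1], within the exactness range of the quadrature. *)
pose q := 'X * p - 1.
have sq : (size q <= #|J|)%N.
  have sXp : (size ('X * p)%R <= s.+1)%N.
    have [->|p0] := eqVneq p 0; first by rewrite mulr0 size_poly0.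
    by rewrite mulrC size_mulX.
  apply: leq_trans (size_polyD _ _) _; rewrite size_polyN size_poly1 geq_max.
  by rewrite (leq_trans sXp sJ) (leq_trans _ sJ).
have q0 : q.[0] = -1 by rewrite hornerD hornerN hornerM hornerX mul0r hornerC sub0r.
have v1 : dot v (D *m y - beta) = -1.
  rewrite dot_suml -q0 -quadr//; apply: eq_bigr => j _.
  rewrite dotZl dot_mull /a tail_orthogonal mulmxBr tailD.
  have [_ _ bF] := fF j.
  rewrite -[- _]scaleN1r tailZ bF frame_eigen// py !scalerA -scalerDl dotZr -/(tau F K j).
  rewrite /q hornerD hornerN hornerM hornerX hornerC.
  by field; rewrite sw0 tn.
have vv : dot v v = mass ^+ 2 * potential F K.
  rewrite dot_suml /potential mulr_sumr; apply: eq_bigr => j _.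
  rewrite dotZl dotC dot_suml (bigD1 j)//= big1 ?addr0; last first.
    by move=> i ij; rewrite dotZl frame_orthogonal// ?mulr0.
  rewrite dotZl dot_orthogonal; last by have [] := fF j.
  rewrite -/(tau F K j).
  have sq2 : sw j ^+ 2 = wt j by rewrite sqr_sqrtr// ltW// wt_gt0.
  have m0 : mass != 0.
    by have := wt_gt0 j; rewrite /wt; case: eqVneq => // ->; rewrite invr0 mulr0 ltxx.
  have nn : nu j ^+ 2 = (wt j * mass) ^+ 2.
    by rewrite /wt divfK// real_normK// num_real.
  have w0 : wt j != 0 by rewrite gt_eqF ?wt_gt0.
  rewrite (_ : _ * _ = nu j ^+ 2 / (sw j ^+ 2 * tau F K j)); last by field; rewrite sw0 tn.
  by rewrite nn sq2; field; rewrite tn w0.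
have := dot_cauchy v (D *m y - beta).
by rewrite v1 vv sqrrN expr1n.
Qed.
End frames.

(** * The loss caused by one random direction *)

Section gauss_mull.
Context {R : realType} {n : nat}.
Implicit Types Z : 'M[R]_n.

Lemma gmean_mull Z (f : 'cV[R]_n -> R) : orthogonal_mx Z -> unit_fun f ->
  gmean (fun g => f (Z *m g)) = gmean f.
Proof.
move=> oZ [mf f01]; congr fine.
apply: (gauss_orthogonal oZ (f := fun g => (f g)%:E)); first exact/measurable_EFinP.
by move=> g; rewrite lee_fin; case/andP: (f01 g).
Qed.

Lemma unit_mull Z (f : 'cV[R]_n -> R) : unit_fun f -> unit_fun (fun g => f (Z *m g)).
Proof.
move=> [mf f01]; split; last by move=> g; exact: f01.
exact: (measurableT_comp mf (measurable_mulmxl Z)).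
Qed.

Lemma gauss_ae_tail_mull k Z : (k < n)%N -> orthogonal_mx Z ->
  {ae gauss n, forall g, tail k (Z *m g) != 0}.
Proof.
move=> kn oZ; pose N := [set v : 'cV[R]_n | v (Ordinal kn) ord0 = 0].
have mN : measurable N by exact: measurable_coord0.
have mZN : measurable ((fun v => Z *m v) @^-1` N).
  by rewrite -[X in measurable X]setTI; exact: (measurable_mulmxl Z measurableT mN).
exists ((fun v => Z *m v) @^-1` N); split => //; last first.
  move=> v /= /negP; rewrite negbK => /eqP/colP/(_ (Ordinal kn)).
  by rewrite tailP/= leqnn => h; apply: (etrans h); rewrite mxE.
have m1 (A : set 'cV[R]_n) : measurable A -> (\int[gauss n]_v (\1_A v : R)%:E = gauss n A)%E.
  by move=> mA; rewrite integral_indic// setIT.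
rewrite -m1//; have m1N : measurable_fun setT (fun v : 'cV[R]_n => (\1_N v : R)%:E).
  by apply/measurable_EFinP; exact: measurable_indic.
have i0 (v : 'cV[R]_n) : (0 <= (\1_N v : R)%:E)%E by rewrite lee_fin.
have := gauss_orthogonal oZ m1N i0; rewrite m1// => E.
by rewrite -[RHS](gauss_coord0 (Ordinal kn)) -[RHS]E.
Qed.
End gauss_mull.

Section half_steps.
Context {R : realType} {n : nat} {J : finType}.
Variables (D : 'M[R]_n) (lam : J -> R) (e : J -> 'cV[R]_n) (nu : J -> R).
Hypothesis nu_neq0 : forall j, nu j != 0.
Local Notation frame := (frame D lam e nu).
Local Notation good := (good lam e nu).
Local Notation tau := (tau e).
Local Notation potential := (potential e nu).

Lemma potential_ge0 F K : (forall j, 0 < tau F K j) -> 0 <= potential F K.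
Proof.
move=> t0; apply: sumr_ge0 => j _; apply: divr_ge0; last exact: ltW.
by apply: divr_ge0 => //; apply: sumr_ge0.
Qed.

Lemma headed_split k (v : 'cV[R]_n) (kn : (k < n)%N) : headed k.+1 v ->
  v = (v - tail k v) + v (Ordinal kn) ord0 *: basis n k.
Proof.
move=> hv; rewrite (tail_sum kn) (tail_headed hv) addr0.
by rewrite subrK.
Qed.

(** The one new image is [Q] applied to the normalized tail of [x], a combination of [Q *m x] and of
    [Q] applied to the head of [x]. *)
Lemma good_extend F K s k (Q : 'M[R]_n) (x : 'cV[R]_n) : (k < n)%N ->
  (forall v, headed k v -> good F K s (Q *m v)) -> tail k x != 0 ->
  good F K s (Q *m x) ->
  forall v, headed k.+1 v -> good F K s (Q *m householder k x *m v).
Proof.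
move=> kn gQ x0 gx v hv; rewrite (headed_split kn hv) mulmxDr -!mulmxA.
apply: goodD.
  rewrite (proj2 (householder_stab x kn)); last exact: headed_subr_tail.
  exact/gQ/headed_subr_tail.
rewrite -scalemxAr householder_basis// -2!scalemxAr; do 2 apply: goodZ.
rewrite -[tail k x](subKr x) mulmxBr; apply: goodB => //.
by apply: gQ; exact: headed_subr_tail.
Qed.
Local Open Scope ereal_scope.

Lemma haar_le1 d (f : 'M[R]_n -> R) : (d <= n)%N -> measurable_fun setT f ->
  (forall U, (0 <= f U <= 1)%R) -> haar d (fun M => (f M)%:E) <= 1.
Proof.
move=> dn mf f01; rewrite -[leRHS](@haar_cst R n d 1).
apply: haar_le => //.
- exact/measurable_EFinP.
- by move=> M; rewrite lee_fin; case/andP: (f01 M).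
- by move=> M _; rewrite lee_fin; case/andP: (f01 M).
Qed.

Lemma measurable_conj (P Q : 'M[R]_n) (f : 'M[R]_n -> R) : measurable_fun setT f ->
  measurable_fun setT (fun M : 'M[R]_n => (f (P *m M *m Q))%:E).
Proof.
move=> mf; apply/measurable_EFinP; apply: (measurableT_comp mf).
apply: measurable_mulmx; last exact: measurable_cst.
by apply: measurable_mulmx; [exact: measurable_cst|exact: measurable_id].
Qed.

(** This treats the half [U^T x] of an answer. The premise on [S1], [S2] and [F1] bounds the rest of
    the game once the direction [Q *m g] is known and removed from all frames; integrating over [g]
    reproduces a bound of the same shape, affine in the potential, which allows iteration. *)
Lemma half_step dd K s F (P Q : 'M[R]_n) (x : 'cV[R]_n) (f : 'M[R]_n -> R) A b (delta : R) :
  (dd < n)%N -> (K < n)%N -> (0 < delta)%R -> (delta <= (n - K)%:R)%R ->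
  orthogonal_mx P -> orthogonal_mx Q ->
  frame K F -> (forall j, (0 < tau F K j)%R) ->
  (forall v, headed (n - dd.+1) v -> good F K s (Q *m v)) ->
  measurable_fun setT f -> (forall U, (0 <= f U <= 1)%R) ->
  (0 <= A)%R -> (0 <= b)%R ->
  (forall S1 S2 F1, stab (n - dd.+1) S1 -> stab (n - dd.+1) S2 ->
     frame K.+1 F1 -> (forall j, (0 < tau F1 K.+1 j)%R) ->
     (forall v, headed (n - dd) v -> good F1 K.+1 s (Q *m S2 *m v)) ->
     headed (n - dd) ((P *m S1)^T *m x) ->
     haar dd (fun M => (f (P *m S1 *m M *m (Q *m S2)^T))%:E) <=
     (A * potential F1 K.+1 + b)%:E) ->
  haar dd.+1 (fun M => (f (P *m M *m Q^T))%:E) <=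
  (A * (1 + 2 / delta) * potential F K + (b + 12 * #|J|%:R / delta ^+ 2))%:E.
Proof.
move=> ddn Kn d0 dK oP oQ fF tau0 gQ mf f01 A0 b0 IH.
have kn := subnSS_lt ddn; have kS : (n - dd = (n - dd.+1).+1)%N by rewrite -subSn// subSS.
rewrite kS in IH; set k := (n - dd.+1)%N in kn kS gQ IH.
have f0 U : 0 <= (f U)%:E by rewrite lee_fin; case/andP: (f01 U).
have f1 U : (f U <= 1)%R by case/andP: (f01 U).
(* Left invariance inserts [S1], which makes [(P *m S1)^T *m x] headed by [k.+1]. The remaining part
   of [M] then fixes this vector, so only the reflection of [g] acts on it. *)
pose S1 := householder k (P^T *m x); have sS1 : stab k S1 by exact: householder_stab.
rewrite -(haar_mull ddn sS1 (measurable_conj P Q^T mf))//.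
have mf1 := measurable_mull S1 (measurable_conj P Q^T mf).
rewrite (haarS_mulr ddn mf1 (fun=> f0 _)) -/k.
pose a j := (F j)^T *m e j; pose Z j := (F j)^T *m Q.
have oZ j : orthogonal_mx (Z j).
  by apply: orthogonalM => //; apply: orthogonal_tr; have [] := fF j.
pose c j g := sqcos K (a j) (Z j *m g).
have uc j : unit_fun (c j) by apply: (@unit_mull _ _ (Z j) (sqcos K (a j))); exact: unit_sqcos.
have uc2 j : unit_fun (fun g => c j g ^+ 2)%R.
  by have := unit_funM (uc j) (uc j); under eq_fun do rewrite -expr2.
pose w j := ((`|nu j| / \sum_j `|nu j|) / tau F K j)%R.
have w0 j : (0 <= w j)%R.
  apply: divr_ge0; last exact: ltW.
  by apply: divr_ge0 => //; apply: sumr_ge0.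
(* The left summands pay for the event that some eigenspace loses more than half, the right ones for
   the growth of the potential otherwise; a single index type lets [integral_sum] integrate them at
   once. *)
pose co (i : J + J) : R := match i with inl _ => 4 | inr j => 2 * A * w j end%R.
pose fu (i : J + J) : 'cV[R]_n -> R := match i with inl j => fun g => c j g ^+ 2 | inr j => c j end%R.
have co0 i : (0 <= co i)%R by case: i => j //=; apply: mulr_ge0 => //; apply: mulr_ge0.
have ufu i : xpredT i -> unit_fun (fu i) by case: i => j _; [exact: uc2|exact: uc].
pose h g := (\sum_i co i * fu i g)%R.
have mh : measurable_fun setT h.
  apply: measurable_sum => i; apply: measurable_funM; first exact: measurable_cst.
  by have [] := ufu i isT.
have h0 g : (0 <= h g)%R.
  apply: sumr_ge0 => i _; rewrite mulr_ge0//.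
  by have [_ /(_ g)/andP[]] := ufu i isT.
have hE g : h g = (\sum_j (4 * c j g ^+ 2 + 2 * A * w j * c j g))%R.
  by rewrite /h big_sumType big_split.
have ht j g : (0 <= 4 * c j g ^+ 2)%R /\ (0 <= 2 * A * w j * c j g)%R.
  have [_ /(_ g)/andP[ci _]] := uc j.
  by split; apply: mulr_ge0 => //; [exact: exprn_ge0|exact: (co0 (inr j))].
have potE : potential F K = (\sum_j w j)%R by [].
have pot0 : (0 <= A * potential F K + b)%R.
  by rewrite addr_ge0// mulr_ge0// potential_ge0.
have tn j : tail K (a j) != 0%R by rewrite -dot_eq0 gt_eqF// tau0.
pose phi g := haar dd (fun M => (f (P *m (S1 *m (M *m householder k g)) *m Q^T))%:E).
have mphi : measurable_fun setT phi.
  apply: (measurable_haar dd (F := fun w : 'cV[R]_n * 'M[R]_n =>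
    (f (P *m (S1 *m (w.2 *m householder k w.1)) *m Q^T))%:E)).
    apply/measurable_EFinP; apply: (measurableT_comp mf).
    apply: measurable_mulmx; last exact: measurable_cst.
    apply: measurable_mulmx; first exact: measurable_cst.
    apply: measurable_mulmx; first exact: measurable_cst.
    apply: measurable_mulmx; first exact: measurable_snd.
    exact: (measurableT_comp (measurable_householder k) measurable_fst).
  by move=> v; exact: f0.
apply: (@le_trans _ _ (\int[gauss n]_g ((h g)%:E + (A * potential F K + b)%:E))).
  apply: ae_ge0_le_integral => //.
  - by move=> g _; apply: haar_ge0 => M; exact: f0.
  - by move=> g _; rewrite -EFinD lee_fin addr_ge0.
  - by apply: emeasurable_funD; [exact/measurable_EFinP|exact: measurable_cst].
  have aeZ : {ae gauss n, forall g j, tail K (Z j *m g) != 0%R}.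
    by apply: filter_forall => j; exact: gauss_ae_tail_mull.
  have aek := @gauss_ae_tail R n k kn.
  apply: filterS2 aek aeZ => g kg Zg _.
  (* If some [c j g] exceeds 1/2, the trivial bound 1 is below [4 * c j g ^+ 2]. Otherwise [tau]
     shrinks by the factor [1 - c j g], whose inverse is at most [1 + 2 * c j g]. *)
  have [/forallP c12|] := boolP [forall j, c j g <= 2^-1]%R; last first.
    rewrite negb_forall => /existsP[j]; rewrite -ltNge => cj.
    apply: (@le_trans _ _ 1).
      apply: haar_le1; first exact: ltnW.
        apply: (measurableT_comp mf); apply: measurable_mulmx; last exact: measurable_cst.
        apply: measurable_mulmx; first exact: measurable_cst.
        apply: measurable_mulmx; first exact: measurable_cst.
        apply: measurable_mulmx; [exact: measurable_id|exact: measurable_cst].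
      by move=> U; exact: f01.
    rewrite -EFinD lee_fin; apply: ler_wpDr => //.
    rewrite hE (bigD1 j)//=; apply: ler_wpDr.
      by apply: sumr_ge0 => i _; have [? ?] := ht i g; rewrite addr_ge0.
    by apply: ler_wpDr; [have [] := ht j g|nra].
  pose F1 := update K F (Q *m g).
  have tZ j : tail K ((F j)^T *m (Q *m g)) != 0%R by rewrite mulmxA; exact: Zg.
  have tauE j : (tau F1 K.+1 j = tau F K j * (1 - c j g))%R.
    by rewrite /F1 tau_update ?gt_eqF// /c /sqcos /Z mulmxA.
  have tau10 j : (0 < tau F1 K.+1 j)%R.
    by rewrite tauE mulr_gt0// subr_gt0 (le_lt_trans (c12 j))// invf_lt1 ?ltr1n.
  have := IH S1 (householder k g) F1 sS1 (householder_stab g kn) (frame_update _ Kn fF) tau10.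
  have gH v : headed k.+1 v -> good F1 K.+1 s (Q *m householder k g *m v).
    apply: good_extend => //.
      by move=> u hu; apply: good_update => //; exact: gQ.
    exact: good_update_new.
  have hx : headed k.+1 ((P *m S1)^T *m x).
    by rewrite trmx_mul householder_tr -mulmxA; exact: householder_headed.
  move=> /(_ gH hx); rewrite /phi => hb.
  apply: (@le_trans _ _ (A * potential F1 K.+1 + b)%:E).
    rewrite [leLHS](_ : _ = haar dd (fun M => (f (P *m S1 *m M *m (Q *m householder k g)^T))%:E))//.
    apply: haar_eq; first exact: ltnW.
    by move=> M _; congr (f _)%:E; rewrite trmx_mul householder_tr !mulmxA.
  have e1 : (A * potential F K = \sum_j A * w j)%R by rewrite potE mulr_sumr.
  have e2 : (A * potential F1 K.+1 =
      \sum_j A * ((`|nu j| / \sum_i `|nu i|) / tau F1 K.+1 j))%R by rewrite -mulr_sumr.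
  rewrite -EFinD lee_fin addrA lerD2r hE e1 e2 -big_split/=.
  apply: ler_sum => j _; rewrite tauE.
  rewrite (_ : A * _ = A * w j * (1 - c j g)^-1)%R; last by rewrite invfM /w !mulrA.
  have [_ /(_ g)/andP[cj0 cj1]] := uc j; have := c12 j => c2.
  have inv1 : ((1 - c j g)^-1 <= 1 + 2 * c j g)%R.
    rewrite -[leLHS]mul1r ler_pdivrMr; last by lra.
    by nra.
  apply: le_trans (ler_wpM2l (mulr_ge0 A0 (w0 j)) inv1) _.
  have : (0 <= 4 * c j g ^+ 2)%R by have [] := ht j g.
  by set X := (_ ^+ 2)%R => p1; lra.
have mhE : measurable_fun setT (fun g => (h g)%:E) by exact/measurable_EFinP.
rewrite ge0_integralD//; last by move=> g _; rewrite lee_fin.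
rewrite integral_gauss_cst integral_sum// -EFinD lee_fin.
rewrite big_sumType/=.
have dinv : (((n - K)%:R)^-1 <= delta^-1 :> R)%R.
  by rewrite lef_pV2 ?posrE// (lt_le_trans d0).
have gc1 j : (gmean (c j) <= delta^-1)%R.
  rewrite (gmean_mull (oZ j) (unit_sqcos K (a j))).
  apply: le_trans (gmean_sqcos1 Kn (tn j)) _.
  exact: dinv.
have gc2 j : (gmean (fun g => c j g ^+ 2) <= 3 * delta^-1 ^+ 2)%R.
  have uX : unit_fun (fun g => sqcos K (a j) g ^+ 2)%R.
    by have := unit_funM (unit_sqcos K (a j)) (unit_sqcos K (a j)); under eq_fun do rewrite -expr2.
  rewrite (gmean_mull (oZ j) uX); apply: le_trans (gmean_sqcos2 Kn (tn j)) _.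
  by rewrite ler_wpM2l// ler_pXn2r ?nnegrE ?invr_ge0 ?ler0n// ltW.
have s1 : (\sum_j 4 * gmean (fun g => c j g ^+ 2) <= 12 * #|J|%:R / delta ^+ 2)%R.
  apply: (@le_trans _ _ (\sum_(j : J) 12 / delta ^+ 2)%R).
    by apply: ler_sum => j _; have := gc2 j; rewrite exprVn; lra.
  by rewrite sumr_const -[leLHS]mulr_natr mulrAC.
have s2 : (\sum_j 2 * A * w j * gmean (c j) <= A * (2 / delta) * potential F K)%R.
  rewrite potE mulr_sumr; apply: ler_sum => j _.
  have := ler_wpM2l (mulr_ge0 A0 (w0 j)) (gc1 j).
  set X := (A * w j * _)%R; rewrite (_ : 2 * A * w j * gmean (c j) = 2 * X)%R; last by rewrite /X; ring.
  by set Y := (A * w j / _)%R; rewrite (_ : A * (2 / delta) * w j = 2 * Y)%R; [lra|rewrite /Y; ring].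
by move: s1 s2; set X := (\sum_j 4 * _)%R; set Y := (\sum_j 2 * _ * _ * _)%R; lra.
Qed.
End half_steps.

(** * The game against a random frame *)

Section game.
Context {R : realType} {n : nat}.
Local Notation vec := 'cV[R]_n.
Local Notation entry := (vec * (vec * vec))%type.
Context {dO : measure_display} {Omega : measurableType dO}.
Variables (query : forall t : nat, Omega * t.-tuple entry -> vec).
Variables (resp : vec * vec -> vec * vec) (D : 'M[R]_n) (b : vec) (eps : R).
Hypothesis mquery : forall t, measurable_fun setT (@query t).
Hypothesis mresp : measurable_fun setT resp.

(** The map [resp] covers both oracles: the identity gives the stronger one and, [A] being
    symmetric, [(z.1, z.1)] gives the pair of products by [A] and its transpose. *)
Definition oracle_of (U : 'M[R]_n) (x : vec) : vec * vec :=
  resp (U *m D *m U^T *m x, U^T *m x).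

(** The rest of the game from an arbitrary history, with [r] answers still to come: unlike
    [transcript], it allows induction on the remaining rounds. *)
Fixpoint run (w : Omega) (U : 'M[R]_n) (r t : nat) (h : t.-tuple entry) : vec :=
  let x := query (w, h) in
  if r is r'.+1 then run w U r' [tuple of (x, oracle_of U x) :: h] else x.

Lemma measurable_oracle_of d (Z : measurableType d) (U : Z -> 'M[R]_n) (x : Z -> vec) :
  measurable_fun setT U -> measurable_fun setT x ->
  measurable_fun setT (fun z => oracle_of (U z) (x z)).
Proof.
move=> mU mx; apply: (measurableT_comp mresp); apply: measurable_fun_pair.
  apply: measurable_mulmx => //; apply: measurable_mulmx; last exact: measurable_trmx.
  by apply: measurable_mulmx => //; exact: measurable_cst.
by apply: measurable_mulmx => //; exact: measurable_trmx.
Qed.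

Lemma measurable_run r d (Z : measurableType d) t (w : Z -> Omega) (U : Z -> 'M[R]_n)
    (h : Z -> t.-tuple entry) :
  measurable_fun setT w -> measurable_fun setT U -> measurable_fun setT h ->
  measurable_fun setT (fun z => run (w z) (U z) r (h z)).
Proof.
elim: r t h => [|r IH] t h mw mU mh /=.
  by apply: (measurableT_comp (@mquery t)); exact: measurable_fun_pair.
have mx : measurable_fun setT (fun z => query (w z, h z)).
  by apply: (measurableT_comp (@mquery t)); exact: measurable_fun_pair.
apply: IH => //; apply: measurable_cons => //; apply: measurable_fun_pair => //.
exact: measurable_oracle_of.
Qed.

Lemma measurable_residual r d (Z : measurableType d) t (w : Z -> Omega) (U : Z -> 'M[R]_n)
    (h : Z -> t.-tuple entry) :
  measurable_fun setT w -> measurable_fun setT U -> measurable_fun setT h ->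
  measurable_fun setT (fun z =>
    euclidean_norm (U z *m D *m (U z)^T *m run (w z) (U z) r (h z) - b)).
Proof.
move=> mw mU mh; apply: measurable_euclidean_norm; apply: measurable_submx; last first.
  exact: measurable_cst.
apply: measurable_mulmx; last exact: measurable_run.
apply: measurable_mulmx; last exact: measurable_trmx.
by apply: measurable_mulmx => //; exact: measurable_cst.
Qed.
Variable w : Omega.

Definition winning (r t : nat) (h : t.-tuple entry) : set 'M[R]_n :=
  [set U | (euclidean_norm (U *m D *m U^T *m run w U r h - b) <= eps)%R].

Definition won (r t : nat) (h : t.-tuple entry) (U : 'M[R]_n) : R :=
  \1_(winning r h) U.

Lemma measurable_winning r t (h : t.-tuple entry) : measurable (winning r h).
Proof.
have := @measurable_residual r _ _ t (fun=> w) id (fun=> h)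
  (@measurable_cst _ _ _ _ _ w) (@measurable_id _ _ _) (@measurable_cst _ _ _ _ _ h).
move=> /(_ measurableT `]-oo, eps]%classic (measurable_itv _)); rewrite setTI.
by congr measurable; apply/seteqP; split => U /=; rewrite in_itv.
Qed.

Lemma measurable_won r t (h : t.-tuple entry) : measurable_fun setT (won r h).
Proof. by apply: measurable_indic; exact: measurable_winning. Qed.

Lemma won01 r t (h : t.-tuple entry) U : (0 <= won r h U <= 1)%R.
Proof. by rewrite /won indicE; case: (_ \in _); rewrite !lexx ler01. Qed.

Lemma conj_mulTl k (P Q M : 'M[R]_n) (x : vec) : stab k M -> headed k (P^T *m x) ->
  (P *m M *m Q^T)^T *m x = Q *m (P^T *m x).
Proof.
move=> sM hx; rewrite !trmx_mul trmxK -!mulmxA; congr (_ *m _).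
exact: (proj2 (stab_tr sM)).
Qed.

Lemma conj_mull k (P Q M : 'M[R]_n) (z : vec) : stab k M -> headed k (Q^T *m z) ->
  (P *m M *m Q^T) *m z = P *m (Q^T *m z).
Proof. by move=> sM hz; rewrite -!mulmxA; congr (_ *m _); exact: (proj2 sM). Qed.
(* If both halves of the oracle's answer are determined, the answer is a
   constant of the remaining Haar integration and can be put in the history. *)
Lemma wonS r t (h : t.-tuple entry) k (P Q M : 'M[R]_n) :
  let x := query (w, h) in let y := Q *m (P^T *m x) in
  stab k M -> headed k (P^T *m x) -> headed k (Q^T *m (D *m y)) ->
  won r.+1 h (P *m M *m Q^T) =
  won r [tuple of (x, resp (P *m (Q^T *m (D *m y)), y)) :: h] (P *m M *m Q^T).
Proof.
move=> x y sM hx hz.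
have E : oracle_of (P *m M *m Q^T) x = resp (P *m (Q^T *m (D *m y)), y).
  rewrite /oracle_of (conj_mulTl _ sM hx) -/y; congr (resp (_, _)).
  rewrite -[LHS]mulmxA (conj_mulTl _ sM hx) -/y -mulmxA.
  exact: (conj_mull _ sM hz).
have W : winning r.+1 h (P *m M *m Q^T) =
    winning r [tuple of (x, resp (P *m (Q^T *m (D *m y)), y)) :: h] (P *m M *m Q^T).
  by rewrite /winning/= -/x E.
rewrite /won !indicE; congr (nat_of_bool _)%:R.
by apply/idP/idP => /set_mem ?; apply/mem_set; [rewrite -W|rewrite W].
Qed.
Local Open Scope ereal_scope.

(** This treats the half [A x = U z] with [z = D y]. Right invariance makes [Q2^T *m z] headed by
    [k.+1]; the random direction now appears on the side of [P], where no frame sees it, so it is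
    enough to bound the rest for every [g] and nothing is lost. *)
Lemma second_half dd (P Q : 'M[R]_n) (z : vec) (f : 'M[R]_n -> R) (B : \bar R) :
  (dd < n)%N -> measurable_fun setT f -> (forall U, (0 <= f U <= 1)%R) ->
  let k := (n - dd.+1)%N in let Q2 := Q *m householder k (Q^T *m z) in
  (forall g, haar dd (fun M => (f (P *m householder k g *m M *m Q2^T))%:E) <= B) ->
  haar dd.+1 (fun M => (f (P *m M *m Q^T))%:E) <= B.
Proof.
move=> ddn mf f01 k Q2 H; have kn := subnSS_lt ddn.
have f0 U : 0 <= (f U)%:E by rewrite lee_fin; case/andP: (f01 U).
have sS := householder_stab (Q^T *m z) kn.
rewrite -(haar_mulr ddn sS (measurable_conj P Q^T mf) (fun=> f0 _))/=.
rewrite -[leRHS](@integral_gauss_cst R n B).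
apply: ge0_le_integral.
- exact: measurableT.
- by move=> g _; apply: haar_ge0 => M; exact: f0.
- apply: (measurable_haar dd (F := fun w : 'cV[R]_n * 'M[R]_n =>
    (f (P *m (householder k w.1 *m w.2 *m householder k (Q^T *m z)) *m Q^T))%:E)).
    apply/measurable_EFinP; apply: (measurableT_comp mf).
    apply: measurable_mulmx; last exact: measurable_cst.
    apply: measurable_mulmx; first exact: measurable_cst.
    apply: measurable_mulmx; last exact: measurable_cst.
    apply: measurable_mulmx; last exact: measurable_snd.
    exact: (measurableT_comp (measurable_householder k) measurable_fst).
  by move=> v; exact: f0.
- exact: measurable_cst.
move=> g _; apply: le_trans (H g); rewrite le_eqVlt; apply/orP; left; apply/eqP.
apply: haar_eq; first exact: ltnW.
by move=> M _; congr (f _)%:E; rewrite /Q2 trmx_mul householder_tr !mulmxA.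
Qed.
Variables (J : finType) (lam : J -> R) (e : J -> vec) (nu : J -> R).
Hypothesis D_sym : D^T = D.
Hypothesis lam_inj : injective lam.
Hypothesis nu_neq0 : forall j, nu j != 0%R.
Hypothesis quadr : forall q : {poly R}, (size q <= #|J|)%N ->
  (\sum_j nu j * q.[lam j])%R = q.[0].
Hypothesis eps_ge0 : (0 <= eps)%R.
Local Notation frame := (frame D lam e nu).
Local Notation good := (good lam e nu).
Local Notation tau := (tau e).
Local Notation potential := (potential e nu).
Let mass : R := (\sum_j `|nu j|)%R.
Variable delta : R.
Hypothesis delta_gt0 : (0 < delta)%R.
(** The constants of the bound with [r] random directions still to be drawn: each direction
    contributes the factor and the summand of [half_step]. *)
Let cst_r (r : nat) : R := (eps ^+ 2 * mass ^+ 2 * (1 + 2 / delta) ^+ r)%R.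
Let add_r (r : nat) : R := (r%:R * (12 * #|J|%:R / delta ^+ 2))%R.
Let cst_r_ge0 r : (0 <= cst_r r)%R.
Proof.
by apply: mulr_ge0; [apply: mulr_ge0; exact: sqr_ge0|apply: exprn_ge0; rewrite addr_ge0// divr_ge0// ltW].
Qed.
Let add_r_ge0 r : (0 <= add_r r)%R.
Proof. by apply: mulr_ge0 => //; apply: divr_ge0; [exact: mulr_ge0|apply: exprn_ge0; exact: ltW]. Qed.

(** When the output wins, its squared residual is at most [eps ^+ 2], and [residual_bound] makes the
    right-hand side at least 1; otherwise the left-hand side is 0. The residual is measured after
    applying [U^T], where it becomes [D *m y - beta]. *)
Lemma won0_bound t (h : t.-tuple entry) k s K F (P Q M : 'M[R]_n) :
  orthogonal_mx P -> orthogonal_mx Q -> stab k M ->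
  frame K F -> (forall j, (0 < tau F K j)%R) -> (s < #|J|)%N ->
  (forall v, headed k v -> good F K s (Q *m v)) ->
  headed k (P^T *m query (w, h)) -> headed k (P^T *m b) -> Q *m (P^T *m b) = beta e nu ->
  (won 0 h (P *m M *m Q^T) <= eps ^+ 2 * mass ^+ 2 * potential F K)%R.
Proof.
move=> oP oQ sM fF tau0 sJ gQ hx hb Qb.
have pot0 : (0 <= potential F K)%R by apply: potential_ge0.
have c0 : (0 <= eps ^+ 2 * mass ^+ 2 * potential F K)%R.
  by rewrite mulr_ge0// mulr_ge0// sqr_ge0.
rewrite /won indicE; have [|_] := boolP (_ \in _); last by [].
move=> /set_mem; rewrite /winning/=; set U := P *m M *m Q^T => hU.
have oU : orthogonal_mx U.
  apply: orthogonalM; last exact: orthogonal_tr.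
  by apply: orthogonalM => //; exact: (proj1 sM).
have UTx := conj_mulTl Q sM hx; have UTb := conj_mulTl Q sM hb.
rewrite -/U in UTx UTb; clearbody U.
have rb := residual_bound D_sym lam_inj nu_neq0 quadr fF tau0 sJ (gQ _ hx).
have dE : dot (U *m D *m U^T *m query (w, h) - b) (U *m D *m U^T *m query (w, h) - b) =
    dot (D *m (Q *m (P^T *m query (w, h))) - beta e nu) (D *m (Q *m (P^T *m query (w, h))) - beta e nu).
  rewrite -[LHS](dot_orthogonal _ _ (orthogonal_tr oU)) !mulmxBr -!mulmxA.
  rewrite !(orthogonal_trK _ oU) UTx.
  by rewrite UTb Qb.
have d2 : (dot (U *m D *m U^T *m query (w, h) - b) (U *m D *m U^T *m query (w, h) - b) <= eps ^+ 2)%R.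
  rewrite -(sqr_sqrtr (dot_ge0 (U *m D *m U^T *m query (w, h) - b))) -euclidean_normE.
  by rewrite ler_pXn2r// nnegrE ?eps_ge0// sqrtr_ge0.
rewrite dE in d2; apply: (le_trans rb); rewrite -/mass -[leRHS]mulrA mulrC.
by apply: ler_wpM2r d2; rewrite mulr_ge0// sqr_ge0.
Qed.
(* Given the history, the unknown frame is [P *m M *m Q^T] where [M] follows the
   Haar measure of the stabilizer of the first [n - dd] basis vectors, and every
   vector [Q *m v] that the algorithm may use is good. *)
Lemma game_bound r t (h : t.-tuple entry) dd s K F (P Q : 'M[R]_n) :
  (2 * r < dd)%N -> (dd <= n)%N -> (K + r < n)%N -> (s + r < #|J|)%N ->
  (delta <= (n - (K + r))%:R)%R ->
  orthogonal_mx P -> orthogonal_mx Q ->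
  frame K F -> (forall j, (0 < tau F K j)%R) ->
  (forall v, headed (n - dd) v -> good F K s (Q *m v)) ->
  headed (n - dd) (P^T *m b) -> Q *m (P^T *m b) = beta e nu ->
  haar dd (fun M => (won r h (P *m M *m Q^T))%:E) <=
  (cst_r r.+1 * potential F K + add_r r.+1)%:E.
Proof.
elim: r t h dd s K F P Q => [|r IH] t h dd s K F P Q rdd ddn Kn sJ dK oP oQ fF tau0 gQ hb Qb.
  (* The output receives no answer, but its residual depends on [U^T x]; hence one last random
     direction, and [r.+1] of them for [r] answers. *)
  rewrite addn0 in Kn sJ dK; case: dd rdd ddn gQ hb => // dd _ ddn gQ hb.
  have := @half_step R n J D lam e nu dd K s F P Q (query (w, h)) (won 0 h)
    (eps ^+ 2 * mass ^+ 2)%R 0%R delta ddn Kn delta_gt0 dK oP oQ fF tau0 gQ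
    (measurable_won 0 h) (won01 _ h).
  rewrite add0r /cst_r /add_r expr1 mul1r; apply => //.
    by rewrite mulr_ge0// sqr_ge0.
  move=> S1 S2 F1 sS1 sS2 fF1 tau1 gQ2 hx; rewrite addr0.
  have kS : (n - dd.+1 <= n - dd)%N by exact: leq_sub2l.
  have PS1 : (P *m S1)^T *m b = P^T *m b.
    by rewrite trmx_mul -mulmxA (proj2 (stab_tr sS1)).
  have oPS : orthogonal_mx (P *m S1) by apply: orthogonalM => //; exact: (proj1 sS1).
  have oQS : orthogonal_mx (Q *m S2) by apply: orthogonalM => //; exact: (proj1 sS2).
  rewrite -[leRHS](@haar_cst R n dd).
  have p0 : (0 <= eps ^+ 2 * mass ^+ 2 * potential F1 K.+1)%R.
    by apply: mulr_ge0; [rewrite mulr_ge0// sqr_ge0|exact: potential_ge0].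
  apply: haar_le => //.
  - exact: ltnW.
  - by apply: measurable_conj; exact: measurable_won.
  - by move=> M; rewrite lee_fin; case/andP: (won01 0 h (P *m S1 *m M *m (Q *m S2)^T)).
  move=> M sM; rewrite lee_fin.
  apply: (@won0_bound t h (n - dd) s K.+1 F1) => //.
  - by rewrite addn0 in sJ.
  - by rewrite PS1; exact: headed_le hb.
  - by rewrite PS1 -mulmxA (proj2 sS2).
case: dd rdd ddn gQ hb => // dd rdd ddn gQ hb.
have rdd' : (2 * r < dd.-1)%N by move: rdd; rewrite mulnS; case: dd {ddn gQ hb} => // -[].
have Kn' : (K.+1 + r < n)%N by rewrite addSnnS.
have dK' : (delta <= (n - K)%:R)%R.
  by apply: le_trans dK _; rewrite ler_nat leq_sub2l// leq_addr.
have := @half_step R n J D lam e nu dd K s F P Q (query (w, h)) (won r.+1 h)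
    (cst_r r.+1) (add_r r.+1) delta ddn (leq_ltn_trans (leq_addr _ _) Kn) delta_gt0 dK' oP oQ fF tau0 gQ
    (measurable_won r.+1 h) (won01 _ h) (cst_r_ge0 _) (add_r_ge0 _).
have -> : (cst_r r.+1 * (1 + 2 / delta) = cst_r r.+2)%R by rewrite /cst_r [in RHS](exprS _ r.+1); ring.
have -> : (add_r r.+1 + 12 * #|J|%:R / delta ^+ 2 = add_r r.+2)%R.
  by rewrite /add_r -(natr1 r.+1) (mulrDl (r.+1)%:R) mul1r.
apply => S1 S2 F1 sS1 sS2 fF1 tau1 gQ2 hx.
have kS : (n - dd.+1 <= n - dd)%N by exact: leq_sub2l.
have PS1 : (P *m S1)^T *m b = P^T *m b.
  by rewrite trmx_mul -mulmxA (proj2 (stab_tr sS1)).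
have oP1 : orthogonal_mx (P *m S1) by apply: orthogonalM => //; exact: (proj1 sS1).
have oQ1 : orthogonal_mx (Q *m S2) by apply: orthogonalM => //; exact: (proj1 sS2).
have hb1 : headed (n - dd) ((P *m S1)^T *m b) by rewrite PS1; exact: headed_le hb.
have Qb1 : Q *m S2 *m ((P *m S1)^T *m b) = beta e nu by rewrite PS1 -mulmxA (proj2 sS2).
move: (P *m S1) (Q *m S2) oP1 oQ1 gQ2 hx hb1 Qb1 => {P Q oP oQ gQ hb Qb sS1 sS2 PS1} P Q oP oQ gQ hx hb Qb.
pose y := Q *m (P^T *m query (w, h)).
have gz : good F1 K.+1 s.+1 (D *m y) by apply: (good_mulD D_sym fF1); exact: gQ.
have gQ' v : headed (n - dd) v -> good F1 K.+1 s.+1 (Q *m v).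
  by move=> hv; apply: good_le (gQ v hv).
have sJ' : (s.+1 + r < #|J|)%N by rewrite addSnnS.
have dKS : (delta <= (n - (K.+1 + r))%:R)%R by rewrite addSnnS.
(* If [D *m y] lies in the known directions, [A x] is already determined and the round uses a single
   coordinate; otherwise a second reflection uses another one. *)
have [/headed_tail0 hz|tz] := eqVneq (tail (n - dd) (Q^T *m (D *m y))) 0%R.
  rewrite (haar_eq (f' := fun M => (won r [tuple of (query (w, h),
    resp (P *m (Q^T *m (D *m y)), y)) :: h] (P *m M *m Q^T))%:E)); last 2 first.
  - exact: ltnW.
  - by move=> M sM; rewrite (wonS _ sM hx hz).
  apply: (@IH t.+1 _ dd s.+1) => //; last exact: ltnW.
  by apply: leq_trans rdd' _; exact: leq_pred.
case: dd rdd rdd' ddn kS gQ gQ' hx hb tz => // dd rdd rdd' ddn kS gQ gQ' hx hb tz.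
have dn : (dd < n)%N by exact: ltnW.
apply: (@second_half dd P Q (D *m y)) => //.
- exact: measurable_won.
- exact: won01.
move=> g; have kn := subnSS_lt dn; set k := (n - dd.+1)%N in kn gQ gQ' hx hb tz *.
have kSd : (n - dd = k.+1)%N by rewrite /k -subSn// subSS.
set H := householder k g; set H2 := householder k _.
have sH : stab k H by exact: householder_stab.
have sH2 : stab k H2 by exact: householder_stab.
have PH v : headed k (P^T *m v) -> (P *m H)^T *m v = P^T *m v.
  by move=> hv; rewrite trmx_mul -mulmxA (proj2 (stab_tr sH)).
have QH v : headed k v -> Q *m H2 *m v = Q *m v.
  by move=> hv; rewrite -mulmxA (proj2 sH2).
have hz : headed k.+1 ((Q *m H2)^T *m (D *m y)).
  by rewrite trmx_mul householder_tr -mulmxA; exact: householder_headed.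
have yE : y = Q *m H2 *m ((P *m H)^T *m query (w, h)) by rewrite PH// QH.
rewrite yE in hz.
rewrite (haar_eq (f' := fun M => (won r [tuple of (query (w, h),
  resp (P *m H *m ((Q *m H2)^T *m (D *m y)), y)) :: h] (P *m H *m M *m (Q *m H2)^T))%:E)); last 2 first.
- exact: ltnW.
- move=> M; rewrite kSd => sM; rewrite yE.
  by rewrite (wonS _ sM _ hz)//= PH//; exact: headed_le hx.
apply: (@IH t.+1 _ dd s.+1) => //.
- exact: ltnW.
- by apply: orthogonalM => //; exact: (proj1 sH).
- by apply: orthogonalM => //; exact: (proj1 sH2).
- rewrite kSd; apply: good_extend => //.
  by rewrite orthogonal_Ktr.
- by rewrite kSd PH//; exact: headed_le hb.
- by rewrite PH// QH.
Qed.
End game.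

(** * Averaging over the coins of the algorithm *)

Lemma eq_indic (R : realType) (T S : Type) (A : set T) (B : set S) x y :
  (A x <-> B y) -> \1_A x = \1_B y :> R.
Proof.
move=> AB; rewrite !indicE; congr (nat_of_bool _)%:R.
by apply/idP/idP; rewrite !inE; case: AB.
Qed.

Section averaging.
Context {R : realType} {n : nat} {dO : measure_display} {Omega : measurableType dO}.
Local Notation vec := 'cV[R]_n.
Local Notation entry := (vec * (vec * vec))%type.
Variables (mu : probability Omega R) (query : forall t : nat, Omega * t.-tuple entry -> vec).
Variables (resp : vec * vec -> vec * vec) (D : 'M[R]_n) (b : vec) (eps : R).
Hypothesis mquery : forall t, measurable_fun setT (@query t).
Hypothesis mresp : measurable_fun setT resp.
Local Open Scope ereal_scope.

(** Yao's principle: a guarantee for every matrix holds on average over the Haar measure, and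
    exchanging the integrals reduces it to a bound for each fixed outcome of the coins. *)
Lemma averaging r t (h : t.-tuple entry) dd (P Q : 'M[R]_n) (p B : \bar R) :
  (dd <= n)%N -> 0 <= p ->
  (forall w, haar dd (fun M => (won query resp D b eps w r h (P *m M *m Q^T))%:E) <= B) ->
  (forall M, stab (n - dd) M ->
     p <= mu [set w | winning query resp D b eps w r h (P *m M *m Q^T)]) ->
  p <= B.
Proof.
move=> dn p0 hB hp.
pose F (z : Omega * 'M[R]_n) :=
  (won query resp D b eps z.1 r h (P *m z.2 *m Q^T))%:E : \bar R.
pose W := [set z : Omega * 'M[R]_n |
  winning query resp D b eps z.1 r h (P *m z.2 *m Q^T)].
have mW : measurable W.
  have mU : measurable_fun setT (fun z : Omega * 'M[R]_n => P *m z.2 *m Q^T).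
    apply: measurable_mulmx; last exact: measurable_cst.
    by apply: measurable_mulmx; [exact: measurable_cst|exact: measurable_snd].
  have := measurable_residual D b mquery mresp r measurable_fst mU
    (@measurable_cst _ _ _ _ _ h).
  move=> /(_ measurableT `]-oo, eps]%classic (measurable_itv _)); rewrite setTI.
  by congr measurable; apply/seteqP; split => U /=; rewrite in_itv.
have FE z : F z = (\1_W z)%:E by congr (_)%:E; exact: eq_indic.
have mF : measurable_fun setT F.
  rewrite (_ : F = fun z => (\1_W z)%:E); last exact/funext.
  by apply/measurable_EFinP; exact: measurable_indic.
have F0 z : 0 <= F z by rewrite FE lee_fin.
have IE M : \int[mu]_w F (w, M) =
    mu [set w | winning query resp D b eps w r h (P *m M *m Q^T)].
  under eq_integral do rewrite FE.
  rewrite -[X in _ = mu X]setIT -integral_indic//.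
  have := measurable_ysection M mW.
  by congr measurable; apply/seteqP; split => w; rewrite /ysection/= inE.
rewrite -[leLHS](@haar_cst R n dd).
apply: (@le_trans _ _ (haar dd (fun M => \int[mu]_w F (w, M)))).
  apply: haar_le => //.
  - exact: (@measurable_fun_fubini_tonelli_G _ _ _ _ _ mu F mF F0).
  - by move=> M; exact: integral_ge0.
  - by move=> M sM; rewrite IE; exact: hp.
rewrite -integral_haar//.
apply: (@le_trans _ _ (\int[mu]_w cst B w)).
  apply: ge0_le_integral.
  - exact: measurableT.
  - by move=> w _; apply: haar_ge0 => M; exact: F0.
  - exact: (measurable_haar dd mF F0).
  - exact: measurable_cst.
  - by move=> w _; exact: hB.
rewrite (integral_cst mu measurableT).
by rewrite [X in _ * X](_ : _ = 1) ?mule1//; exact: (@probability_setT _ _ _ mu).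
Qed.
End averaging.

Section execution.
Context {R : realType} {n : nat} {d : measure_display} {I : measurableType d}.
Variables (alg : algorithm R n I) (info : I).
Local Notation vec := 'cV[R]_n.

Definition informed_query (t : nat)
    (p : coins alg * t.-tuple (vec * (vec * vec))) : vec :=
  query alg t (p.1, info, p.2).

Lemma measurable_informed_query t : measurable_fun setT (@informed_query t).
Proof.
apply: (measurableT_comp (@measurable_query _ _ _ _ alg t)).
apply: measurable_fun_pair; last exact: measurable_snd.
by apply: measurable_fun_pair; [exact: measurable_fst|exact: measurable_cst].
Qed.

Lemma run_transcript resp D (U : 'M[R]_n) w r t :
  run informed_query resp D w U r (transcript (oracle_of resp D U) info w t) =
  output alg (oracle_of resp D U) info w (r + t).+1.
Proof.
elim: r t => [//|r IH] t.
by rewrite addSnnS -IH.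
Qed.
End execution.

(** * Conditioning of the hard instance *)

(** If [v] is an eigenvector of [A^T *m A], then [v *m U] is one of the squared diagonal matrix, so
    each singular value is the absolute value of a diagonal entry. *)
Lemma condition_number_conj (R : realType) n (U D : 'M[R]_n) (kappa : R) : 0 <= kappa ->
  orthogonal_mx U -> is_diag_mx D ->
  (forall i, (- kappa <= D i i <= -1) \/ (1 <= D i i <= kappa)) ->
  condition_number (U *m D *m U^T) <= kappa.
Proof.
move=> k0 oU dD hD; set A := U *m D *m U^T.
have sv s : singular_values A s -> 1 <= s <= kappa.
  move=> [s0 /eigenvalueP[v]]; rewrite !trmx_mul trmxK !mulmxA.
  rewrite -!mulmxA (mulmxA U^T U) oU mul1mx => vE v0.
  pose u := v *m U.
  have uE : u *m (D^T *m D) = s ^+ 2 *: u.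
    rewrite /u scalemxAl -vE -!mulmxA oU mulmx1 //.
  have u0 : u != 0.
    apply: contraNneq v0 => uz; have vu : v = u *m U^T.
      by rewrite /u -mulmxA (orthogonal_mxr oU) mulmx1.
    by rewrite vu uz mul0mx.
  have /rV0Pn[i ui] := u0.
  have /diag_mxP[d dE] := dD.
  have dii : D i i = d ord0 i by rewrite dE mxE eqxx.
  have : (u *m (D^T *m D)) ord0 i = D i i ^+ 2 * u ord0 i.
    by rewrite dii dE tr_diag_mx mulmxA mul_mx_diag mxE mul_mx_diag mxE; ring.
  rewrite uE mxE => /(mulIf ui) sE.
  by case: (hD i) => ?; nra.
(* The set is empty when [n = 0]; its supremum is then 0, and so is the quotient. *)
have [E|/set0P ne] := eqVneq (singular_values A) set0.
  by rewrite /condition_number E sup0 mul0r.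
have i1 : 1 <= inf (singular_values A) by apply: lb_le_inf => // s /sv/andP[].
have sk : sup (singular_values A) <= kappa by apply: ge_sup => // s /sv/andP[].
rewrite /condition_number ler_pdivrMr ?(lt_le_trans _ i1)//.
by apply: le_trans sk _; rewrite ler_peMr.
Qed.

Lemma unitmx_conj (R : realType) n (U D : 'M[R]_n) :
  orthogonal_mx U -> is_diag_mx D -> (forall i, D i i != 0) ->
  U *m D *m U^T \in unitmx.
Proof.
move=> oU dD D0; have /diag_mxP[d dE] := dD.
have uU : U \in unitmx by have [] := mulmx1_unit (orthogonal_mxr oU).
rewrite !unitmx_mul uU unitmx_tr uU unitmxE dE det_diag unitfE/= andbT.
apply/prodf_neq0 => i _; move: (D0 i).
by rewrite dE mxE eqxx.
Qed.

(** * The hard instance *)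

Section blocks.
Context {R : realType} {n : nat} {J : finType}.
Variables (m : nat) (lam nu : J -> R).
Hypothesis Jm : (#|J| * m <= n)%N.
Hypothesis m_gt0 : (0 < m)%N.

(** Consecutive blocks of [m] coordinates carry the values of [lam]; the coordinates beyond the last
    block receive the admissible value 1. *)
Definition block_value (l : nat) : R :=
  if insub (l %/ m)%N is Some r then lam (enum_val (r : 'I_#|J|)) else 1.

Definition block_diag : 'M[R]_n := diag_mx (\row_l block_value l).

Definition block_head (j : J) : 'cV[R]_n := basis n (enum_rank j * m)%N.

Lemma shift_proof c (l : 'I_n) : ((l + c) %% n < n)%N.
Proof. by rewrite ltn_mod; case: n l => // -[]. Qed.

Definition shift c (l : 'I_n) : 'I_n := Ordinal (shift_proof c l).

Lemma shift_inj c : injective (shift c).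
Proof.
move=> l l' /(congr1 val)/=/eqP; rewrite eqn_modDr !modn_small// => /eqP.
exact: val_inj.
Qed.
(* The cyclic shift that moves the last [m] coordinates onto the block of [j]. *)
Definition block_perm (j : J) : 'S_n := perm (@shift_inj (m + enum_rank j * m)).

Definition block_frame j : 'M[R]_n := (perm_mx (block_perm j))^T.

Lemma block_perm_tail j (l : 'I_n) : (n - m <= l)%N ->
  block_perm j l = (enum_rank j * m + (l - (n - m)))%N :> nat.
Proof.
move=> nl; rewrite permE/=.
have mn : (m <= n)%N.
  by apply: leq_trans Jm; rewrite leq_pmull// (leq_ltn_trans _ (ltn_ord (enum_rank j))).
have -> : (l + (m + enum_rank j * m) = n + (enum_rank j * m + (l - (n - m))))%N.
  by move: (enum_rank j * m)%N; lia.
rewrite modnDl modn_small//; have lm : (l - (n - m) < m)%N by have := ltn_ord l; lia.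
apply: leq_trans Jm; apply: leq_trans (_ : (enum_rank j).+1 * m <= _)%N.
  by rewrite mulSn addnC ltn_add2r.
by rewrite leq_mul2r ltn_ord orbT.
Qed.

Lemma block_perm_div j (l : 'I_n) : (n - m <= l)%N ->
  (block_perm j l %/ m = enum_rank j)%N.
Proof.
move=> nl; rewrite block_perm_tail// divnMDl// divn_small ?addn0//.
have := ltn_ord l; have : (m <= n)%N.
  by apply: leq_trans Jm; rewrite leq_pmull// (leq_ltn_trans _ (ltn_ord (enum_rank j))).
lia.
Qed.

Lemma block_frame_tr j (v : 'cV[R]_n) l :
  ((block_frame j)^T *m v) l ord0 = v (block_perm j l) ord0.
Proof. by rewrite trmxK -row_permE mxE. Qed.

Lemma block_frame_orthogonal j : orthogonal_mx (block_frame j).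
Proof. by rewrite /orthogonal_mx /block_frame trmxK tr_perm_mx -perm_mxM mulgV perm_mx1. Qed.

Lemma block_head_perm i j (l : 'I_n) : (n - m <= l)%N ->
  block_head i (block_perm j l) ord0 = ((i == j) && (l == n - m :> nat)%N)%:R.
Proof.
move=> nl; rewrite mxE; congr (nat_of_bool _)%:R.
have [<-|ij] := eqVneq i j.
  by rewrite block_perm_tail// -[X in _ == X]addn0 eqn_add2l subn_eq0 eqn_leq nl andbT.
apply/negbTE; apply: contra ij => /eqP E; apply/eqP/enum_rank_inj/val_inj => /=.
by rewrite -(block_perm_div j nl) E mulnK.
Qed.

Lemma tail_block_head i j : tail (n - m) ((block_frame j)^T *m block_head i) =
  (i == j)%:R *: basis n (n - m).
Proof.
apply/colP => l; rewrite tailP block_frame_tr.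
have -> : ((i == j)%:R *: basis n (n - m)) l ord0 = ((i == j) && (l == n - m :> nat)%N)%:R :> R.
  by rewrite 2!mxE -natrM mulnb.
case: leqP => nl; first by rewrite block_head_perm.
by rewrite ltn_eqF// andbF.
Qed.

Lemma block_head_orthonormal i j : dot (block_head i) (block_head j) = (i == j)%:R.
Proof.
have h : (enum_rank i * m < n)%N.
  apply: leq_trans Jm; apply: leq_trans (_ : (enum_rank i).+1 * m <= _)%N.
    by rewrite mulSn -[X in (X < _)%N]add0n ltn_add2r.
  by rewrite leq_mul2r ltn_ord orbT.
rewrite dot_basis mxE/= eqn_pmul2r//; congr (nat_of_bool _)%:R.
by rewrite (inj_eq val_inj) (inj_eq enum_rank_inj).
Qed.

Lemma tau_block j : (n - m < n)%N -> tau block_head block_frame (n - m) j = 1.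
Proof.
by move=> h; rewrite /tau tail_block_head eqxx scale1r (dot_basis h) mxE eqxx.
Qed.

Lemma frame_block : frame block_diag lam block_head nu (n - m) block_frame.
Proof.
move=> j; split; first exact: block_frame_orthogonal.
  move=> v; apply: (can_inj (fun w => orthogonal_Ktr w (block_frame_orthogonal j))).
  apply/colP => l; rewrite block_frame_tr mul_diag_mx mxE.
  rewrite -scalemxAr [RHS]mxE (orthogonal_trK _ (block_frame_orthogonal j)).
  rewrite -block_frame_tr (orthogonal_trK _ (block_frame_orthogonal j)) tailP mxE.
  case: leqP => nl; last by rewrite !mulr0.
  rewrite /block_value block_perm_div//; case: insubP => [r _ /val_inj ->|].
    by rewrite enum_rankK.
  by rewrite ltn_ord.
rewrite tail_block_head eqxx scale1r /beta mulmx_sumr; apply/colP => l.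
rewrite tailP summxE [RHS]mxE [X in _ = _ * X]mxE.
case: leqP => nl; last by rewrite ltn_eqF// mulr0.
move: (\sum_j `|nu j|) => c; rewrite (bigD1 j)//= big1 ?addr0 => [|i ij].
  by rewrite -scalemxAr [LHS]mxE block_frame_tr block_head_perm// eqxx.
by rewrite -scalemxAr [LHS]mxE block_frame_tr block_head_perm// (negbTE ij) mulr0.
Qed.
Hypothesis nu_neq0 : forall j, nu j != 0.

Lemma block_diag_itv k i : 1 <= k ->
  (forall j, (- k <= lam j <= -1) \/ (1 <= lam j <= k)) ->
  (- k <= block_diag i i <= -1) \/ (1 <= block_diag i i <= k).
Proof.
move=> k1 hl; rewrite mxE eqxx mxE /block_value; case: insub => [r|]; first exact: hl.
by right; rewrite lexx.
Qed.
Hypothesis J_gt0 : (0 < #|J|)%N.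
Let mass : R := \sum_j `|nu j|.

Lemma mass_gt0 : 0 < mass.
Proof.
have /card_gt0P[j _] := J_gt0.
rewrite /mass (bigD1 j)//= ltr_pwDl ?normr_gt0//.
by apply: sumr_ge0.
Qed.

Lemma sum_weights : \sum_j `|nu j| / mass = 1.
Proof. by rewrite -mulr_suml mulfV// gt_eqF// mass_gt0. Qed.

Lemma potential_block : (n - m < n)%N -> potential block_head nu block_frame (n - m) = 1.
Proof.
move=> h; rewrite -[RHS]sum_weights; apply: eq_bigr => j _.
by rewrite tau_block// divr1.
Qed.

Lemma dot_beta : dot (beta block_head nu) (beta block_head nu) = 1.
Proof.
have := mass_gt0; have := sum_weights; rewrite /beta /mass.
move: (\sum_j `|nu j|) => c c1 c0; rewrite -[RHS]c1 dot_suml; apply: eq_bigr => j _.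
rewrite dotZl dotC dot_suml (bigD1 j)//= big1 => [|i ij]; last first.
  by rewrite dotZl block_head_orthonormal (negbTE ij) mulr0.
rewrite dotZl block_head_orthonormal eqxx mulr1 addr0 -expr2 sqr_sqrtr//.
by rewrite divr_ge0// ltW.
Qed.
End blocks.

(** * Choice of the constants and conclusion *)

(** The assumed upper bound on [T] is what gives [mass ^+ 2 <= eps^-1], as [mass ^+ 2] is at most
    [expR (4 / kappa) ^+ T]; the constant 1/4 comes from this exponent. The first term is then at
    most [eps * (39 / 37)], and the second at most 36/1521. *)
Lemma game_value_lt (R : realType) (T N : nat) (kappa eps mass : R) :
  (0 < T)%N -> 2 <= kappa -> 0 < eps -> eps <= 1 / 4 ->
  T%:R < 1 / 4 * kappa * ln (1 / eps) ->
  0 <= mass -> mass <= ((kappa + 1) / (kappa - 1)) ^+ T./2 -> (N <= 3 * T)%N ->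
  eps ^+ 2 * mass ^+ 2 * (1 + 2 / (39 * T%:R)) ^+ T +
    T%:R * (12 * N%:R / (39 * T%:R) ^+ 2) < 2 / 3.
Proof.
move=> T0 k2 e0 ec Tlt m0 mle NT.
have t0 : 0 < T%:R :> R by rewrite ltr0n.
have k0 : 0 < kappa by lra.
have base : (kappa + 1) / (kappa - 1) <= expR (4 / kappa).
  apply: le_trans (expR_ge1Dx _); rewrite ler_pdivrMr; last by lra.
  rewrite -(ler_pM2r k0) mulrAC [X in _ <= X](_ : _ = (kappa + 4) * (kappa - 1)).
    by nra.
  by field; rewrite gt_eqF.
have base1 : 1 <= (kappa + 1) / (kappa - 1) by rewrite ler_pdivlMr; lra.
have mass2 : mass ^+ 2 <= eps^-1.
  apply: (@le_trans _ _ (((kappa + 1) / (kappa - 1)) ^+ T)).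
    apply: (@le_trans _ _ (((kappa + 1) / (kappa - 1)) ^+ (T./2 * 2))).
      by rewrite exprM ler_pXn2r// nnegrE// (le_trans m0).
    by rewrite ler_weXn2l// muln2 -[leqRHS]odd_double_half leq_addl.
  apply: (@le_trans _ _ (expR (4 / kappa) ^+ T)).
    by rewrite ler_pXn2r// ?nnegrE ?expR_ge0//; lra.
  rewrite -expRM_natl -[leRHS]lnK ?posrE ?invr_gt0// ler_expR.
  apply: ltW; move: Tlt; rewrite (div1r eps) => Tlt.
  by rewrite mulrA ltr_pdivrMr//; lra.
have exp2 : (1 + 2 / (39 * T%:R)) ^+ T <= 39 / 37 :> R.
  have x0 : 0 <= 2 / (39 * T%:R) :> R by rewrite divr_ge0// mulr_ge0.
  apply: (@le_trans _ _ (expR (2 / (39 * T%:R)) ^+ T)).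
    by rewrite ler_pXn2r ?expR_ge1Dx// nnegrE ?expR_ge0// addr_ge0.
  rewrite -expRM_natl [X in expR X](_ : _ = 2 / 39); last by field; rewrite gt_eqF.
  (* An upper bound on the exponential from the lower bound [1 - x <= expR (- x)], by inversion. *)
  have := expR_ge1Dx (- (2 / 39) : R); rewrite expRN.
  have := expR_gt0 (2 / 39 : R); set X := expR _ => X0 h.
  have : (1 - 2 / 39) * X <= 1 by rewrite -ler_pdivlMr// div1r.
  by lra.
have a1 : eps ^+ 2 * mass ^+ 2 * (1 + 2 / (39 * T%:R)) ^+ T <= eps * (39 / 37).
  apply: (@le_trans _ _ (eps ^+ 2 * eps^-1 * (39 / 37))); last first.
    by rewrite expr2 mulfK// gt_eqF.
  have e2 := sqr_ge0 eps; have m2 := sqr_ge0 mass.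
  apply: ler_pM => //; first by rewrite mulr_ge0.
  by apply: ler_wpM2l.
have a2 : T%:R * (12 * N%:R / (39 * T%:R) ^+ 2) <= 36 / 1521 :> R.
  have : N%:R <= 3 * T%:R :> R by rewrite -natrM ler_nat.
  move: (N%:R : R) (T%:R : R) t0 => x t {}t0 xt; clear -t0 xt.
  rewrite (_ : _ * _ = 12 * x / (1521 * t)); last by field; rewrite gt_eqF.
  by rewrite ler_pdivrMr; lra.
apply: le_lt_trans (lerD a1 a2) _; clear -ec e0; lra.
Qed.

(** [D] is fixed before the algorithm and [info] is arbitrary, so revealing [D] changes nothing:
    only [U] is random. *)
Lemma query_lower_bound (R : realType) (T n : nat) (kappa eps : R) :
  (0 < T)%N -> (120 * T ^ 2 <= n)%N -> 2 <= kappa -> 0 < eps -> eps <= 1 / 4 ->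
  exists D : 'M[R]_n, [/\ is_diag_mx D,
    forall i, (- kappa <= D i i <= -1) \/ (1 <= D i i <= kappa) &
    forall (resp : 'cV[R]_n * 'cV[R]_n -> 'cV[R]_n * 'cV[R]_n) d (I : measurableType d)
      (alg : algorithm R n I) (info : I), measurable_fun setT resp ->
      (forall U, orthogonal_mx U ->
        succeeds alg T (oracle_of resp D U) info (U *m D *m U^T) (basis n 0) eps) ->
      1 / 4 * kappa * ln (1 / eps) <= T%:R].
Proof.
move=> T0 nT k2 e0 ec.
have n0 : (0 < n)%N by apply: leq_trans nT; rewrite muln_gt0 expn_gt0 T0.
have [|lam [nu [lam_inj lam_itv nu0 quadr massle]]] := @quadrature R kappa T./2; first by lra.
set J : finType := ('I_T./2.+1 * bool)%type in lam nu lam_inj lam_itv nu0 quadr massle.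
have cJ : #|J| = (2 * T./2.+1)%N by rewrite card_prod card_ord card_bool mulnC.
have Th := odd_double_half T; rewrite -muln2 in Th.
have TJ : (T < #|J|)%N by rewrite cJ; case: (odd T) Th => /= Th; lia.
have J3 : (#|J| <= 3 * T)%N by rewrite cJ; case: (odd T) Th => /= Th; lia.
(* At most [T] directions are removed from each eigenspace, so a dimension of at least [39 * T]
   remains throughout; at most [3 * T] blocks of this size fit in dimension [120 * T ^ 2]. *)
pose m := (40 * T)%N.
have m0 : (0 < m)%N by rewrite muln_gt0.
have Jm : (#|J| * m <= n)%N.
  apply: leq_trans nT; apply: leq_trans (_ : 3 * T * m <= _)%N; first by rewrite leq_mul2r J3 orbT.
  by rewrite /m expnS expn1; lia.
have mn : (m <= n)%N by apply: leq_trans Jm; rewrite leq_pmull// (leq_trans _ TJ).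
have nm : (n - m < n)%N by lia.
have n1 : (n - n.-1 = 1)%N by lia.
pose D := block_diag (n := n) m lam.
pose e : J -> 'cV[R]_n := block_head m; pose F := block_frame (R := R) (n := n) (J := J) m.
have J0 : (0 < #|J|)%N by exact: leq_trans TJ.
exists D; split.
- exact: diag_mx_is_diag.
- by move=> i; apply: block_diag_itv => //; lra.
move=> resp d I alg info mresp sol.
rewrite leNgt; apply/negP => Tlt.
have bb : dot (beta e nu) (beta e nu) = 1 by apply: dot_beta.
have b0 : tail 0 (beta e nu) = beta e nu by apply/colP => i; rewrite tailP.
(* As [Q] sends the first basis vector to [beta], every [U = M *m Q^T] with [M] in [stab 1] maps
   [beta] to [b]; this leaves [n.-1] coordinates for the Haar integration. *)
pose Q := householder 0 (beta e nu).
have Qb : Q *m basis n 0 = beta e nu.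
  by rewrite householder_basis// b0 ?bb ?sqrtr1 ?invr1 ?scale1r// -dot_eq0 bb oner_neq0.
have oQ : orthogonal_mx Q by have [] := householder_stab (beta e nu) n0.
have fF : frame D lam e nu (n - m) F by apply: frame_block.
have tF j : 0 < tau e F (n - m) j by rewrite tau_block.
pose mass := \sum_j `|nu j|.
pose B := eps ^+ 2 * mass ^+ 2 * (1 + 2 / (39 * T%:R)) ^+ T +
  T%:R * (12 * #|J|%:R / (39 * T%:R) ^+ 2).
have Bs : B < 2 / 3.
  by apply: (@game_value_lt R T #|J| kappa) => //; apply: sumr_ge0.
have : ((2 / 3 : R)%:E <= B%:E)%E; last by rewrite lee_fin leNgt Bs.
apply: (@averaging R n _ (coins alg) (coins_prob alg) (informed_query info) resp D
  (basis n 0) eps (measurable_informed_query info) mresp T.-1 0 [tuple] n.-1 1%:M Q).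
- exact: leq_pred.
- by rewrite lee_fin.
- move=> w.
  have := @game_bound R n _ (coins alg) (informed_query info) resp D (basis n 0) eps
    (measurable_informed_query info) mresp w J lam e nu.
  have DT : D^T = D by exact: tr_diag_mx.
  have d0 : 0 < 39 * T%:R :> R by rewrite mulr_gt0// ltr0n.
  have qJ (q : {poly R}) : (size q <= #|J|)%N -> \sum_j nu j * q.[lam j] = q.[0].
    by rewrite cJ; exact: quadr.
  move=> /(_ DT lam_inj nu0 qJ (ltW e0) _ d0 T.-1 0 [tuple] n.-1 1 (n - m) F 1%:M Q)%N.
  rewrite prednK// potential_block// mulr1 n1; apply => //.
  - by move: nT; rewrite expnS expn1; nia.
  - exact: leq_pred.
  - by rewrite /m; lia.
  - by rewrite add1n prednK.
  - by rewrite -natrM ler_nat /m; lia.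
  - exact: orthogonal1.
  - move=> v hv; rewrite (headed_split n0 hv) mulmxDr; apply: goodD.
      rewrite (_ : v - tail 0 v = 0) ?mulmx0; last by apply/colP => i; rewrite !mxE/= subrr.
      exists 0 => [|j]; first by rewrite size_poly0.
      by rewrite horner0 mulr0 scale0r mulmx0 tail_headed// => i _; rewrite mxE.
    rewrite -scalemxAr Qb; apply: goodZ; exact: good_beta.
  - by rewrite trmx1 mul1mx; exact: headed_basis.
  - by rewrite trmx1 mul1mx.
rewrite n1 => M sM; set U := 1%:M *m M *m Q^T.
have oU : orthogonal_mx U.
  apply: orthogonalM; last exact: orthogonal_tr.
  by apply: orthogonalM; [exact: orthogonal1|exact: (proj1 sM)].
have nb : euclidean_norm (basis n 0 : 'cV[R]_n) = 1.
  by rewrite euclidean_normE (dot_basis n0) mxE/= sqrtr1.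
have rE w : run (informed_query info) resp D w U T.-1 [tuple] =
    output alg (oracle_of resp D U) info w T.
  by have := run_transcript info resp D U w T.-1 0; rewrite addn0 prednK.
have := sol U oU; rewrite /succeeds nb mulr1 => /le_trans; apply.
rewrite le_eqVlt; apply/orP; left; apply/eqP; congr (coins_prob alg _).
by apply/seteqP; split => w; rewrite /winning/= rE.
Qed.

Theorem theorem1 (R : realType) :
  exists c C : R, 0 < c /\ 0 < C /\
  forall kappa eps : R, C <= kappa -> 0 < eps -> eps <= c ->
    (* (i) *)
    (forall (T : nat) (alg : forall n : nat, algorithm R n 'cV[R]_n),
       (0 < T)%N ->
       (forall n : nat, solves_well_conditioned T kappa eps (alg n)) ->
       c * kappa * ln (1 / eps) <= T%:R) /\
    (* (ii) *)
    (forall (T : nat)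
            (alg : forall n : nat, algorithm R n ('cV[R]_n * 'M[R]_n)%type),
       (0 < T)%N ->
       (forall n : nat, solves_symmetric T kappa eps (alg n)) ->
       c * kappa * ln (1 / eps) <= T%:R) /\
    (* (iii) *)
    (forall T n : nat, (0 < T)%N -> C * T%:R ^+ 2 <= n%:R ->
       (forall alg : algorithm R n 'cV[R]_n,
          solves_well_conditioned T kappa eps alg ->
          c * kappa * ln (1 / eps) <= T%:R) /\
       (forall alg : algorithm R n ('cV[R]_n * 'M[R]_n)%type,
          solves_symmetric T kappa eps alg ->
          c * kappa * ln (1 / eps) <= T%:R)).
Proof.
exists (1 / 4), 120; split; first by lra.
split; first by lra.
move=> kappa eps k120 e0 ec.
have k2 : 2 <= kappa by lra.
have wc (T n : nat) (alg : algorithm R n 'cV[R]_n) : (0 < T)%N -> (120 * T ^ 2 <= n)%N ->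
    solves_well_conditioned T kappa eps alg -> 1 / 4 * kappa * ln (1 / eps) <= T%:R.
  move=> T0 nT sol; have [D [dD hD]] := query_lower_bound T0 nT k2 e0 ec.
  (* The instance is symmetric, so the answer [(A x, A^T x)] is computed from the first half of the
     stronger oracle. *)
  move=> /(_ (fun z => (z.1, z.1)) _ _ alg (basis n 0)); apply.
    by apply: measurable_fun_pair; exact: measurable_fst.
  move=> U oU; have AT : (U *m D *m U^T)^T = U *m D *m U^T.
    have /diag_mxP[v ->] := dD.
    by rewrite !trmx_mul trmxK tr_diag_mx mulmxA.
  have /sol : U *m D *m U^T \in unitmx.
    by apply: unitmx_conj => // i; case: (hD i) => /andP[? ?]; apply/eqP; lra.
  have cn : condition_number (U *m D *m U^T) <= kappa.
    by apply: condition_number_conj => //; lra.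
  by move=> /(_ (basis n 0) cn); rewrite AT.
have sy (T n : nat) (alg : algorithm R n ('cV[R]_n * 'M[R]_n)%type) :
    (0 < T)%N -> (120 * T ^ 2 <= n)%N ->
    solves_symmetric T kappa eps alg -> 1 / 4 * kappa * ln (1 / eps) <= T%:R.
  move=> T0 nT sol; have [D [dD hD]] := query_lower_bound T0 nT k2 e0 ec.
  move=> /(_ id _ _ alg (basis n 0, D)); apply; first exact: measurable_id.
  by move=> U oU; exact: sol.
(* An algorithm that works in every dimension is used in the smallest admissible one. *)
split=> [T alg T0 sol|]; first exact: (wc T (120 * T ^ 2)%N).
split=> [T alg T0 sol|T n T0 nT]; first exact: (sy T (120 * T ^ 2)%N).
have {}nT : (120 * T ^ 2 <= n)%N by rewrite -(ler_nat R) natrM natrX.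
by split=> alg; [exact: wc|exact: sy].
Qed.
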